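(* Let $\mathbf u(\mathbf x,t)=(\rho,\mathbf m,\rho\theta)^T$ be a smooth solution (with values in the admissible set $\mathcal A$) of the atmospheric Euler equations and let $\mathbf u_h=\mathcal I_h\mathbf u(\cdot,t_n)$ be its Lagrange interpolant at time $t_n$, with nodal values $\mathsf U_i=\mathbf u(\mathbf x_i,t_n)=(\varrho_i,\mathsf M_i,\Theta_i)^T$ and $\vartheta_i=\Theta_i/\varrho_i$. Then: (i) The pressure and gravity term admit a first-order approximation as follows: $$\int_D(\nabla p+\rho g\,\hat{\mathbf e}_d)\varphi_i\,dx=\tilde c\,\varrho_i\vartheta_i\sum_{j\in\mathcal I(i)}\big((\varrho_j^{\ast,i}\vartheta_j)^{\gamma-1}-(\varrho_i^{\ast,j}\vartheta_i)^{\gamma-1}\big)\mathbf c_{ij}+\mathcal O(h).$$ (ii) For $\gamma>1$ and under the mild mesh regularity assumption (M) stated in the context, the pressureless flux $\mathbf g(\mathbf u)$ can be approximated as follows: $$\int_D\nabla\cdot\mathbf g(\mathbf u)\,\varphi_i\,dx=\sum_{j\in\mathcal I(i)}\big(\mathbf g(\mathsf U_i^{\ast,j})+\mathbf g(\mathsf U_j^{\ast,i})\big)\mathbf c_{ij}+\mathcal O(h).$$ Here $i\in\mathcal V$ is an arbitrary interior degree of freedom (that is, $\mathbf x_i\notin\partial D$).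
   Context: PDE. $D\subset\mathbb R^d$ is a polygonal domain, $\hat{\mathbf e}_d=\nabla x_d$, the scalar $g$ is the gravitational acceleration (not to be confused with the flux $\mathbf g$), $\gamma=c_p/c_v$ is the ratio of specific heat capacities, $C_{\rm eos}>0$ is a constant, $\tilde c:=C_{\rm eos}\gamma/(\gamma-1)$. For $\mathbf u=(\rho,\mathbf m,\rho\theta)^T\in\mathbb R^{d+2}$ put $\mathbf v=\mathbf m/\rho$ and $p(\mathbf u)=C_{\rm eos}(\rho\theta)^\gamma$. The atmospheric Euler equations are $\partial_t\rho+\nabla\cdot\mathbf m=0$, $\partial_t\mathbf m+\nabla\cdot(\rho^{-1}\mathbf m\otimes\mathbf m+p(\mathbf u)I_d)=-\rho g\hat{\mathbf e}_d$, $\partial_t(\rho\theta)+\nabla\cdot(\mathbf v\rho\theta)=0$. The admissible set is $\mathcal A=\{\mathbf u:\rho>0,\theta>0\}$. The pressureless flux is $\mathbf g(\mathbf u)=(\mathbf m,\rho^{-1}\mathbf m\otimes\mathbf m,\mathbf v\rho\theta)^T$; for $\mathbf c\in\mathbb R^d$, $\mathbf g(\mathbf u)\mathbf c=(\mathbf v\cdot\mathbf c)\,\mathbf u$. Discretization. $\mathcal T_h$ is a shape and form regular mesh of $D$ of quadrilaterals ($d=2$) or hexahedra ($d=3$) with mesh size $h$; $\{\varphi_i\}_{i\in\mathcal V}$ is the nodal Lagrange basis of the continuous (bi-/tri-)linear finite element space, with nodes $\mathbf x_i$ and $z_i:=(\mathbf x_i)_d$. $m_{ij}=\int_D\varphi_i\varphi_j\,dx$,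 $\mathbf c_{ij}=\int_D\varphi_i\nabla\varphi_j\,dx\in\mathbb R^d$, $\mathcal I(i)=\{j\in\mathcal V:m_{ij}\ne0\}$. Hydrostatic star states. For $j\in\mathcal I(i)$, with $\mathsf V_i=\mathsf M_i/\varrho_i$ and $\bar\vartheta_{ij}=\tfrac12(\vartheta_i+\vartheta_j)$, $$\varrho_i^{\ast,j}=\Big(\varrho_i^{\gamma-1}+\frac{g}{\tilde c\,\bar\vartheta_{ij}\,\vartheta_i^{\gamma-1}}\max(0,z_i-z_j)\Big)^{1/(\gamma-1)},\qquad \mathsf U_i^{\ast,j}=(\varrho_i^{\ast,j},\ \mathsf V_i\varrho_i^{\ast,j},\ \vartheta_i\varrho_i^{\ast,j})^T.$$ Mesh assumption (M). Set $h_{ij}:=\max(0,z_i-z_j)$. The index sets $\{j\in\mathcal I(i):h_{ji}>0\}$ and $\{k\in\mathcal I(i):h_{ik}>0\}$ have equal cardinality and can be matched up pairwise such that $(1+\mathcal O(h))\,h_{ji}\,\mathbf c_{ij}=-h_{ik}\,\mathbf c_{ik}$ for every matched pair $(j,k)$. *)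

(* Defs.v *)
From HB Require Import structures.
From mathcomp Require Import all_boot all_order all_algebra.
From mathcomp Require Import all_classical all_reals all_analysis.
Set Implicit Arguments.
Unset Strict Implicit.
Unset Printing Implicit Defensive.
Import Order.TTheory GRing.Theory Num.Theory.
Import numFieldNormedType.Exports.
Local Open Scope classical_set_scope.
Local Open Scope ring_scope.

(* Lebesgue measure on R^n, on the Borel sets of n.-tuple R: the n-fold product
   of the one-dimensional Lebesgue measure. *)
Section lebesgue_tuple.
Variable R : realType.
Let RM := measurableTypeR R.

Definition tcons n (p : RM * n.-tuple RM) : n.+1.-tuple RM :=
  [tuple of p.1 :: p.2].

Definition tuncons n (t : n.+1.-tuple RM) : RM * n.-tuple RM :=
  (thead t, [tuple of behead t]).

Lemma tconsK n : cancel (@tcons n) (@tuncons n).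
Proof. by move=> [x t]; congr pair; apply/val_inj. Qed.

Lemma tunconsK n : cancel (@tuncons n) (@tcons n).
Proof. by move=> t; rewrite [in RHS](tuple_eta t); apply/val_inj. Qed.

Lemma measurable_tcons n : measurable_fun setT (@tcons n).
Proof. exact: measurable_cons. Qed.

Lemma measurable_tuncons n : measurable_fun setT (@tuncons n).
Proof.
apply/measurable_fun_pairP; split.
  exact: measurable_tnth.
exact: measurable_behead.
Qed.

Section step.
Variables (n : nat) (mu : {sigma_finite_measure set (n.-tuple RM) -> \bar R}).

Definition lebesgue_tupleS : set (n.+1.-tuple RM) -> \bar R :=
  pushforward (@lebesgue_measure R \x mu)%E (@tcons n).

Let lebesgue_tupleS0 : lebesgue_tupleS set0 = 0%E.
Proof. by rewrite /lebesgue_tupleS /pushforward preimage_set0 measure0. Qed.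

Let lebesgue_tupleS_ge0 A : (0 <= lebesgue_tupleS A)%E.
Proof. by rewrite /lebesgue_tupleS /pushforward measure_ge0. Qed.

Let lebesgue_tupleS_sigma_additive : semi_sigma_additive lebesgue_tupleS.
Proof.
have mt A : measurable A -> measurable (@tcons n @^-1` A).
  by move=> mA; rewrite -[X in measurable X]setTI; exact: measurable_tcons.
move=> F mF tF mUF; rewrite /lebesgue_tupleS /pushforward preimage_bigcup.
apply: measure_semi_sigma_additive.
- by move=> k; exact: mt.
- apply/trivIsetP => /= i j _ _ ij; rewrite -preimage_setI.
  by move/trivIsetP : tF => /(_ _ _ _ _ ij) ->//; rewrite preimage_set0.
- by rewrite -preimage_bigcup; exact: mt.
Qed.

HB.instance Definition _ := isMeasure.Build _ _ _ lebesgue_tupleS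
  lebesgue_tupleS0 lebesgue_tupleS_ge0 lebesgue_tupleS_sigma_additive.

Let lebesgue_tupleS_sigma_finite : sigma_finite setT lebesgue_tupleS.
Proof.
have /sigma_finiteP[F [TF ndF Foo]] := sigma_finiteT (@lebesgue_measure R).
have /sigma_finiteP[G [TG ndG Goo]] := sigma_finiteT mu.
exists (fun k => @tuncons n @^-1` (F k `*` G k)).
  rewrite -preimage_bigcup (_ : \bigcup_k _ = setT) ?preimage_setT//.
  rewrite -setXTT TF TG predeqE => -[x y]; split.
    by move=> [k _ []/= ? ?]; split; exists k.
  move=> [/= [j _ Fjx] [k _ Gky]]; exists (maxn j k) => //; split.
    by move: x Fjx; exact/subsetPset/ndF/leq_maxl.
  by move: y Gky; exact/subsetPset/ndG/leq_maxr.
move=> k; have [mF Fk] := Foo k; have [mG Gk] := Goo k; split.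
  rewrite -[X in measurable X]setTI; apply: measurable_tuncons => //.
  exact: measurableX.
rewrite /lebesgue_tupleS /pushforward -comp_preimage.
rewrite (_ : _ \o _ = id) ?preimage_id; last exact/funext/tconsK.
by rewrite product_measure1E// lte_mul_pinfty// ge0_fin_numE.
Qed.

HB.instance Definition _ := Measure_isSigmaFinite.Build _ _ _ lebesgue_tupleS
  lebesgue_tupleS_sigma_finite.

End step.

Fixpoint lebesgue_tuple n : {sigma_finite_measure set (n.-tuple RM) -> \bar R} :=
  if n is k.+1 then lebesgue_tupleS (lebesgue_tuple k)
  else dirac ([tuple] : 0.-tuple RM).

End lebesgue_tuple.

Section integration.
Variables (R : realType) (d : nat).
Implicit Types (D : set 'rV[R]_d).

Definition rV_of_tuple (t : d.-tuple (measurableTypeR R)) : 'rV[R]_d :=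
  \row_k tnth t k.

(* ['rV[R]_d] carries the normed structure but no sigma-algebra, so integrals
   are pulled back to [d.-tuple R]. *)
Definition domain_integral D (f : 'rV[R]_d -> R) : R :=
  \int[lebesgue_tuple R d]_(t in rV_of_tuple @^-1` D) f (rV_of_tuple t).

Definition vec_integral D (f : 'rV[R]_d -> 'rV[R]_d) : 'rV[R]_d :=
  \row_k domain_integral D (fun x => f x 0 k).

End integration.

Section calculus.
Variable R : realType.

Fixpoint Ck (V W : normedModType R) (k : nat) (O : set V) (f : V -> W) : Prop :=
  if k is k'.+1 then
    (forall p, O p -> differentiable f p) /\
    (forall v : V, Ck k' O (fun p => 'D_v f p))
  else forall p, O p -> {for p, continuous f}.

(* Smoothness up to the boundary of a (not necessarily open) set. *)
Definition smooth_on (V W : normedModType R) (S : set V) (f : V -> W) : Prop :=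
  exists O : set V, [/\ open O, S `<=` O & forall k, Ck k O f].

Variable d : nat.

Definition pderiv (k : 'I_d) (f : 'rV[R]_d -> R) (x : 'rV[R]_d) : R :=
  'D_(delta_mx 0 k) f x.

Definition grad (f : 'rV[R]_d -> R) (x : 'rV[R]_d) : 'rV[R]_d :=
  \row_k pderiv k f x.

Definition div (f : 'rV[R]_d -> 'rV[R]_d) (x : 'rV[R]_d) : R :=
  \sum_k pderiv k (fun y => f y 0 k) x.

Definition divmx (F : 'rV[R]_d -> 'M[R]_d) (x : 'rV[R]_d) : 'rV[R]_d :=
  \row_i div (fun y => row i (F y)) x.

Definition dot (a b : 'rV[R]_d) : R := (a *m b^T) 0 0.

End calculus.

(* Throughout, the space dimension is n.+1, the last coordinate is the vertical
   one, and a state u = (rho, m, rho theta) is a triple. *)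
Notation state R n := (R * 'rV[R]_n.+1 * R)%type.

(* The three row blocks (mass, momentum, rho theta) of a (d + 2) x d flux. *)
Notation flux R n := ('rV[R]_n.+1 * 'M[R]_n.+1 * 'rV[R]_n.+1)%type.

Section atmospheric_euler.
Variables (R : realType) (n : nat).
Variables (gam Ceos grav : R).
Local Notation vec := 'rV[R]_n.+1.
Implicit Types (u : state R n) (U : vec -> R -> state R n) (D : set vec).

Definition rho u : R := u.1.1.
Definition mom u : vec := u.1.2.
Definition rhotheta u : R := u.2.
Definition theta u : R := rhotheta u / rho u.
Definition vel u : vec := (rho u)^-1 *: mom u.
Definition pres u : R := Ceos * rhotheta u `^ gam.

Definition admissible u : Prop := 0 < rho u /\ 0 < theta u.

Definition e_vert : vec := delta_mx 0 ord_max.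

Definition euler_solution (D : set vec) (T : R) U : Prop :=
  forall x t, D x -> 0 < t < T ->
  [/\ derive1 (fun s => rho (U x s)) t + div (fun y => mom (U y t)) x = 0,
      derive1 (fun s => mom (U x s)) t +
        divmx (fun y => (rho (U y t))^-1 *: ((mom (U y t))^T *m mom (U y t))
                        + (pres (U y t))%:M) x
        = - (rho (U x t) * grav) *: e_vert &
      derive1 (fun s => rhotheta (U x s)) t +
        div (fun y => rhotheta (U y t) *: vel (U y t)) x = 0].

Definition smooth_admissible_solution (D : set vec) (T : R) U : Prop :=
  [/\ smooth_on (closure D `*` [set t | 0 <= t <= T]) (fun p => U p.1 p.2),
      forall x t, closure D x -> 0 <= t <= T -> admissible (U x t) &
      euler_solution D T U].

Definition pressureless_flux u : flux R n :=
  (mom u, (rho u)^-1 *: ((mom u)^T *m mom u), rhotheta u *: vel u).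

Definition fluxdot (G : flux R n) (c : vec) : state R n :=
  (dot G.1.1 c, c *m G.1.2^T, dot G.2 c).

Definition divflux (G : vec -> flux R n) (x : vec) : state R n :=
  (div (fun y => (G y).1.1) x, divmx (fun y => (G y).1.2) x,
   div (fun y => (G y).2) x).

Definition state_integral D (F : vec -> state R n) : state R n :=
  (domain_integral D (fun x => (F x).1.1), vec_integral D (fun x => (F x).1.2),
   domain_integral D (fun x => (F x).2)).

Definition ctilde : R := Ceos * gam / (gam - 1).

(* Star state of [ui] with respect to [uj], located at heights zi and zj. *)
Definition star_rho ui uj (zi zj : R) : R :=
  (rho ui `^ (gam - 1) +
   grav / (ctilde * ((theta ui + theta uj) / 2) * theta ui `^ (gam - 1))
     * Num.max 0 (zi - zj)) `^ (gam - 1)^-1.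

Definition star_state ui uj (zi zj : R) : state R n :=
  (star_rho ui uj zi zj, star_rho ui uj zi zj *: vel ui,
   theta ui * star_rho ui uj zi zj).

End atmospheric_euler.

Section meshes.
Variables (R : realType) (d : nat).
Local Notation vec := 'rV[R]_d.

(* Bounded by flat faces, and lying nowhere on both sides of its boundary. *)
Definition polygonal_domain (D : set vec) : Prop :=
  [/\ D !=set0, open D, connected D, D = interior (closure D) &
      exists N m (p : 'I_N -> 'I_m -> vec),
        closure D = \bigcup_s
          [set x | exists w : 'I_m -> R,
            [/\ forall a, 0 <= w a, \sum_a w a = 1 &
                x = \sum_a w a *: p s a]]].

Definition refcube : set vec := [set y | forall k, 0 <= y 0 k <= 1].
Definition refcube_open : set vec := [set y | forall k, 0 < y 0 k < 1].

(* The vertices of the unit cube are the boolean vectors; [refshape a] is the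
   (bi-/tri-)linear function equal to 1 at a and to 0 at the other vertices. *)
Definition refshape (a : {ffun 'I_d -> bool}) (y : vec) : R :=
  \prod_k (if a k then y 0 k else 1 - y 0 k).

Definition Q1 (q : vec -> R) : Prop :=
  exists c : {ffun 'I_d -> bool} -> R,
    forall y, refcube y -> q y = \sum_a c a * refshape a y.

Record mesh := Mesh {
  node : finType;
  cell : finType;
  pos : node -> vec;
  vertex : cell -> {ffun 'I_d -> bool} -> node }.

Variable M : mesh.

Definition cellmap (K : cell M) (y : vec) : vec :=
  \sum_a refshape a y *: pos (vertex K a).

Definition cellset (K : cell M) : set vec := cellmap K @` refcube.

Definition cell_diam (K : cell M) : R :=
  sup [set r | exists x y, [/\ cellset K x, cellset K y & r = `|x - y|]].

Definition mesh_size : R := \big[Num.max/0]_(K : cell M) cell_diam K.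

(* Conformity is not listed here: the absence of hanging nodes is what makes a
   continuous nodal basis ([nodal_basis] below) exist. *)
Definition mesh_of (D : set vec) : Prop :=
  [/\ injective (@pos M),
      (forall K : cell M, injective (vertex K)) /\
        (forall i : node M, exists K a, vertex K a = i),
      forall K, set_inj refcube (cellmap K),
      closure D = \bigcup_K cellset K &
      forall K L : cell M, K != L ->
        cellmap K @` refcube_open `&` cellmap L @` refcube_open = set0].

(* Shape and form regularity: no cell is flat, and no corner of a cell
   degenerates. *)
Definition regular_mesh (kappa : R) : Prop :=
  forall K y, refcube y ->
    kappa * cell_diam K ^+ d <= `|\det ('J (cellmap K) y)|.

Definition fe_space (D : set vec) (v : vec -> R) : Prop :=
  {within closure D, continuous v} /\ forall K, Q1 (v \o cellmap K).

Definition nodal_basis (D : set vec) (phi : node M -> vec -> R) : Prop :=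
  (forall i, fe_space D (phi i)) /\
  (forall i j, phi i (pos j) = (i == j)%:R).

Variables (D : set vec) (phi : node M -> vec -> R).

Definition mass (i j : node M) : R :=
  domain_integral D (fun x => phi i x * phi j x).

Definition lumped_mass (i : node M) : R := domain_integral D (phi i).

(* The gradient of [phi j] is the classical one; the cell boundaries, where it
   need not exist, are negligible. *)
Definition cvec (i j : node M) : vec :=
  vec_integral D (fun x => phi i x *: grad (phi j) x).

Definition stencil (i : node M) : {set node M} :=
  [set j | mass i j != 0]%SET.

Definition interior_node (i : node M) : Prop :=
  ~ (closure D `\` interior D) (pos i).

End meshes.

Section vertical.
Variables (R : realType) (n : nat) (M : mesh R n.+1).

Definition height (i : node M) : R := pos i 0 ord_max.

Definition drop_height (i j : node M) : R :=
  Num.max 0 (height i - height j).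

(* The neighbours of i above and below it are paired so that
   (1 + eps) h_ji c_ij = - h_ik c_ik with |eps| <= c h. *)
Definition vertically_matched (D : set 'rV[R]_n.+1)
    (phi : node M -> 'rV[R]_n.+1 -> R) (c : R) (i : node M) : Prop :=
  let A := [set j in stencil D phi i | 0 < drop_height j i]%SET in
  let B := [set k in stencil D phi i | 0 < drop_height i k]%SET in
  #|A| = #|B| /\
  exists s : node M -> node M, {in A &, injective s} /\
    forall j, j \in A -> s j \in B /\
      exists2 eps : R, `|eps| <= c * mesh_size M &
        ((1 + eps) * drop_height j i) *: cvec D phi i j =
        - (drop_height i (s j) *: cvec D phi i (s j)).

End vertical.

(* Main.v *)
Require Import Defs.
From HB Require Import structures.
From mathcomp Require Import all_boot all_order all_algebra.
From mathcomp Require Import all_classical all_reals all_analysis.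
From mathcomp Require Import perm measurable_realfun ring lra.
Set Implicit Arguments.
Unset Strict Implicit.
Unset Printing Implicit Defensive.
Import Order.TTheory GRing.Theory Num.Theory.
Import numFieldNormedType.Exports.
Local Open Scope classical_set_scope.
Local Open Scope ring_scope.

(** Off the null set of cell boundaries, the gradients [B_a] of the nodal functions
    of a cell [K] satisfy [sum_a B_a = 0], [sum_a B_a (x_a)_m = e_m] and
    [|B_a| diam K <= C], the last by form regularity through the adjugate of the
    Jacobian.  Hence nodal weights [W_j] that agree on [K] with an affine function
    of slope [b] up to [O(diam K ^ 2)] yield [sum_j W_j c_ij = int b phi_i] up to
    [O(h) int phi_i].  For (i) the weights are
    [ctilde Theta_i (P_j - P_i) + grav Theta_i (z_j - z_i) / mean theta] with
    [P = Theta ^ (gam - 1)], of slope [grad p + rho grav e_d].  For (ii) the star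
    density is [rho_i + s_i h_ij + O(h ^ 2)], so the weights are affine up to
    [s_i (h_ij + h_ji)], whose contribution the vertical matching cancels. *)

(** The constants must not depend on the mesh or on the node, whereas the estimates are local to a
    cell. So the expansions of the weights are proved with no mesh in sight, for two nodes and an
    evaluation point at mutual distance at most [radius c]. Compactness of [closure D] makes their
    constants uniform, and two vertices and a point of a cell form such a triple, with the diameter
    as radius. Since [closure D] need not be convex, Taylor remainders come from balls inside the
    open set where the solution is smooth, and distant pairs are covered by crude bounds. The affine
    comparison function is chosen afresh at each point [x], so the exact gradient at [x] is
    reproduced under the integral. Gradients cost one inverse diameter, which is why the weights are
    expanded to second order. The threshold [h0] keeps the base of the star power positive: for
    [gam < 1] the constant [ctilde] is negative, and a large height difference could make that base
    negative. *)

Section null_sets.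
Context {disp : measure_display} {T : measurableType disp} {R : realType}.
Variable mu : {measure set T -> \bar R}.
Local Open Scope ereal_scope.
Import HBNNSimple.

(** Nonnegative integrals are suprema over simple functions below the integrand. A competitor on
    [D], multiplied by the indicator of the complement of [N], competes on the smaller set and has
    the same integral. *)
Let ge0_integral_setD_null (D N : set T) (f : T -> \bar R) :
  measurable N -> mu N = 0 -> (forall x, D x -> 0 <= f x) ->
  \int[mu]_(x in D) f x = \int[mu]_(x in D `\` N) f x.
Proof.
move=> mN N0 f0.
rewrite !ge0_integralE//; last by move=> x [/f0].
apply/eqP; rewrite eq_le; apply/andP; split; last first.
  apply: le_ereal_sup => _ [h /= hf <-]; exists h => //= x.
  apply: (le_trans (hf x)); rewrite !patchE.
  case: ifPn => [/set_mem[Dx _]|_]; first by rewrite mem_set.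
  by case: ifPn => [/set_mem/f0|].
apply: ge_ereal_sup => _ [h /= hf <-].
have mNC : measurable (~` N) by exact: measurableC.
apply: ereal_sup_ubound; exists (proj_nnsfun h mNC) => /=.
  move=> x; rewrite -[X in X%:E]/(proj_nnsfun h mNC x) -mrestrict !patchE.
  have := hf x; rewrite patchE.
  have [Nx|Nx] := pselect (N x).
    move=> _; rewrite (memNset (A := ~` N))//=.
    by case: ifPn => // /set_mem[Dx _]; exact: f0.
  rewrite (mem_set (A := ~` N))//=; case: ifPn => Dx.
    by rewrite mem_set//; split => //; exact: set_mem.
  by rewrite memNset// => -[]/mem_set; rewrite (negbTE Dx).
rewrite -(integralT_nnsfun mu h) (@ge0_negligible_integral _ _ _ mu setT N)//=.
- by rewrite setTD integral_nnsfun// mrestrict.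
- by apply/measurable_EFinP; exact: measurable_funPT.
- by move=> x _; rewrite lee_fin.
Qed.

(* No measurability of [f] is assumed: [mu] need not be complete. *)
Lemma integral_setD_null (D N : set T) (f : T -> \bar R) :
  measurable N -> mu N = 0 ->
  \int[mu]_(x in D) f x = \int[mu]_(x in D `\` N) f x.
Proof.
move=> mN N0; rewrite integralE [RHS]integralE.
by congr (_ - _); apply: ge0_integral_setD_null.
Qed.

End null_sets.

(** * Measurable sets of row vectors, volumes of cubes and null sets by coverings *)

Section rV_sets.
Variables (R : realType) (d : nat).
Local Notation preim := (preimage (@rV_of_tuple R d)).

Lemma preimage_rV_ball (x : 'rV[R]_d) (e : R) : 0 < e ->
  preim (ball x e) =
    [set t | forall k, ball (x 0 k) e (tnth t k : R)].
Proof.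
move=> e0; apply/seteqP; split => t /=.
  by move=> [_ H] k; have := H 0 k; rewrite mxE.
by move=> H; split => // i k; rewrite (ord1 i) mxE; exact: H.
Qed.

Lemma measurable_tuple_ball n (c : 'I_n -> R) (e : R) :
  measurable ([set t | forall k, ball (c k) e (tnth t k : R)] :
    set (n.-tuple (measurableTypeR R))).
Proof.
rewrite (_ : [set _ | _] = \bigcap_(k in [set: 'I_n])
    ((@tnth n (measurableTypeR R))^~ k @^-1` (ball (c k) e : set R))).
  apply: fin_bigcap_measurable => // k _; rewrite -[X in measurable X]setTI.
  by apply: measurable_tnth => //; apply: open_measurable; exact: ball_open.
by apply/seteqP; split => t /= H k => [_|]; exact: H.
Qed.

(** An open set is the union of the balls it contains with rational centre and radius [1 / (m + 1)].
    There are countably many, and in the maximum norm each is a cube, hence measurable. *)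
Lemma open_preimage_measurable (O : set 'rV[R]_d) :
  open O -> measurable (preim O).
Proof.
move=> oO.
pose c (q : 'rV[rat]_d) : 'rV[R]_d := map_mx ratr q.
pose F (p : 'rV[rat]_d * nat) : set 'rV[R]_d :=
  if pselect (ball (c p.1) (p.2.+1%:R^-1) `<=` O) then
    ball (c p.1) (p.2.+1%:R^-1) else set0.
rewrite (_ : O = \bigcup_p F p).
  rewrite preimage_bigcup; apply: countable_bigcupT_measurable => // -[q m].
  rewrite /F; case: pselect => ?; last by rewrite preimage_set0.
  by rewrite preimage_rV_ball//; exact: measurable_tuple_ball.
apply/seteqP; split => [x Ox|x [p _]]; last first.
  by rewrite /F /=; case: pselect => [H /H|].
have /nbhs_ballP[e /= e0 xe] := open_nbhs_nbhs (conj oO Ox).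
pose m := Num.truncn (e / 2)^-1.
have e2 : 0 < e / 2 by rewrite divr_gt0.
have me : m.+1%:R^-1 < e / 2.
  by rewrite invf_plt ?posrE//; rewrite -truncn_lt_nat ?ltnSn// invr_ge0 ltW.
have ex k : exists q : rat, `|ratr q - x 0 k| < m.+1%:R^-1.
  have [q] := @rat_in_itvoo R (x 0 k) (x 0 k + m.+1%:R^-1)
    ltac:(by rewrite ltrDl invr_gt0).
  rewrite in_itv/= => /andP[q1 q2]; exists q.
  by rewrite ger0_norm ?subr_ge0 1?ltW// ltrBlDl.
have [q qx] := choice ex.
exists (\row_k q k, m) => //; rewrite /F /=.
case: pselect => [?|bO]; last first.
  exfalso; apply: bO.
  apply: subset_trans xe => y [_ H]; split => // i k.
  have := H 0 k; rewrite (ord1 i) !mxE -!ball_normE /= => Hk.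
  rewrite -(subrK (ratr (q k)) (x 0 k)) -addrA.
  rewrite (le_lt_trans (ler_normD _ _))// (splitr e) ltrD//.
    by rewrite distrC (lt_trans (qx k)).
  exact: lt_trans me.
split; first by rewrite invr_gt0.
by move=> i k; rewrite (ord1 i) !mxE -ball_normE; exact: qx.
Qed.

Lemma lebesgue_tuple_ball n (c : 'I_n -> R) (e : R) : 0 <= e ->
  lebesgue_tuple R n [set t | forall k, ball (c k) e (tnth t k : R)] =
    ((e *+ 2) ^+ n)%:E.
Proof.
move=> e0; elim: n c => [|n IH] c.
  by rewrite /= diracE mem_set// => -[].
rewrite /= /lebesgue_tupleS /pushforward.
rewrite (_ : _ @^-1` _ = (ball (c ord0) e : set R) `*`
    [set t | forall k, ball (c (lift ord0 k)) e (tnth t k : R)]).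
  rewrite product_measure1E//; last 2 first.
  - by apply: open_measurable; exact: ball_open.
  - exact: measurable_tuple_ball.
  rewrite IH exprS EFinM; congr (_ * _)%E.
  exact: lebesgue_measure_ball.
apply/seteqP; split => -[y t] /=.
  move=> H; split; first by have := H ord0; rewrite tnth0.
  by move=> k; have := H (lift ord0 k); rewrite tnthS.
move=> [H0 H1] k; case: (unliftP ord0 k) => [j|] ->.
  by rewrite tnthS; exact: H1.
by rewrite tnth0.
Qed.

Lemma closed_preimage_measurable (K : set 'rV[R]_d) :
  closed K -> measurable (preim K).
Proof.
move=> cK; rewrite -[K]setCK preimage_setC; apply: measurableC.
exact: (open_preimage_measurable (closed_openC cK)).
Qed.

End rV_sets.

Lemma measure_bigsetU_le {disp : measure_display} {T : measurableType disp}
    {R : realType} (mu : {measure set T -> \bar R}) (I : Type) (s : seq I)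
    (F : I -> set T) :
  (forall i, measurable (F i)) ->
  (mu (\big[setU/set0]_(i <- s) F i) <= \sum_(i <- s) mu (F i))%E.
Proof.
move=> mF; elim: s => [|i s IH]; first by rewrite !big_nil measure0.
rewrite !big_cons (le_trans (measureU2 _ _ _))//; first exact: bigsetU_measurable.
exact: leeD.
Qed.

(* The number of boxes needed to cover at scale [1/m] grows like [m^n], one
   power less than the inverse of the volume of a box. *)
Lemma null_of_coverings (R : realType) (n : nat) (A : set 'rV[R]_n.+1) (L : R) :
  0 <= L -> measurable (@rV_of_tuple R n.+1 @^-1` A) ->
  (forall m : nat, exists c : {ffun 'I_n -> 'I_m.+1} -> 'rV[R]_n.+1,
    A `<=` \bigcup_J ball (c J) (L / m.+1%:R)) ->
  lebesgue_tuple R n.+1 (@rV_of_tuple R n.+1 @^-1` A) = 0%E.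
Proof.
move=> L0 mA cov; set mu := lebesgue_tuple R n.+1; set B := _ @^-1` A.
have bnd (m : nat) : (mu B <= ((L *+ 2) ^+ n.+1 / m.+1%:R)%:E)%E.
  have [c Ac] := cov m.
  pose F J := [set t : n.+1.-tuple (measurableTypeR R) |
    forall k, ball (c J 0 k) (L / m.+1%:R) (tnth t k : R)].
  have mF J : measurable (F J) by exact: measurable_tuple_ball.
  apply: (@le_trans _ _ (mu (\big[setU/set0]_(J <- enum {ffun 'I_n -> 'I_m.+1}) F J))).
    apply: le_measure; rewrite ?inE//; first exact: bigsetU_measurable.
    move=> t /= /Ac[J _ [_ Jt]]; rewrite -bigcup_seq; exists J => /=.
      by rewrite mem_enum.
    by move=> k; have := Jt 0 k; rewrite mxE.
  rewrite (le_trans (measure_bigsetU_le _ _ _))//.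
  rewrite (eq_bigr (fun=> (((L / m.+1%:R) *+ 2) ^+ n.+1)%:E)); last first.
    by move=> J _; apply: lebesgue_tuple_ball; rewrite divr_ge0.
  rewrite sumEFin lee_fin big_const_seq count_predT -cardE iter_addr_0.
  rewrite -[X in X <= _]mulr_natr card_ffun !card_ord natrX -mulrnAl exprMn.
  rewrite -mulrA.
  rewrite ler_wpM2l ?exprn_ge0 ?mulrn_wge0//.
  by rewrite exprS -mulrA -exprMn mulVf ?pnatr_eq0// expr1n mulr1.
apply/eqP; rewrite eq_le measure_ge0 andbT.
apply/lee_addgt0Pr => e e0; rewrite add0e.
pose C := (L *+ 2) ^+ n.+1.
have C0 : 0 <= C by rewrite exprn_ge0// mulrn_wge0.
apply: (le_trans (bnd (Num.truncn (C / e)))); rewrite lee_fin.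
rewrite ler_pdivrMr// mulrC -ler_pdivrMr// ltW//.
by rewrite -truncn_lt_nat ?ltnSn// divr_ge0// ltW.
Qed.

(** * Norm estimates and the differential of a local right inverse *)

Section row_vector_norm.
Variables (R : realType) (d : nat).
Local Notation vec := 'rV[R]_d.
Implicit Types v w : vec.

Lemma coord_le_norm v k : `|v 0 k| <= `|v|.
Proof.
rewrite [X in _ <= X]mx_normrE.
by rewrite (le_bigmax_cond _ (fun ij : 'I_1 * 'I_d => `|v ij.1 ij.2|) (j := (0, k))).
Qed.

Lemma norm_le_coord v e : 0 <= e -> (forall k, `|v 0 k| <= e) -> `|v| <= e.
Proof.
move=> e0 H; rewrite [X in X <= _]mx_normrE; apply/bigmax_leP; split => // -[i k] _ /=.
by rewrite (ord1 i).
Qed.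

Lemma dot_sum v w : dot v w = \sum_k v 0 k * w 0 k.
Proof. by rewrite /dot mxE; apply: eq_bigr => k _; rewrite mxE. Qed.

Lemma norm_dot_le v w e : (forall k, `|v 0 k| <= e) ->
  `|dot v w| <= d%:R * e * `|w|.
Proof.
move=> H; rewrite dot_sum (le_trans (ler_norm_sum _ _ _))//.
rewrite (@le_trans _ _ (\sum_(k < d) e * `|w|))//.
  by apply: ler_sum => k _; rewrite normrM ler_pM// coord_le_norm.
by rewrite sumr_const card_ord -mulrA mulr_natl.
Qed.

Lemma mulmx_norm_bound (A : 'M[R]_d) :
  exists2 K : R, 0 < K & forall v, `|v *m A| <= K * `|v|.
Proof.
exists (1 + \sum_(i < d) \sum_(j < d) `|A i j|) => [|v].
  by rewrite ltr_pwDl// !sumr_ge0// => i _; rewrite sumr_ge0.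
have S0 : 0 <= \sum_(i < d) \sum_(j < d) `|A i j|.
  by rewrite sumr_ge0// => i _; rewrite sumr_ge0.
rewrite (@le_trans _ _ ((\sum_(i < d) \sum_(j < d) `|A i j|) * `|v|))//; last first.
  by rewrite ler_wpM2r// lerDr.
apply: norm_le_coord => [|k]; first by rewrite mulr_ge0.
rewrite mxE (le_trans (ler_norm_sum _ _ _))// mulr_suml ler_sum// => i _.
rewrite normrM mulrC ler_pM// ?coord_le_norm//.
by rewrite (bigD1 k)//= lerDl sumr_ge0.
Qed.

Lemma mulmxr_continuous (A : 'M[R]_d) : continuous (mulmxr A : vec -> vec).
Proof.
apply/linear_bounded_continuous/linear_boundedP.
have [K K0 HK] := mulmx_norm_bound A; near=> M => v.
by rewrite (le_trans (HK v))// ler_wpM2r//; near: M; exact: nbhs_pinfty_ge.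
Unshelve. all: by end_near. Qed.

End row_vector_norm.

Section differentials.
Variables (R : realType) (V W : normedModType R).

Lemma diff_expansion (f : V -> W) (x : V) (e : R) :
  differentiable f x -> 0 < e ->
  \forall h \near (0 : V), `|f (h + x) - f x - 'd f x h| <= e * `|h|.
Proof.
move=> /diff_locally/eqaddoP H e0; have := H _ e0.
by apply: filterS => h /=; rewrite !fctE opprD addrA.
Qed.

Lemma differentiable_expansion (f : V -> W) (x : V) (df : {linear V -> W}) :
  continuous df ->
  (forall e : R, 0 < e ->
    \forall h \near (0 : V), `|f (h + x) - f x - df h| <= e * `|h|) ->
  differentiable f x /\ 'd f x = df :> (V -> W).
Proof.
move=> dfc H.
have E : f \o shift x = cst (f x) + df +o_ 0 id.
  apply/eqaddoP => e e0; have := H _ e0.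
  by apply: filterS => h /=; rewrite !fctE opprD addrA.
have D := diff_unique dfc E; split => //.
by apply/diff_locallyP; rewrite D.
Qed.

End differentials.

Section inverse_differential.
Variables (R : realType) (d : nat).
Local Notation vec := 'rV[R]_d.+1.
Variables (F G : vec -> vec) (x : vec).
Hypotheses (dF : differentiable F (G x)) (JF : 'J F (G x) \in unitmx).
Hypotheses (cG : {for x, continuous G}) (FG : \forall z \near x, F (G z) = z).


(** With [k = G (h + x) - G x], differentiability of [F] gives [k = h A + o(|k|)], where continuity
    of [G] ensures that [k] is small. Absorbing half of [|k|] yields [|k| = O(|h|)], so the
    remainder is [o(|h|)]. *)
Lemma differentiable_right_inverse :
  differentiable G x /\
  'd G x = (mulmxr (invmx ('J F (G x))) : vec -> vec) :> (vec -> vec).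
Proof.
set y := G x; set A := invmx _.
apply: differentiable_expansion; first exact: mulmxr_continuous.
have [K K0 KP] := mulmx_norm_bound A.
have Fy : F y = x by exact: nbhs_singleton FG.
move=> e e0.
(* The first bound gives [K * e1 <= 1 / 2], which lets [|k|] be absorbed; the second turns the final
   remainder [2 * K ^ 2 * e1 * |h|] into at most [e * |h|]. *)
pose e1 := Num.min (2 * K)^-1 (e / (2 * K ^+ 2)).
have e10 : 0 < e1.
  by rewrite lt_min invr_gt0 divr_gt0 ?mulr_gt0 ?exprn_gt0 ?ltr0n.
have H1 : \forall h \near (0 : vec),
    `|F (h + y) - F y - 'd F y h| <= e1 * `|h| by exact: diff_expansion.
have H2 : \forall h \near (0 : vec), F (G (h + x)) = h + x.
  have := FG; rewrite (near_shift 0 x); apply: filterS => h /=.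
  by rewrite subr0.
have H3 : \forall h \near (0 : vec),
    `|F (G (h + x) - y + y) - F y - 'd F y (G (h + x) - y)| <=
      e1 * `|G (h + x) - y|.
  have cGx : (fun h : vec => G (h + x)) @ (0 : vec) --> y.
    have cs : (fun h : vec => h + x) @ (0 : vec) --> x.
      have : {for 0, continuous (fun h : vec => h + x)}.
        by apply: continuousD => //; exact: cst_continuous.
      by move=> cs; rewrite -[X in _ --> X]add0r; exact: cs.
    exact: cvg_comp cs cG.
  move: H1; rewrite (near_shift y) => /cGx.
  by apply: (@filterS _ _ (@nbhs_filter vec (0 : vec))) => h /=; rewrite sub0r.
near=> h.
have E2 : F (G (h + x)) = h + x by near: h.
have E3 : `|h - 'd F y (G (h + x) - y)| <= e1 * `|G (h + x) - y|.
  have : `|F (G (h + x) - y + y) - F y - 'd F y (G (h + x) - y)| <=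
    e1 * `|G (h + x) - y| by near: h.
  by rewrite subrK E2 Fy addrK.
set k := G (h + x) - y in E3 *.
have E4 : k - h *m A = - ((h - 'd F y k) *m A).
  rewrite mulmxBl opprB; congr (_ - _).
  by rewrite -[in RHS](mul_rV_lin1 ('d F y)) -mulmxA mulmxV ?mulmx1.
have b1 : `|k - h *m A| <= K * (e1 * `|k|).
  by rewrite E4 normrN (le_trans (KP _))// ler_wpM2l// ltW.
have Ke1 : K * e1 <= 2^-1.
  by rewrite -ler_pdivlMl// -invfM mulrC ge_min lexx.
have k2 : `|k| <= 2 * (K * `|h|).
  have : `|k| <= `|h *m A| + `|k - h *m A|.
    by rewrite -{1}(subrK (h *m A) k) addrC ler_normD.
  have := KP h.
  have : K * (e1 * `|k|) <= 2^-1 * `|k| by rewrite mulrA ler_wpM2r.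
  move: b1; lra.
rewrite (le_trans b1)//.
rewrite (@le_trans _ _ (K * (e1 * (2 * (K * `|h|)))))//.
  by rewrite ler_wpM2l ?ler_wpM2l// ltW.
have : K * (e1 * (2 * (K * `|h|))) = (2 * K ^+ 2 * e1) * `|h| by ring.
move=> ->; rewrite ler_wpM2r// -ler_pdivlMl ?mulr_gt0 ?exprn_gt0//.
by rewrite mulrC ge_min lexx orbT.
Unshelve. all: by end_near. Qed.

End inverse_differential.

(** * Shape functions on the unit cube, and the geometry of a cell *)

Section reference_shapes.
Variables (R : realType) (d : nat).
Local Notation vec := 'rV[R]_d.
Local Notation vtx := {ffun 'I_d -> bool}.
Implicit Types (a b : vtx) (y : vec).

Definition reffactor (b : bool) (t : R) : R := if b then t else 1 - t.

(** The partial derivative of [refshape a] along axis [l]. As [refshape a] is affine in each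
    coordinate, increments along an axis are exact multiples of it. *)
Definition refslope a (l : 'I_d) y : R :=
  (if a l then 1 else -1) * \prod_(k | k != l) reffactor (a k) (y 0 k).

Lemma reffactor_itv (b : bool) (t : R) : 0 <= t <= 1 -> 0 <= reffactor b t <= 1.
Proof. by rewrite /reffactor; case: b => //; lra. Qed.

Lemma prod_itv (I : Type) (s : seq I) (P : pred I) (F : I -> R) :
  (forall i, 0 <= F i <= 1) -> 0 <= \prod_(i <- s | P i) F i <= 1.
Proof.
move=> F01; apply: (big_ind (fun x : R => 0 <= x <= 1)) => //.
  by rewrite ler01 lexx.
move=> x y /andP[x0 x1] /andP[y0 y1]; rewrite mulr_ge0//=.
by rewrite mulr_ile1.
Qed.

Lemma refshape_itv a y : refcube y -> 0 <= refshape a y <= 1.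
Proof. by move=> Hy; apply: prod_itv => k; exact: reffactor_itv. Qed.

Lemma refslope_le1 a l y : refcube y -> `|refslope a l y| <= 1.
Proof.
move=> Hy; rewrite normrM.
have /andP[p0 p1] : 0 <= \prod_(k | k != l) reffactor (a k) (y 0 k) <= 1.
  by apply: prod_itv => k; exact: reffactor_itv.
by rewrite (ger0_norm p0); case: (a l); rewrite ?normrN normr1 mul1r.
Qed.

Lemma refshape_line a l y h :
  refshape a (h *: delta_mx 0 l + y) = refshape a y + h * refslope a l y.
Proof.
rewrite /refshape /refslope (bigD1 l)//= [in RHS](bigD1 l)//=.
rewrite (eq_bigr (fun k => reffactor (a k) (y 0 k))); last first.
  by move=> k kl; rewrite /reffactor !mxE eqxx (negbTE kl)/= mulr0 add0r.
rewrite /reffactor !mxE !eqxx mulr1; set p := \prod_(_ | _) _.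
by case: (a l); ring.
Qed.

(** Expanding the product over [k] of [y_k + (1 - y_k)] gives exactly this sum. *)
Lemma sum_refshape y : \sum_a refshape a y = 1.
Proof.
rewrite -(bigA_distr_bigA (fun k (c : bool) => reffactor c (y 0 k))) /=.
rewrite big1// => k _; rewrite big_bool /reffactor/=; ring.
Qed.

Lemma sum_refslope l y : \sum_a refslope a l y = 0.
Proof.
have := sum_refshape (1 *: delta_mx 0 l + y).
under eq_bigr do rewrite refshape_line mul1r.
by rewrite big_split/= sum_refshape => /(canRL (addKr _)); rewrite addNr.
Qed.

Definition refvertex a : vec := \row_k (a k)%:R.

Lemma refcube_vertex a : refcube (refvertex a).
Proof. by move=> k; rewrite mxE; case: (a k); rewrite ?lexx ?ler01. Qed.

Lemma refshape_vertex a b : refshape b (refvertex a) = (b == a)%:R.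
Proof.
have [->|ba] := eqVneq b a.
  rewrite /refshape big1// => k _; rewrite mxE; case: (a k) => //=.
  by rewrite subr0.
have /existsP[k ak] : [exists k, b k != a k].
  apply: contraR ba => /existsPn H; apply/eqP/ffunP => k.
  by apply/eqP; rewrite -[_ == _]negbK H.
rewrite /refshape (bigD1 k)//= mxE; move: ak.
by case: (a k); case: (b k) => //= _; rewrite ?subrr mul0r.
Qed.

Lemma refshape_differentiable a y : differentiable (refshape a) y.
Proof.
rewrite /refshape; elim: (index_enum _) => [|k s IH].
  rewrite (_ : (fun _ => _) = cst 1); first exact: differentiable_cst.
  by apply/funext => z; rewrite big_nil.
rewrite (_ : (fun _ => _) = (fun z : vec => reffactor (a k) (z 0 k)) *
    (fun z => \prod_(k <- s) if a k then z 0 k else 1 - z 0 k)); last first.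
  by apply/funext => z; rewrite big_cons.
apply: differentiableM => //; rewrite /reffactor.
case: (a k); first exact: differentiable_coord.
by apply: differentiableB; [exact: differentiable_cst|exact: differentiable_coord].
Qed.

(** Telescoping: one factor is changed at a time, and the remaining product is at most 1. *)
Lemma prod_dist_le (I : Type) (s : seq I) (F G : I -> R) :
  (forall i, 0 <= F i <= 1) -> (forall i, 0 <= G i <= 1) ->
  `|\prod_(i <- s) F i - \prod_(i <- s) G i| <= \sum_(i <- s) `|F i - G i|.
Proof.
move=> F01 G01; elim: s => [|i s IH]; first by rewrite !big_nil subrr normr0.
rewrite !big_cons.
set P := \prod_(_ <- _) F _ in IH *; set Q := \prod_(_ <- _) G _ in IH *.
have -> : F i * P - G i * Q = (F i - G i) * P + G i * (P - Q) by ring.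
rewrite (le_trans (ler_normD _ _))// lerD//.
  have /andP[P0 P1] : 0 <= P <= 1 by exact: prod_itv.
  by rewrite normrM (ger0_norm P0) ler_piMr.
have /andP[g0 g1] := G01 i.
by rewrite normrM (ger0_norm g0) (le_trans _ IH)// ler_piMl.
Qed.

Lemma refshape_lipschitz a y y' : refcube y -> refcube y' ->
  `|refshape a y - refshape a y'| <= d%:R * `|y - y'|.
Proof.
move=> Hy Hy'; rewrite (le_trans (prod_dist_le _ _ _))//.
- by move=> k; exact: reffactor_itv.
- by move=> k; exact: reffactor_itv.
rewrite -[d in d%:R]card_ord -sum1_card natr_sum mulr_suml ler_sum// => k _.
rewrite mul1r; have := coord_le_norm (y - y') k; rewrite !mxE.
case: (a k) => //; rewrite [in X in _ -> `|X| <= _](_ : _ - _ = - (y 0 k - y' 0 k)) ?normrN//.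
by ring.
Qed.

End reference_shapes.

Section cell_geometry.
Variables (R : realType) (n : nat) (M : mesh R n.+1).
Local Notation d := n.+1.
Local Notation vec := 'rV[R]_d.
Local Notation vtx := {ffun 'I_d -> bool}.
Variable K : cell M.
Implicit Types (a b : vtx) (y : vec).
Local Notation p a := (pos (vertex K a)).

Lemma cellmap_vertex a : cellmap K (refvertex R a) = p a.
Proof.
rewrite /cellmap (bigD1 a)//= refshape_vertex eqxx scale1r big1 ?addr0// => b ba.
by rewrite refshape_vertex (negbTE ba) scale0r.
Qed.

Lemma cellset_vertex a : cellset K (p a).
Proof.
by exists (refvertex R a); [exact: refcube_vertex|exact: cellmap_vertex].
Qed.

Let S : R := \sum_a `|p a|.

Let S_ge0 : 0 <= S. Proof. exact: sumr_ge0. Qed.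

Lemma cellmap_lipschitz : exists2 L : R, 0 < L &
  forall y y', refcube y -> refcube y' ->
    `|cellmap K y - cellmap K y'| <= L * `|y - y'|.
Proof.
exists (d%:R * S + 1) => [|y y' Hy Hy'].
  by rewrite ltr_wpDl// mulr_ge0.
rewrite (@le_trans _ _ (d%:R * S * `|y - y'|))//; last first.
  by rewrite ler_wpM2r// lerDl.
rewrite /cellmap -sumrB (le_trans (ler_norm_sum _ _ _))//.
rewrite /S mulr_sumr mulr_suml ler_sum// => a _.
rewrite -scalerBl mx_normZ mulrAC ler_wpM2r//.
exact: refshape_lipschitz.
Qed.

Lemma cellset_dist_bounded : has_ubound
  [set r | exists x y, [/\ cellset K x, cellset K y & r = `|x - y|]].
Proof.
have b x : cellset K x -> `|x| <= S.
  move=> [y Hy <-]; rewrite (le_trans (ler_norm_sum _ _ _))// ler_sum// => a _.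
  have /andP[r0 r1] := refshape_itv a Hy.
  by rewrite mx_normZ (ger0_norm r0) ler_piMl.
exists (S + S) => _ [x [y [/b Hx /b Hy ->]]].
by rewrite (le_trans (ler_normB _ _))// lerD.
Qed.

Lemma cell_diam_ge x y : cellset K x -> cellset K y -> `|x - y| <= cell_diam K.
Proof.
by move=> Kx Ky; apply: (ub_le_sup cellset_dist_bounded); exists x, y.
Qed.

Lemma cell_diam_ge0 : 0 <= cell_diam K.
Proof.
have := cell_diam_ge (cellset_vertex [ffun=> false]) (cellset_vertex [ffun=> false]).
by rewrite subrr normr0.
Qed.

Lemma cell_diam_gt0 : set_inj (@refcube R d) (cellmap K) -> 0 < cell_diam K.
Proof.
move=> inj; pose a : vtx := [ffun=> false]; pose b : vtx := [ffun=> true].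
rewrite (lt_le_trans _ (cell_diam_ge (cellset_vertex a) (cellset_vertex b)))//.
rewrite normr_gt0 subr_eq0 -!cellmap_vertex; apply/negP => /eqP.
move/(inj _ _ (mem_set (refcube_vertex R a)) (mem_set (refcube_vertex R b))).
move=> /matrixP/(_ 0 ord0); rewrite !mxE !ffunE => /eqP.
by rewrite eq_sym oner_eq0.
Qed.

Lemma cell_diam_le_mesh_size : cell_diam K <= mesh_size M.
Proof. by rewrite /mesh_size (le_bigmax_cond _ _ (j := K)). Qed.

Lemma cellmap_differentiable y : differentiable (cellmap K) y.
Proof.
rewrite (_ : cellmap K = \sum_(i < #|{: vtx}|)
    (fun z : vec => refshape (enum_val i) z *: p (enum_val i))).
  apply: differentiable_sum => i; apply: differentiableZl.
  exact: refshape_differentiable.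
apply/funext => z; rewrite fct_sumE /cellmap.
by rewrite (reindex (@enum_val _ {: vtx}))//; exact/onW_bij/enum_val_bij.
Qed.

Lemma derive_along_line (V : normedModType R) (f : vec -> V) y v w :
  (forall h : R, f (h *: v + y) = f y + h *: w) -> is_derive y v f w.
Proof.
move=> H.
have C : h^-1 *: ((f \o shift y) (h *: v) - f y) @[h --> 0^'] --> w.
  apply: (@cvg_trans _ ((fun=> w) @ 0^')); last exact: cvg_cst.
  apply: near_eq_cvg; near=> h.
  rewrite /= H addrAC subrr add0r scalerA mulVf ?scale1r//.
  by near: h; exact: nbhs_dnbhs_neq.
split; first by apply/cvg_ex; exists w.
exact: cvg_lim C.
Unshelve. all: by end_near. Qed.

Lemma jacobian_cellmap y l k :
  'J (cellmap K) y l k = \sum_a refslope a l y * p a 0 k.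
Proof.
rewrite /jacobian mxE -deriveE; last exact: cellmap_differentiable.
have D : is_derive y (delta_mx 0 l) (cellmap K) (\sum_a refslope a l y *: p a).
  apply: derive_along_line => h; rewrite /cellmap scaler_sumr -big_split/=.
  by apply: eq_bigr => a _; rewrite refshape_line scalerDl scalerA.
rewrite (@derive_val _ _ _ _ _ _ _ D).
by rewrite summxE; apply: eq_bigr => a _; rewrite mxE.
Qed.

Lemma jacobian_cellmap_le y l k : refcube y ->
  `|'J (cellmap K) y l k| <= #|{: vtx}|%:R * cell_diam K.
Proof.
move=> Hy; rewrite jacobian_cellmap.
pose a0 : vtx := [ffun=> false].
(* The slopes sum to 0, so positions may be measured from one vertex; each difference is then at
   most the diameter. *)
rewrite (_ : \sum_a _ = \sum_a refslope a l y * (p a - p a0) 0 k); last first.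
  under [RHS]eq_bigr do rewrite !mxE mulrBr.
  by rewrite sumrB -mulr_suml sum_refslope mul0r subr0.
rewrite (le_trans (ler_norm_sum _ _ _))// mulr_natl -sumr_const ler_sum// => a _.
rewrite normrM -[leRHS]mul1r ler_pM// ?refslope_le1//.
rewrite (le_trans (coord_le_norm _ _))// cell_diam_ge//; exact: cellset_vertex.
Qed.

End cell_geometry.

Lemma det_le (R : realType) (m : nat) (A : 'M[R]_m) (c : R) :
  (forall i j, `|A i j| <= c) -> `|\det A| <= (m`!)%:R * c ^+ m.
Proof.
move=> H; rewrite /determinant (le_trans (ler_norm_sum _ _ _))//.
rewrite (@le_trans _ _ (\sum_(s : 'S_m) c ^+ m))//; last first.
  by rewrite sumr_const card_Sn mulr_natl.
apply: ler_sum => s _; rewrite normrM normrX normrN1 expr1n mul1r normr_prod.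
rewrite -[m in c ^+ m]card_ord -prodr_const ler_prod// => i _.
by rewrite normr_ge0 H.
Qed.

(** By Cramer's rule the determinant times the inverse is the adjugate, whose entries are minors of
    order [m] up to sign. For a singular matrix the left-hand side is 0. *)
Lemma invmx_le (R : realType) (m : nat) (A : 'M[R]_m.+1) (c : R) i j :
  (forall i j, `|A i j| <= c) ->
  `|\det A| * `|invmx A i j| <= (m`!)%:R * c ^+ m.
Proof.
move=> H.
have [uA|nA] := boolP (A \in unitmx); last first.
  move: nA; rewrite unitmxE unitfE negbK => /eqP->.
  by rewrite normr0 mul0r mulr_ge0// exprn_ge0// (le_trans _ (H ord0 ord0)).
rewrite /invmx uA mxE normrM normfV mulrA mulfV ?mul1r; last first.
  by rewrite normr_eq0 -unitfE -unitmxE.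
rewrite mxE /cofactor normrM normrX normrN1 expr1n mul1r.
by apply: det_le => k l; rewrite !mxE.
Qed.

(** * Inverse of the cell map and gradients of nodal functions in physical coordinates *)

Section cellmap_inverse.
Variables (R : realType) (n : nat) (M : mesh R n.+1).
Local Notation d := n.+1.
Local Notation vec := 'rV[R]_d.
Local Notation vtx := {ffun 'I_d -> bool}.
Variable K : cell M.
Hypothesis inj : set_inj (@refcube R d) (cellmap K).

Lemma refcube_compact : compact (@refcube R d).
Proof.
rewrite (_ : @refcube R d = [set v : vec | forall i, `[0, 1]%classic (v 0 i)]).
  exact: (@rV_compact R d (fun=> `[0, 1]%classic) (fun=> @segment_compact R 0 1)).
by apply/seteqP; split => v H k; have := H k; rewrite /= in_itv.
Qed.

Lemma cellmap_image_closed (A : set vec) :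
  closed A -> closed (cellmap K @` (@refcube R d `&` A)).
Proof.
move=> cA; apply: compact_closed; first exact: norm_hausdorff.
apply: continuous_compact; last by apply: compact_closedI => //; exact: refcube_compact.
apply: continuous_subspaceT => y.
by apply: differentiable_continuous; exact: cellmap_differentiable.
Qed.

Definition cellinv (x : vec) : vec := xget 0 [set y | refcube y /\ cellmap K y = x].

Lemma cellinvP x : cellset K x -> refcube (cellinv x) /\ cellmap K (cellinv x) = x.
Proof.
move=> [y Hy yx]; rewrite /cellinv; case: xgetP => [z -> //|/(_ y)]; case.
by split.
Qed.

Lemma cellmapK y : refcube y -> cellinv (cellmap K y) = y.
Proof.
move=> Hy; have [|H1 H2] := @cellinvP (cellmap K y); first by exists y.
exact: (inj (mem_set H1) (mem_set Hy)).
Qed.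

(** A continuous injection on a compact set has a continuous inverse: the image of the cube minus a
    ball about [y] is closed and misses [cellmap K y]. The neighbourhood hypothesis makes [cellinv]
    a genuine inverse on a full neighbourhood. *)
Lemma cellinv_continuous y : refcube y -> nbhs (cellmap K y) (cellset K) ->
  {for cellmap K y, continuous cellinv}.
Proof.
move=> Hy nK; rewrite /prop_for /continuous_at cellmapK//.
move=> P /nbhs_ballP[e /= e0 eP].
have oB : open (~` (cellmap K @` (@refcube R d `&` ~` ball y e))).
  by apply/closed_openC/cellmap_image_closed/open_closedC; exact: ball_open.
have nB : nbhs (cellmap K y) (~` (cellmap K @` (@refcube R d `&` ~` ball y e))).
  apply: open_nbhs_nbhs; split => // -[z [Hz zy]] /(inj (mem_set Hz) (mem_set Hy)).
  by move=> E; apply: zy; rewrite E; exact: ballxx.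
apply: filterS2 nK nB => x Kx Bx; have [H1 H2] := cellinvP Kx.
by apply: eP; apply: contrapT => ye; apply: Bx; exists (cellinv x).
Qed.

Variables (kappa : R) (y : vec).
Hypotheses (kappa_gt0 : 0 < kappa).
Hypothesis reg : kappa * cell_diam K ^+ d <= `|\det ('J (cellmap K) y)|.
Hypotheses (Hy : refcube y) (nK : nbhs (cellmap K y) (cellset K)).

Let A := invmx ('J (cellmap K) y).

Let det_gt0 : 0 < `|\det ('J (cellmap K) y)|.
Proof. by rewrite (lt_le_trans _ reg)// mulr_gt0// exprn_gt0// cell_diam_gt0. Qed.

Let uJ : 'J (cellmap K) y \in unitmx.
Proof. by rewrite unitmxE unitfE -normr_gt0. Qed.

(** Near the point, [f] is [q \o cellinv], and the chain rule applies with the differential of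
    [cellinv] given by the inverse Jacobian. *)
Lemma is_derive_on_cell (q f : vec -> R) (v : vec) :
  differentiable q y -> (forall z, refcube z -> f (cellmap K z) = q z) ->
  is_derive (cellmap K y) v f ('d q y (v *m A)).
Proof.
move=> dq fq; pose x := cellmap K y.
have [dG EG] := @differentiable_right_inverse R n (cellmap K) cellinv x
  (cellmap_differentiable _ _) ltac:(by rewrite cellmapK)
  (cellinv_continuous Hy nK) ltac:(by apply: filterS nK => z /cellinvP[]).
have Ex : cellinv x = y by exact: cellmapK.
have dq' : differentiable q (cellinv x) by rewrite Ex.
have dqG : differentiable (q \o cellinv) x by exact: differentiable_comp.
have E : \forall z \near x, (q \o cellinv) z = f z.
  by apply: filterS nK => z /cellinvP[H1 H2] /=; rewrite -fq// H2.
split; first by apply: near_eq_derivable E _; exact: diff_derivable.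
transitivity ('d (q \o cellinv) x v).
  by rewrite -(deriveE v dqG); exact/esym/(near_eq_derive v E).
have E1 := congr1 (fun h => h v) (diff_comp dG dq').
have E2 : 'd cellinv x v = v *m A.
  by have := congr1 (fun h => h v) EG; rewrite Ex.
apply: (etrans E1); rewrite -[LHS]/('d q (cellinv x) ('d cellinv x v)) E2.
by rewrite Ex.
Qed.

(** The gradient of the nodal function of vertex [a]: the reference gradient at [y] transported by
    the inverse Jacobian. *)
Definition basis_gradient (a : vtx) : vec :=
  \row_k \sum_l A k l * refslope a l y.

Lemma pderiv_on_cell (c : vtx -> R) (f : vec -> R) (k : 'I_d) :
  (forall z, refcube z -> f (cellmap K z) = \sum_a c a * refshape a z) ->
  is_derive (cellmap K y) (delta_mx 0 k) f (\sum_a c a * basis_gradient a 0 k).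
Proof.
move=> fc; pose q (z : vec) := \sum_a c a * refshape a z.
have Eq : q = \sum_(i < #|{: vtx}|)
    (fun z : vec => c (enum_val i) *: refshape (enum_val i) z).
  apply/funext => z; rewrite fct_sumE /q.
  by rewrite (reindex (@enum_val _ {: vtx}))//; exact/onW_bij/enum_val_bij.
have dq : differentiable q y.
  rewrite Eq; apply: differentiable_sum => i; apply: differentiableZ.
  exact: refshape_differentiable.
have H := is_derive_on_cell (delta_mx 0 k) dq fc.
apply: (is_derive_eq H).
have Eql l : 'd q y (delta_mx 0 l) = \sum_a c a * refslope a l y.
  rewrite -deriveE//.
  have D : is_derive y (delta_mx 0 l) q (\sum_a c a * refslope a l y).
    apply: derive_along_line => h; rewrite /q scaler_sumr -big_split/=.
    by apply: eq_bigr => a _; rewrite refshape_line mulrDr [_ *: _]mulrCA.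
  by rewrite (@derive_val _ _ _ _ _ _ _ D).
rewrite (row_sum_delta (_ *m _)) linear_sum.
under eq_bigr do rewrite linearZ/= Eql -rowE mxE.
under [RHS]eq_bigr do rewrite mxE mulr_sumr.
rewrite exchange_big; apply: eq_bigr => l _ /=.
by rewrite [LHS]mulr_sumr; apply: eq_bigr => a _; ring.
Qed.

Lemma sum_basis_gradient k : \sum_a basis_gradient a 0 k = 0.
Proof.
under eq_bigr do rewrite mxE.
by rewrite exchange_big big1// => l _; rewrite /= -mulr_sumr sum_refslope mulr0.
Qed.

(** This is the identity [A J = 1] read through [jacobian_cellmap], which writes the Jacobian as
    slopes times vertex positions. *)
Lemma sum_basis_gradient_pos k m :
  \sum_a basis_gradient a 0 k * pos (vertex K a) 0 m = (k == m)%:R.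
Proof.
have := mulVmx uJ; move=> /matrixP/(_ k m); rewrite !mxE => <-.
under eq_bigr do rewrite mxE mulr_suml.
rewrite exchange_big; apply: eq_bigr => l _ /=.
rewrite jacobian_cellmap mulr_sumr; apply: eq_bigr => a _.
by rewrite -mulrA.
Qed.

(** The adjugate of the Jacobian scales like the diameter to the power [n], while regularity bounds
    the determinant below by [kappa] times the power [n + 1]; the quotient is of order one over the
    diameter. *)
Lemma basis_gradient_le a k :
  `|basis_gradient a 0 k| * cell_diam K <=
    d%:R * ((n`!)%:R * #|{: vtx}|%:R ^+ n) / kappa.
Proof.
have D0 : 0 < cell_diam K by exact: cell_diam_gt0.
have Ale l : `|A k l| * cell_diam K <= (n`!)%:R * #|{: vtx}|%:R ^+ n / kappa.
  have := @invmx_le R n ('J (cellmap K) y) (#|{: vtx}|%:R * cell_diam K) k l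
    ltac:(by move=> i j; exact: jacobian_cellmap_le).
  move=> H.
  have : kappa * cell_diam K ^+ d * `|A k l| <=
      (n`!)%:R * (#|{: vtx}|%:R * cell_diam K) ^+ n.
    by apply: le_trans H; rewrite ler_wpM2r.
  rewrite exprS exprMn mulrA => H'.
  have Dn : 0 < cell_diam K ^+ n by rewrite exprn_gt0.
  rewrite ler_pdivlMr// -(ler_pM2r Dn) -[leRHS]mulrA; apply: le_trans H'.
  by rewrite le_eqVlt; apply/orP; left; apply/eqP; ring.
rewrite mxE -ler_pdivlMr// (le_trans (ler_norm_sum _ _ _))//.
rewrite ler_pdivlMr// mulr_suml.
rewrite -(mulrA d%:R) -[d in d%:R](card_ord d) -sum1_card natr_sum mulr_suml ler_sum// => l _.
rewrite mul1r (le_trans _ (Ale l))// ler_wpM2r ?(ltW D0)//.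
by rewrite normrM ler_piMr// refslope_le1.
Qed.

End cellmap_inverse.

(** * The union of the cell boundaries is a null set, and its complement lies inside cells *)

Section cell_skeleton.
Variables (R : realType) (n : nat) (M : mesh R n.+1).
Local Notation d := n.+1.
Local Notation vec := 'rV[R]_d.
Local Notation preim := (preimage (@rV_of_tuple R d)).

Definition cell_face (K : cell M) (k : 'I_d) (b : bool) : set vec :=
  cellmap K @` (@refcube R d `&` [set y | y 0 k = b%:R]).

Definition cell_skeleton : set vec :=
  \bigcup_(p : cell M * 'I_d * bool) cell_face p.1.1 p.1.2 p.2.

Lemma cell_face_measurable K k b : measurable (preim (cell_face K k b)).
Proof.
apply: closed_preimage_measurable; apply: cellmap_image_closed.
apply: (@closed_comp _ _ (fun y : vec => y 0 k) [set b%:R]).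
  by move=> y _; exact: coord_continuous.
exact: closed_eq.
Qed.

(** A face is a Lipschitz image of an [n]-dimensional cube, so the images of the points of a grid of
    mesh [1 / (m + 1)] are the centres of a covering as required by [null_of_coverings]. *)
Lemma cell_face_null K k b : lebesgue_tuple R d (preim (cell_face K k b)) = 0%E.
Proof.
have [L L0 HL] := cellmap_lipschitz K.
(* [L + 1] in place of [L] because the covering balls are open. *)
apply: (@null_of_coverings R n _ (L + 1)); first by rewrite addr_ge0// ltW.
  exact: cell_face_measurable.
move=> m.
pose c (J : {ffun 'I_n -> 'I_m.+1}) : vec :=
  \row_l if unlift k l is Some l' then (J l')%:R / m.+1%:R else b%:R.
have m0 : 0 < m.+1%:R :> R by rewrite ltr0n.
have cin J : refcube (c J).
  move=> l; rewrite mxE; case: (unlift k l) => [l'|]; last first.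
    by case: (b); rewrite ?lexx ler01.
  by rewrite divr_ge0//= ler_pdivrMr// mul1r ler_nat ltnW.
exists (cellmap K \o c) => _ [y [Hy yk] <-].
(* The cap at [m] is for the coordinate value 1, whose truncation would be [m + 1], outside the
   index range. *)
pose J : {ffun 'I_n -> 'I_m.+1} :=
  [ffun l' => inord (minn m (Num.truncn (y 0 (lift k l') * m.+1%:R)))].
exists J => //=; rewrite -ball_normE /=.
have cy : `|c J - y| <= m.+1%:R^-1.
  apply: norm_le_coord => [|l]; first by rewrite invr_ge0 ltW.
  rewrite !mxE; case: unliftP => [l'|] ->; last by rewrite yk subrr normr0 invr_ge0 ltW.
  rewrite ffunE inordK ?ltnS ?geq_minl//.
  have /andP[t0 t1] := Hy (lift k l').
  set t := y 0 (lift k l') in t0 t1 *.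
  have tm0 : 0 <= t * m.+1%:R by rewrite mulr_ge0// ltW.
  have /andP[tr1 tr2] := truncn_itv tm0.
  have -> : (minn m (Num.truncn (t * m.+1%:R)))%:R / m.+1%:R - t =
      ((minn m (Num.truncn (t * m.+1%:R)))%:R - t * m.+1%:R) / m.+1%:R.
    by rewrite mulrBl mulfK// gt_eqF.
  rewrite normrM [X in _ * X]ger0_norm ?invr_ge0 ?(ltW m0)//.
  rewrite -[leRHS]mul1r ler_wpM2r ?invr_ge0 ?(ltW m0)//.
  have [mt|tm] := leqP m (Num.truncn (t * m.+1%:R)).
    have : m%:R <= t * m.+1%:R by rewrite (le_trans _ tr1)// ler_nat.
    have : t * m.+1%:R <= m%:R + 1 by rewrite natr1 ler_piMl// ltW.
    rewrite ler_distl; lra.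
  rewrite ler_distl; move: tr1 tr2; rewrite -natr1; lra.
rewrite distrC in cy.
rewrite distrC (le_lt_trans (HL _ _ Hy (cin J)))//.
apply: (@le_lt_trans _ _ (L / m.+1%:R)); first by rewrite ler_wpM2l// ltW.
by rewrite ltr_pM2r ?invr_gt0// ltrDl.
Qed.

Let skeletonE : preim cell_skeleton =
  \big[setU/set0]_(p <- enum {: cell M * 'I_d * bool})
    preim (cell_face p.1.1 p.1.2 p.2).
Proof.
rewrite -bigcup_seq /cell_skeleton preimage_bigcup.
apply/seteqP; split => t [p _ Hp]; exists p => //=.
by rewrite mem_enum.
Qed.

Lemma cell_skeleton_measurable : measurable (preim cell_skeleton).
Proof.
by rewrite skeletonE; apply: bigsetU_measurable => p _; exact: cell_face_measurable.
Qed.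

Lemma cell_skeleton_null : lebesgue_tuple R d (preim cell_skeleton) = 0%E.
Proof.
apply/eqP; rewrite eq_le measure_ge0 andbT skeletonE.
apply: le_trans (measure_bigsetU_le _ _ _) _.
  by move=> p; exact: cell_face_measurable.
by rewrite big1// => p _; exact: cell_face_null.
Qed.

Lemma refcube_open_off_skeleton (K : cell M) y : refcube y ->
  ~ cell_skeleton (cellmap K y) -> refcube_open y.
Proof.
move=> Hy Ny k; have /andP[y0 y1] := Hy k.
rewrite !lt_neqAle y0 y1 !andbT; apply/andP; split; apply/eqP => E; apply: Ny.
  by exists (K, k, false) => //; exists y.
by exists (K, k, true) => //; exists y.
Qed.

(** Off the skeleton a point of a cell is the image of an interior point of the cube, so it belongs
    to a single cell [K]. The other cells are closed and finitely many, hence a neighbourhood avoids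
    them all; since the cells cover [D], that neighbourhood, cut down to [D], lies in [K]. *)
Lemma cell_nbhs_off_skeleton (D : set vec) x : mesh_of M D -> open D ->
  D x -> ~ cell_skeleton x ->
  exists (K : cell M) y, [/\ refcube y, cellmap K y = x & nbhs x (cellset K)].
Proof.
move=> [_ _ _ cD disj] oD Dx Nx.
have : closure D x by exact: subset_closure.
rewrite cD => -[K _ [y Hy yx]]; exists K, y; split => //.
have oy : refcube_open y by apply: (@refcube_open_off_skeleton K) => //; rewrite yx.
have nL (L : cell M) : \forall z \near x, L != K -> ~ cellset L z.
  have [->|LK] := eqVneq L K; first by near=> z.
  suff : \forall z \near x, (~` cellset L) z by apply: filterS.
  apply: open_nbhs_nbhs; split.
    apply: closed_openC; rewrite /cellset -[@refcube R d]setIT.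
    exact: cellmap_image_closed closedT.
  move=> [z Hz zx]; have oz : refcube_open z.
    by apply: (@refcube_open_off_skeleton L) => //; rewrite zx.
  have := disj _ _ LK; apply/eqP/set0P; exists x.
  by split; [exists z|exists y].
have nD : \forall z \near x, D z by exact: open_nbhs_nbhs.
have nLs : \forall z \near x, forall L : cell M, L != K -> ~ cellset L z.
  exact: (@filter_forall _ _ (fun L z => L != K -> ~ cellset L z) _ _ nL).
apply: filterS2 nD nLs => z Dz Lz.
have : closure D z by exact: subset_closure.
rewrite cD => -[L _ Lz']; have [<-//|LK] := eqVneq L K.
by have := Lz _ LK.
Unshelve. all: by end_near. Qed.

End cell_skeleton.

(** * Uniform first-order expansions: algebra, interior derivatives and real powers *)

Section expansions.
Variables (R : realType) (d : nat).
Local Notation vec := 'rV[R]_d.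
Implicit Types (E : set vec) (f g : vec -> R) (F G : vec -> vec).

(* A bounded first-order Taylor expansion, uniform on [E], which need be neither
   open nor convex. *)
Definition expands E f F := exists2 L : R, 0 < L & forall x, E x ->
  [/\ `|f x| <= L, forall k, `|F x 0 k| <= L &
      forall x', E x' -> `|f x' - f x - dot (F x) (x' - x)| <= L * `|x' - x| ^+ 2].

(** At distance at most 1 the linear term gives [d * L] and the quadratic remainder at most [L]; at
    larger distance the bound [2 * L] on the increment is enough. No segment between the points has
    to lie in [E]. *)
Lemma expands_lipschitz E f F : expands E f F ->
  exists2 L : R, 0 < L & forall x x', E x -> E x' -> `|f x' - f x| <= L * `|x' - x|.
Proof.
move=> [L L0 H]; exists ((d%:R + 2) * L) => [|x x' Ex Ex'].
  by rewrite mulr_gt0// ltr_wpDl.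
have [fx Fx /(_ _ Ex') ex] := H x Ex; have [fx' _ _] := H x' Ex'.
set v := x' - x in ex *.
have d0 : 0 <= d%:R * L * `|v| by rewrite !mulr_ge0// ltW.
have [v1|v1] := leP `|v| 1.
  have Dv := norm_dot_le v Fx.
  rewrite -(subrK (dot (F x) v) (f x' - f x)) (le_trans (ler_normD _ _))//.
  rewrite (le_trans (lerD ex Dv))//.
  have : L * `|v| ^+ 2 <= L * `|v| by rewrite ler_pM2l// expr2 ler_piMl.
  have : 0 <= L * `|v| by rewrite mulr_ge0// ltW.
  by rewrite mulrDl mulrDl; lra.
rewrite (le_trans (ler_normB _ _))//.
have : L <= L * `|v| by rewrite ler_peMr// ltW.
by rewrite mulrDl mulrDl; lra.
Qed.

Lemma dotDl (u v w : vec) : dot (u + v) w = dot u w + dot v w.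
Proof. by rewrite /dot mulmxDl mxE. Qed.

Lemma dotZl (c : R) (u w : vec) : dot (c *: u) w = c * dot u w.
Proof. by rewrite /dot -scalemxAl mxE. Qed.

(** The remainder of the product is each factor times the remainder of the other, plus the product
    of the two increments, which is quadratic by [expands_lipschitz]. *)
Lemma expands_mul E f F g G : expands E f F -> expands E g G ->
  expands E (fun x => f x * g x) (fun x => f x *: G x + g x *: F x).
Proof.
move=> ef eg; have [Lf Lf0 Hlf] := expands_lipschitz ef.
have [Lg Lg0 Hlg] := expands_lipschitz eg.
case: ef => L L0 Hf; case: eg => K K0 Hg.
exists (3 * L * K + Lf * Lg) => [|x Ex].
  by rewrite addr_gt0// !mulr_gt0.
have LK0 : 0 < L * K by rewrite mulr_gt0.
have LL0 : 0 < Lf * Lg by rewrite mulr_gt0.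
have [fx Fx ef] := Hf x Ex; have [gx Gx eg] := Hg x Ex; split.
- rewrite normrM; have : `|f x| * `|g x| <= L * K by exact: ler_pM.
  by rewrite -mulrA; lra.
- move=> k; rewrite !mxE (le_trans (ler_normD _ _))// !normrM.
  have := ler_pM (normr_ge0 _) (normr_ge0 _) fx (Gx k).
  have := ler_pM (normr_ge0 _) (normr_ge0 _) gx (Fx k).
  by rewrite -mulrA (mulrC K); lra.
move=> x' Ex'; have := ef x' Ex'; have := eg x' Ex'.
have lf := Hlf x x' Ex Ex'; have lg := Hlg x x' Ex Ex'.
rewrite dotDl !dotZl; set v := x' - x in lf lg *.
set A := f x' - f x - _; set B := g x' - g x - _ => HB HA.
rewrite (_ : _ - _ = f x * B + g x * A + (f x' - f x) * (g x' - g x)); last first.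
  by rewrite /A /B; ring.
rewrite (le_trans (ler_normD _ _))// (le_trans (lerD (ler_normD _ _) (lexx _)))//.
rewrite !normrM.
have h1 := ler_pM (normr_ge0 _) (normr_ge0 _) fx HB.
have h2 := ler_pM (normr_ge0 _) (normr_ge0 _) gx HA.
have h3 := ler_pM (normr_ge0 _) (normr_ge0 _) lf lg.
have e1 : L * (K * `|v| ^+ 2) = (L * K) * `|v| ^+ 2 by rewrite mulrA.
have e2 : K * (L * `|v| ^+ 2) = (L * K) * `|v| ^+ 2 by rewrite mulrA (mulrC K).
have e3 : Lf * `|v| * (Lg * `|v|) = (Lf * Lg) * `|v| ^+ 2 by ring.
have : 0 <= (L * K) * `|v| ^+ 2 by rewrite mulr_ge0 ?exprn_ge0// ltW.
by rewrite mulrDl -!mulrA; rewrite -!mulrA in h1 h2 h3 e1 e2 e3; lra.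
Qed.

(** The remainder is that of [p] at [f x], quadratic in the Lipschitz increment of [f], plus
    [p1 (f x)] times that of [f]. *)
Lemma expands_comp E f F (p p1 : R -> R) (P : set R) (C : R) :
  expands E f F -> (forall x, E x -> P (f x)) ->
  (forall s, P s -> [/\ `|p s| <= C, `|p1 s| <= C &
     forall s', P s' -> `|p s' - p s - p1 s * (s' - s)| <= C * (s' - s) ^+ 2]) ->
  expands E (fun x => p (f x)) (fun x => p1 (f x) *: F x).
Proof.
move=> ef EP HC; have [Lf Lf0 Hlf] := expands_lipschitz ef.
case: ef => L L0 Hf.
have [K K0 CK] : exists2 K : R, 0 < K & C <= K.
  by exists (`|C| + 1); [rewrite ltr_wpDl|rewrite (le_trans (ler_norm C))// lerDl].
have KL0 : 0 < K * L by rewrite mulr_gt0.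
have KLf0 : 0 < K * Lf ^+ 2 by rewrite mulr_gt0 ?exprn_gt0.
exists (K + K * L + K * Lf ^+ 2) => [|x Ex]; first by move: K0 KL0 KLf0; lra.
have [px p1x ep] := HC _ (EP _ Ex); have [fx Fx ef] := Hf x Ex; split.
- by move: px; lra.
- move=> k; rewrite !mxE normrM.
  have := ler_pM (normr_ge0 _) (normr_ge0 _) (le_trans p1x CK) (Fx k); lra.
move=> x' Ex'; have := ep _ (EP _ Ex'); have := ef _ Ex'.
rewrite dotZl; set v := x' - x; set A := _ - _ - dot _ _; set B := _ - _ - _ => HA HB.
rewrite (_ : _ - _ = B + p1 (f x) * A); last by rewrite /A /B; ring.
rewrite (le_trans (ler_normD _ _))// normrM.
have h1 := ler_pM (normr_ge0 _) (normr_ge0 _) (le_trans p1x CK) HA.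
have h2 : C * (f x' - f x) ^+ 2 <= K * (Lf * `|v|) ^+ 2.
  rewrite (@le_trans _ _ (K * (f x' - f x) ^+ 2))//; first by rewrite ler_wpM2r// sqr_ge0.
  rewrite ler_pM2l// -real_normK ?num_real//.
  by rewrite lerXn2r ?nnegrE// ?Hlf// mulr_ge0// ltW.
have e2 : K * (Lf * `|v|) ^+ 2 = K * Lf ^+ 2 * `|v| ^+ 2 by ring.
rewrite mulrA in h1; have h3 := le_trans HB h2; rewrite e2 in h3.
have Kv : 0 <= K * `|v| ^+ 2 by rewrite mulr_ge0 ?exprn_ge0// ltW.
by rewrite !mulrDl; lra.
Qed.

(** At interior points the quadratic remainder forces [F] to be the gradient. This links expansions
    on the closed domain to the classical derivatives under the integrals. *)
Lemma expands_pderiv E f F x k : expands E f F -> nbhs x E ->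
  is_derive x (delta_mx 0 k) f (F x 0 k).
Proof.
move=> [L L0 H] nE; have Ex : E x by exact: nbhs_singleton.
have [_ _ {H}H] := H x Ex.
have C : h^-1 *: ((f \o shift x) (h *: delta_mx 0 k) - f x) @[h --> 0^'] --> F x 0 k.
  apply/cvgrPdist_le => e e0.
  have nE' : \forall h \near (0 : R), E (h *: delta_mx 0 k + x).
    have c : {for 0, continuous (fun h : R => h *: (delta_mx 0 k : vec) + x)}.
      by apply: continuousD; [exact: scalel_continuous|exact: cst_continuous].
    by apply: c; rewrite scale0r add0r.
  near=> h.
  have h0 : h != 0 by near: h; exact: nbhs_dnbhs_neq.
  have Eh : E (h *: delta_mx 0 k + x) by near: h; exact: nbhs_dnbhs.
  have he : `|h| <= e / L.
    by near: h; apply: dnbhs0_le; rewrite divr_gt0.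
  have := H _ Eh; rewrite addrK.
  have -> : dot (F x) (h *: delta_mx 0 k) = h * F x 0 k.
    rewrite dot_sum (bigD1 k)//= big1 ?addr0 => [|l lk].
      by rewrite !mxE !eqxx mulr1 mulrC.
    by rewrite !mxE eqxx (negbTE lk) !mulr0.
  have D1 : `|delta_mx 0 k : vec| <= 1.
    apply: norm_le_coord => // l; rewrite mxE eqxx/=.
    by case: (l == k); rewrite ?normr1 ?normr0.
  rewrite mx_normZ exprMn => H1.
  have {}H1 : `|f (h *: delta_mx 0 k + x) - f x - h * F x 0 k| <= L * `|h| ^+ 2.
    rewrite (le_trans H1)// ler_pM2l// ler_piMr ?exprn_ge0//.
    by rewrite exprn_ile1.
  rewrite /= (_ : F x 0 k - _ = - h^-1 * (f (h *: delta_mx 0 k + x) - f x - h * F x 0 k)).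
    rewrite normrM normrN normfV ler_pdivrMl ?normr_gt0// (le_trans H1)//.
    by rewrite expr2 mulrCA ler_pM2l ?normr_gt0// mulrC -ler_pdivlMr.
  by rewrite mulrBr mulNr mulNr mulrA mulVf// mul1r opprK addrC.
split; first by apply/cvg_ex; eexists; exact: C.
exact: cvg_lim C.
Unshelve. all: by end_near. Qed.

Lemma expands_continuous E f F x : expands E f F -> nbhs x E ->
  {for x, continuous f}.
Proof.
move=> /expands_lipschitz[L L0 H] nE; have Ex : E x by exact: nbhs_singleton.
apply/(@cvgrPdist_lt _ _ _ (nbhs x)) => e e0.
have nB : \forall z \near x, ball x (e / L) z.
  by apply: nbhsx_ballx; rewrite divr_gt0.
apply: filterS2 nE nB => z Ez; rewrite -ball_normE /= => zx.
by rewrite distrC (le_lt_trans (H _ _ Ex Ez))// mulrC -ltr_pdivlMr// distrC.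
Qed.

End expansions.

Section second_order.
Variable R : realType.
Implicit Types (p q : R -> R).

(** The intermediate point is located by its distance to [s], so that one statement serves [s < s'],
    [s' < s] and [s = s']. *)
Lemma mean_value p q (a b s s' : R) :
  (forall t, a <= t <= b -> is_derive t 1 p (q t)) ->
  a <= s <= b -> a <= s' <= b ->
  exists c, [/\ a <= c <= b, `|c - s| <= `|s' - s| & p s' - p s = q c * (s' - s)].
Proof.
move=> H.
have mv u u' : a <= u <= b -> a <= u' <= b -> u < u' ->
    exists2 c, u < c < u' & p u' - p u = q c * (u' - u).
  move=> /andP[au ub] /andP[au' u'b] uu'.
  have Hd t : t \in `[u, u'] -> is_derive t 1 p (q t).
    rewrite in_itv/= => /andP[t1 t2]; apply: H.
    by rewrite (le_trans au t1) (le_trans t2 u'b).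
  have D1 t : t \in `]u, u'[ -> is_derive t 1 p (q t).
    by move=> tu; apply: Hd; exact: subset_itv_oo_cc tu.
  have D2 : {within `[u, u'], continuous p}.
    apply: derivable_within_continuous => t tu.
    exact: (@ex_derive _ _ _ _ _ _ _ (Hd t tu)).
  have [c cu E] := MVT uu' D1 D2.
  by exists c => //; move: cu; rewrite in_itv.
move=> sab s'ab; have [ss'|s's|->] := ltgtP s s'.
- have [c cu E] := mv _ _ sab s'ab ss'; exists c; split => //; first by lra.
  by rewrite !ger0_norm; lra.
- have [c cu E] := mv _ _ s'ab sab s's; exists c; split; first by lra.
    by rewrite !ler0_norm; lra.
  by rewrite -opprB E -mulrN opprB.
- by exists s'; split => //; rewrite ?subrr ?mulr0.
Qed.

(** Two applications of the mean value theorem; the intermediate point lies no farther from [s] than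
    [s'], which gives the constant [C] instead of the sharp [C / 2]. *)
Lemma second_order_bound p p1 p2 (a b C s s' : R) :
  (forall t, a <= t <= b -> is_derive t 1 p (p1 t)) ->
  (forall t, a <= t <= b -> is_derive t 1 p1 (p2 t)) ->
  (forall t, a <= t <= b -> `|p2 t| <= C) ->
  a <= s <= b -> a <= s' <= b ->
  `|p s' - p s - p1 s * (s' - s)| <= C * (s' - s) ^+ 2.
Proof.
move=> H1 H2 HC sab s'ab.
have [c [cab cs ->]] := mean_value H1 sab s'ab.
have [e [eab es E]] := mean_value H2 sab cab.
rewrite -mulrBl E -mulrA normrM ler_pM//; first exact: HC.
by rewrite normrM -real_normK ?num_real// expr2 ler_wpM2r.
Qed.

(** Since the power is the exponential of [r * ln s], bounding [|ln s|] by the values at both ends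
    treats either sign of [r] alike. *)
Lemma powR_bound (r a b s : R) : 0 < a -> a <= s <= b ->
  `|s `^ r| <= expR (`|r| * (`|ln a| + `|ln b|)).
Proof.
move=> a0 /andP[as_ sb]; have s0 : 0 < s by exact: lt_le_trans as_.
rewrite /powR gt_eqF// ger0_norm ?expR_ge0// ler_expR.
rewrite (le_trans (ler_norm _))// normrM ler_wpM2l//.
have : ln a <= ln s by rewrite ler_ln.
have : ln s <= ln b by rewrite ler_ln ?posrE// (lt_le_trans s0).
have := ler_norm (ln a); have := ler_norm (ln b).
have := ler_norm (- ln a); have := ler_norm (- ln b); rewrite !normrN ler_norml.
by move=> *; apply/andP; split; lra.
Qed.

Lemma powR_expansion (r a b : R) : 0 < a -> exists C : R, forall s, a <= s <= b ->
  [/\ `|s `^ r| <= C, `|r * s `^ (r - 1)| <= C &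
    forall s', a <= s' <= b ->
      `|s' `^ r - s `^ r - r * s `^ (r - 1) * (s' - s)| <= C * (s' - s) ^+ 2].
Proof.
move=> a0.
pose B (t : R) : R := expR (`|t| * (`|ln a| + `|ln b|)).
have B0 t : 0 <= B t by exact: expR_ge0.
exists (B r + `|r| * B (r - 1) + `|r * (r - 1)| * B (r - 1 - 1)) => s sab.
have t1 : 0 <= `|r| * B (r - 1) by rewrite mulr_ge0.
have t2 : 0 <= `|r * (r - 1)| * B (r - 1 - 1) by rewrite mulr_ge0.
split.
- by have := powR_bound r a0 sab; rewrite -/(B r); have := B0 r; lra.
- have : `|r * s `^ (r - 1)| <= `|r| * B (r - 1).
    by rewrite normrM ler_wpM2l// powR_bound.
  by have := B0 r; lra.
move=> s' s'ab.
have H : `|s' `^ r - s `^ r - r * s `^ (r - 1) * (s' - s)| <=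
    (`|r * (r - 1)| * B (r - 1 - 1)) * (s' - s) ^+ 2.
  apply: (@second_order_bound (fun t => t `^ r) (fun t => r * t `^ (r - 1))
    (fun t => r * ((r - 1) * t `^ (r - 1 - 1))) a b) => // t tab.
  - by apply: is_derive1_powR; lra.
  - by apply: is_deriveZ; apply: is_derive1_powR; lra.
  - by rewrite mulrA normrM ler_wpM2l// powR_bound.
by rewrite (le_trans H)// ler_wpM2r ?sqr_ge0//; have := B0 r; lra.
Qed.

End second_order.

(** * Integrals of bounded measurable functions and measurability of derivatives *)

Section bounded_measurable.
Context {disp : measure_display} {T : measurableType disp} {R : realType}.
Variables (mu : {measure set T -> \bar R}) (E : set T).
Hypotheses (mE : measurable E) (finE : (mu E < +oo)%E).
Implicit Types f g : T -> R.

(** On a set of finite measure this implies integrability, and unlike integrability it is stable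
    under products. *)
Definition bounded_mfun f :=
  measurable_fun E f /\ exists M : R, forall x, E x -> `|f x| <= M.

Lemma bounded_mfun_integrable f : bounded_mfun f -> mu.-integrable E (EFin \o f).
Proof.
move=> [mf [M HM]]; apply: measurable_bounded_integrable => //.
exists M; split; first exact: num_real.
by move=> K MK x Ex /=; rewrite (le_trans (HM _ Ex))// ltW.
Qed.

Lemma bounded_mfun_cst c : bounded_mfun (fun=> c).
Proof. by split; [exact: measurable_cst|exists `|c|]. Qed.

Lemma bounded_mfunD f g : bounded_mfun f -> bounded_mfun g ->
  bounded_mfun (fun x => f x + g x).
Proof.
move=> [mf [M HM]] [mg [K HK]]; split; first exact: measurable_funD.
by exists (M + K) => x Ex; rewrite (le_trans (ler_normD _ _))// lerD// ?HM// HK.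
Qed.

Lemma bounded_mfunM f g : bounded_mfun f -> bounded_mfun g ->
  bounded_mfun (fun x => f x * g x).
Proof.
move=> [mf [M HM]] [mg [K HK]]; split; first exact: measurable_funM.
by exists (M * K) => x Ex; rewrite normrM ler_pM// ?HM// HK.
Qed.

Lemma bounded_mfunZ c f : bounded_mfun f -> bounded_mfun (fun x => c * f x).
Proof. by move=> bf; apply: bounded_mfunM => //; exact: bounded_mfun_cst. Qed.

Lemma bounded_mfunB f g : bounded_mfun f -> bounded_mfun g ->
  bounded_mfun (fun x => f x - g x).
Proof.
move=> bf bg; rewrite (_ : (fun _ => _) = (fun x => f x + -1 * g x)).
  by apply: bounded_mfunD => //; exact: bounded_mfunZ.
by apply/funext => x; rewrite mulN1r.
Qed.

Lemma bounded_mfun_norm f : bounded_mfun f -> bounded_mfun (fun x => `|f x|).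
Proof.
move=> [mf [M HM]]; split; first exact: measurableT_comp.
by exists M => x Ex; rewrite normr_id HM.
Qed.

Lemma bounded_mfun_sum (I : Type) (s : seq I) (F : I -> T -> R) :
  (forall i, bounded_mfun (F i)) -> bounded_mfun (fun x => \sum_(i <- s) F i x).
Proof.
move=> bF; elim: s => [|i s IH].
  rewrite (_ : (fun _ => _) = fun=> 0); first exact: bounded_mfun_cst.
  by apply/funext => x; rewrite big_nil.
rewrite (_ : (fun _ => _) = fun x => F i x + \sum_(i <- s) F i x).
  exact: bounded_mfunD.
by apply/funext => x; rewrite big_cons.
Qed.

Lemma Rintegral_sum (I : Type) (s : seq I) (F : I -> T -> R) :
  (forall i, bounded_mfun (F i)) ->
  \int[mu]_(x in E) (\sum_(i <- s) F i x) = \sum_(i <- s) \int[mu]_(x in E) F i x.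
Proof.
move=> bF; elim: s => [|i s IH].
  rewrite big_nil (@eq_Rintegral _ _ _ mu E (fun=> 0)) => [|x _].
    by rewrite Rintegral_cst ?mul0r.
  by rewrite big_nil.
rewrite big_cons -IH -RintegralD//; last 2 first.
- exact: bounded_mfun_integrable.
- by apply: bounded_mfun_integrable; exact: bounded_mfun_sum.
by apply: eq_Rintegral => x _; rewrite big_cons.
Qed.

Lemma norm_Rintegral_le f g : bounded_mfun f -> bounded_mfun g ->
  (forall x, E x -> `|f x| <= g x) ->
  `|\int[mu]_(x in E) f x| <= \int[mu]_(x in E) g x.
Proof.
move=> bf bg fg; rewrite (le_trans (le_normr_Rintegral _ _))//.
  exact: bounded_mfun_integrable.
apply: le_Rintegral => //; apply: bounded_mfun_integrable => //.
exact: bounded_mfun_norm.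
Qed.

Lemma Rintegral_ae_eq0 f : measurable_fun E f ->
  (ae_eq mu E f (fun=> 0)) -> \int[mu]_(x in E) f x = 0.
Proof.
move=> mf f0; rewrite /Rintegral.
suff -> : (\int[mu]_(x in E) (f x)%:E = 0)%E by [].
rewrite -[RHS](integral0 mu E); apply: ae_eq_integral => //.
- exact/measurable_EFinP.
- by move: f0; apply: filterS => x H Ex /=; rewrite H.
Qed.

Lemma ae_eq0_Rintegral f : bounded_mfun f -> (forall x, E x -> 0 <= f x) ->
  \int[mu]_(x in E) f x = 0 -> ae_eq mu E f (fun=> 0).
Proof.
move=> bf f0 I0; have /integrableP[mf If] := bounded_mfun_integrable bf.
have Iabs : (\int[mu]_(x in E) `|(f x)%:E| = \int[mu]_(x in E) (f x)%:E)%E.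
  by apply: eq_integral => x /set_mem Ex; rewrite gee0_abs// lee_fin f0.
have : ae_eq mu E (EFin \o f) (cst 0%E).
  apply/(ae_eq_integral_abs mu mE mf); rewrite /= Iabs -[LHS]fineK.
    by rewrite -/(Rintegral mu E f) I0.
  by rewrite -Iabs ge0_fin_numE// integral_ge0.
by apply: filterS => x H /H[].
Qed.

End bounded_measurable.

Section domain_measurability.
Variables (R : realType) (d : nat).
Local Notation vec := 'rV[R]_d.
Local Notation preim := (preimage (@rV_of_tuple R d)).
Local Notation mtup := (d.-tuple (measurableTypeR R)).

Lemma continuous_on_open_measurable (D : set vec) (f : vec -> R) : open D ->
  (forall x, D x -> {for x, continuous f}) ->
  measurable_fun (preim D) (f \o @rV_of_tuple R d : mtup -> R).
Proof.
move=> oD cf; apply: (measurability _ (RGenOpens.measurableE R)).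
move=> _ [_ [a [b ->] <-]].
rewrite (_ : _ `&` _ = preim (D `&` f @^-1` `]a, b[%classic))//.
apply: open_preimage_measurable; rewrite openE => x [Dx fx].
apply: filterI; first exact: open_nbhs_nbhs.
by apply: cf => //; apply: open_nbhs_nbhs; split => //; exact: interval_open.
Qed.

Lemma translation_continuous (v : vec) : continuous (fun x : vec => v + x).
Proof.
move=> x; apply/(@cvgrPdist_lt _ _ _ (nbhs x)) => r r0.
have := nbhsx_ballx x r r0; apply: filterS => z.
by rewrite -ball_normE /= opprD addrACA subrr add0r.
Qed.

(** The derivative is the pointwise limit of the difference quotients with steps [1 / (m + 1)]. A
    shifted point may leave [D], where nothing is known of [f]; the quotients use the extension
    [f \_ D] by zero, which makes no difference for large [m]. *)
Lemma pderiv_measurable (D A : set vec) (f : vec -> R) (k : 'I_d) :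
  open D -> A `<=` D -> measurable (preim A) ->
  (forall x, D x -> {for x, continuous f}) ->
  (forall x, A x -> derivable f x (delta_mx 0 k)) ->
  measurable_fun (preim A) (pderiv k f \o @rV_of_tuple R d : mtup -> R).
Proof.
move=> oD AD mA cf df.
pose e m : vec := (m.+1%:R)^-1 *: delta_mx 0 k.
pose h m (x : vec) := m.+1%:R * ((f \_ D) (e m + x) - f x).
have mD := open_preimage_measurable oD.
have mfA : measurable_fun (preim A) (f \o @rV_of_tuple R d : mtup -> R).
  by apply: measurable_funS (continuous_on_open_measurable oD cf) => // t /AD.
have mh m : measurable_fun (preim A) (h m \o @rV_of_tuple R d : mtup -> R).
  apply: measurable_funM; first exact: measurable_cst.
  apply: measurable_funB => //.
  pose D' := [set x | D (e m + x)].
  have cs (x : vec) : {for x, continuous (fun x => e m + x)}.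
    exact: translation_continuous.
  have oD' : open D'.
    rewrite openE => x D'x; apply: cs; exact: open_nbhs_nbhs.
  rewrite (_ : (fun _ => _) =
    ((fun x => f (e m + x)) \o @rV_of_tuple R d : mtup -> R) \_ (preim D')).
    apply/measurable_restrict => //; first exact: open_preimage_measurable.
    apply: (@measurable_funS _ _ _ _ (preim D')) => //.
      exact: open_preimage_measurable.
    apply: (@continuous_on_open_measurable D' (fun x => f (e m + x))) => // x D'x.
    by apply: continuous_comp; [exact: cs|exact: cf].
  apply/funext => t; rewrite /= !patchE.
  suff -> : (t \in preim D') = (e m + rV_of_tuple t \in D) by [].
  by apply/idP/idP => /set_mem ?; exact: mem_set.
apply: (measurable_fun_cvg mh) => t /= At; set x := rV_of_tuple t.
have Dx := AD _ At.
have /cvg_ex := df _ At; rewrite /= => -[l Hl].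
have -> : pderiv k f x = l by exact: cvg_lim Hl.
have hm0 : (forall m, @harmonic R m != 0) /\ @harmonic R @ \oo --> (0 : R).
  by split => [m|]; [rewrite /harmonic/= invr_eq0|exact: cvg_harmonic].
have C := (cvgr_dnbhsP _ _ _).1 Hl _ hm0.
apply: cvg_trans C; apply: near_eq_cvg.
have nD : \forall m \near \oo, D (e m + x).
  have nE : \forall s \near (0 : R), D (s *: delta_mx 0 k + x).
    have c : {for 0, continuous (fun s : R => s *: (delta_mx 0 k : vec) + x)}.
      by apply: continuousD; [exact: scalel_continuous|exact: cst_continuous].
    by apply: c; rewrite scale0r add0r; exact: open_nbhs_nbhs.
  exact: (hm0.2 _ nE).
by apply: filterS nD => m Dm /=; rewrite /h patchE mem_set// /harmonic/= invrK.
Qed.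

End domain_measurability.

(** * Taylor expansion, uniform on a compact set, and its use on a time slice of the solution *)

Section taylor.
Variables (R : realType) (d : nat).
Local Notation vec := 'rV[R]_d.

Lemma is_derive_line (V : normedModType R) (f : V -> R) (v x : V) (t : R) :
  derivable f (t *: v + x) v ->
  is_derive t 1 (fun s => f (s *: v + x)) ('D_v f (t *: v + x)).
Proof.
move=> df.
have E : (fun h => h^-1 *: (((fun s => f (s *: v + x)) \o shift t) (h *: (1 : R)) -
     f (t *: v + x))) =
   (fun h => h^-1 *: ((f \o shift (t *: v + x)) (h *: v) - f (t *: v + x))).
  by apply/funext => h /=; rewrite [h%:A]mulr1 scalerDl addrA.
by split; rewrite /derivable /derive E.
Qed.

Lemma derive_coord_sum (f : vec -> R) (x v : vec) : differentiable f x ->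
  'D_v f x = \sum_k v 0 k * 'D_(delta_mx 0 k) f x.
Proof.
move=> df; rewrite deriveE// {1}(row_sum_delta v) linear_sum.
by apply: eq_bigr => k _; rewrite linearZ/= deriveE.
Qed.

Lemma is_derive_line_sum (f : vec -> R) (g : 'I_d -> vec -> R) (v x : vec) (t : R) :
  differentiable f (t *: v + x) ->
  (forall k, 'D_(delta_mx 0 k) f (t *: v + x) = g k (t *: v + x)) ->
  is_derive t 1 (fun s => f (s *: v + x)) (\sum_k v 0 k * g k (t *: v + x)).
Proof.
move=> df fg; have := is_derive_line (diff_derivable (v := v) df).
rewrite derive_coord_sum// => H; apply: is_derive_eq H _.
by apply: eq_bigr => k _; rewrite fg.
Qed.

Lemma ball_segment (x0 x x' : vec) (r t : R) : 0 <= t <= 1 ->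
  ball x0 r x -> ball x0 r x' -> ball x0 r (t *: (x' - x) + x).
Proof.
move=> /andP[t0 t1]; rewrite -!ball_normE /= => xr xr'.
rewrite (_ : x0 - _ = t *: (x0 - x') + (1 - t) *: (x0 - x)); last first.
  by apply/matrixP => i j; rewrite !mxE; ring.
rewrite (le_lt_trans (ler_normD _ _))// !mx_normZ !ger0_norm ?subr_ge0//.
have [->|tn0] := eqVneq t 0; first by rewrite mul0r add0r subr0 mul1r.
have t0' : 0 < t by rewrite lt_neqAle eq_sym tn0.
have h1 : t * `|x0 - x'| < t * r by rewrite ltr_pM2l.
have h2 : (1 - t) * `|x0 - x| <= (1 - t) * r.
  by rewrite ler_wpM2l ?subr_ge0// ltW.
by rewrite (lt_le_trans (ltr_leD h1 h2))// -mulrDl addrC subrK mul1r.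
Qed.

Lemma taylor_on_ball (f : vec -> R) (f1 : 'I_d -> vec -> R)
    (f2 : 'I_d -> 'I_d -> vec -> R) (x0 : vec) (r M : R) :
  (forall z, ball x0 r z -> differentiable f z) ->
  (forall z k, ball x0 r z -> 'D_(delta_mx 0 k) f z = f1 k z) ->
  (forall z k, ball x0 r z -> differentiable (f1 k) z) ->
  (forall z k l, ball x0 r z -> 'D_(delta_mx 0 l) (f1 k) z = f2 k l z) ->
  (forall z k l, ball x0 r z -> `|f2 k l z| <= M) ->
  forall x x', ball x0 r x -> ball x0 r x' ->
    `|f x' - f x - \sum_k (x' - x) 0 k * f1 k x| <= d%:R ^+ 2 * M * `|x' - x| ^+ 2.
Proof.
move=> df e1 df1 e2 b2 x x' xr xr'; set v := x' - x.
have B t : 0 <= t <= 1 -> ball x0 r (t *: v + x) by move=> ?; exact: ball_segment.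
have := @second_order_bound R (fun t => f (t *: v + x))
  (fun t => \sum_k v 0 k * f1 k (t *: v + x))
  (fun t => \sum_k v 0 k * \sum_l v 0 l * f2 k l (t *: v + x))
  0 1 (d%:R ^+ 2 * M * `|v| ^+ 2) 0 1.
rewrite subr0 mulr1 expr1n mulr1 scale1r scale0r add0r subrK; apply.
- move=> t t01; apply: is_derive_line_sum; first exact/df/B.
  by move=> k; exact/e1/B.
- move=> t t01.
  rewrite (_ : (fun _ => _) = \sum_(k < d) (fun s => v 0 k *: f1 k (s *: v + x))); last first.
    by apply/funext => s; rewrite fct_sumE.
  apply: is_derive_sum => k; apply: is_deriveZ; apply: is_derive_line_sum.
    exact/df1/B.
  by move=> l; exact/e2/B.
- move=> t t01; rewrite (le_trans (ler_norm_sum _ _ _))//.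
  rewrite (@le_trans _ _ (\sum_(k < d) (`|v| * \sum_(l < d) (`|v| * M))))//.
    apply: ler_sum => k _; rewrite normrM ler_pM ?coord_le_norm//.
    rewrite (le_trans (ler_norm_sum _ _ _))// ler_sum// => l _.
    by rewrite normrM ler_pM ?coord_le_norm// b2//; exact: B.
  rewrite !sumr_const !card_ord mulrnAr expr2 -!mulrA !mulr_natl expr2.
  by rewrite mulrA [_ * M]mulrC.
- by rewrite lexx ler01.
- by rewrite lexx ler01.
Qed.

Lemma near_bounded (f : vec -> R) (x : vec) : {for x, continuous f} ->
  \forall z \near x, `|f z| <= `|f x| + 1.
Proof.
move=> cf; have := cf _ (nbhsx_ballx (f x) 1 ltr01).
apply: (@filterS _ _ (@nbhs_filter vec x)) => z; rewrite -ball_normE /= => H.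
have := ler_normB (f x) (f x - f z).
by rewrite opprB addrC subrK; move: H; lra.
Qed.

Lemma near_bounded_family (I : finType) (F : I -> vec -> R) (x : vec) :
  (forall i, {for x, continuous (F i)}) ->
  \forall z \near x, forall i, `|F i z| <= `|F i x| + 1.
Proof.
move=> cF; have H i := near_bounded (cF i).
exact: (@filter_forall _ _ (fun i z => `|F i z| <= `|F i x| + 1) _
  (@nbhs_filter vec x) H).
Qed.

(** Near each point of [E] the Taylor bound holds on a ball inside [O]. Compactness yields one [L]
    for which it holds at every point of [E] up to distance [L^-1]; beyond that distance the bounds
    on [f] and [f1] suffice. *)
Lemma smooth_expands (E O : set vec) (f : vec -> R) (f1 : 'I_d -> vec -> R)
    (f2 : 'I_d -> 'I_d -> vec -> R) : compact E -> open O -> E `<=` O ->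
  (forall z, O z -> differentiable f z) ->
  (forall z k, O z -> 'D_(delta_mx 0 k) f z = f1 k z) ->
  (forall z k, O z -> differentiable (f1 k) z) ->
  (forall z k l, O z -> 'D_(delta_mx 0 l) (f1 k) z = f2 k l z) ->
  (forall z k l, O z -> {for z, continuous (f2 k l)}) ->
  expands E f (fun x => \row_k f1 k x).
Proof.
move=> cE oO EO df e1 df1 e2 c2.
(* A single parameter serves as bound, as Taylor constant and as inverse radius of validity, so
   compactness is applied once, with [L] tending to infinity. *)
pose P (L : R) (x : vec) := [/\ 0 < L, `|f x| <= L, (forall k, `|f1 k x| <= L) &
  forall x', ball x L^-1 x' ->
    `|f x' - f x - \sum_k (x' - x) 0 k * f1 k x| <= L * `|x' - x| ^+ 2].
have : \forall L \near +oo, E `<=` P L.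
  apply: (compact_near_coveringP E).1 cE _ _ _ _ _ => x0 Ex0.
  have Ox0 := EO _ Ex0.
  pose M := \sum_k \sum_l (`|f2 k l x0| + 1).
  have M2 k l : `|f2 k l x0| + 1 <= M.
    rewrite /M (bigD1 k)//= (bigD1 l)//= -addrA lerDl.
    apply: addr_ge0; apply: sumr_ge0 => k' _; first by rewrite addr_ge0.
    by apply: sumr_ge0 => l' _; rewrite addr_ge0.
  have N1 : \forall z \near x0, O z by exact: open_nbhs_nbhs.
  have N2 : \forall z \near x0, forall kl : 'I_d * 'I_d, `|f2 kl.1 kl.2 z| <= `|f2 kl.1 kl.2 x0| + 1.
    by apply: (@near_bounded_family _ (fun kl => f2 kl.1 kl.2)) => kl; exact: c2.
  have N3 : \forall z \near x0, `|f z| <= `|f x0| + 1.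
    by apply: near_bounded; apply: differentiable_continuous; exact: df.
  have N4 : \forall z \near x0, forall k, `|f1 k z| <= `|f1 k x0| + 1.
    apply: near_bounded_family => k.
    by apply: differentiable_continuous; exact: df1.
  have [r /= r0 rP] := (nbhs_ballP _ _).1 (filterI N1 N2).
  (* The last summand keeps the ball of radius [L^-1] about a point of [ball x0 (r / 2)] inside
     [ball x0 r]. *)
  pose B := \sum_k (`|f1 k x0| + 1) + (`|f x0| + 1) + d%:R ^+ 2 * M + 1 + (r / 2)^-1.
  have B0 : 0 <= \sum_k (`|f1 k x0| + 1) by rewrite sumr_ge0// => k _; rewrite addr_ge0.
  have B1 : 0 <= d%:R ^+ 2 * M.
    rewrite mulr_ge0 ?exprn_ge0//; apply: sumr_ge0 => k _; apply: sumr_ge0 => l _.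
    by rewrite addr_ge0.
  clearbody M.
  have B2 : 0 < (r / 2)^-1 by rewrite invr_gt0 divr_gt0.
  have B3 := normr_ge0 (f x0).
  exists (ball x0 (r / 2) `&` [set z | (`|f z| <= `|f x0| + 1) /\
     forall k, `|f1 k z| <= `|f1 k x0| + 1], [set L | B <= L]).
    split => /=; last by apply: nbhs_pinfty_ge; exact: num_real.
    apply: filterI; first by apply: nbhsx_ballx; rewrite divr_gt0.
    exact: filterI N3 N4.
  move=> [x L] /= [[xr [fx f1x]] BL]; split.
  - by move: BL; rewrite /B; lra.
  - by move: BL fx; rewrite /B; lra.
  - move=> k; have : `|f1 k x0| + 1 <= \sum_k (`|f1 k x0| + 1).
      by rewrite (bigD1 k)//= lerDl sumr_ge0// => k' _; rewrite addr_ge0.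
    by move: BL (f1x k); rewrite /B; lra.
  move=> x' xx'.
  have Lr : L^-1 <= r / 2.
    rewrite -[leRHS]invrK lef_pV2 ?posrE//; last by move: BL; rewrite /B; lra.
    by move: BL; rewrite /B; lra.
  have xr' : ball x0 r x'.
    by rewrite (splitr r); apply: ball_triangle xr _; exact: le_ball xx'.
  have {}xr : ball x0 r x by apply: le_ball xr; lra.
  have := @taylor_on_ball f f1 f2 x0 r M.
  move=> /(_ _ _ _ _ _ x x' xr xr') H.
  rewrite (le_trans (H _ _ _ _ _))// => [z /rP[/df]|z k /rP[/e1]|z k /rP[/df1]|z k l /rP[/e2]|z k l /rP[_ /(_ (k, l))]|]//.
    by move=> h; exact: le_trans (M2 k l).
  by rewrite ler_wpM2r ?exprn_ge0//; move: BL; rewrite /B; lra.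
move=> [L0 [_ HL]].
have [L LL0 EP] : exists2 L, 0 < L & E `<=` P L.
  exists (`|L0| + 1); first by rewrite ltr_wpDl.
  by apply: HL; rewrite (le_lt_trans (ler_norm _))// ltrDl.
exists (L + 2 * L ^+ 3 + d%:R * L ^+ 2) => [|x Ex].
  by rewrite -addrA ltr_pwDl// addr_ge0// mulr_ge0// exprn_ge0// ltW.
have [_ fx f1x tx] := EP x Ex.
have p1 : 0 <= L ^+ 3 by rewrite exprn_ge0// ltW.
have p2 : 0 <= d%:R * L ^+ 2 by rewrite mulr_ge0// exprn_ge0// ltW.
split; first by move: fx; lra.
  by move=> k; rewrite mxE; move: (f1x k); lra.
move=> x' Ex'; have [_ fx' _ _] := EP x' Ex'.
have -> : dot (\row_k f1 k x) (x' - x) = \sum_k (x' - x) 0 k * f1 k x.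
  by rewrite dot_sum; apply: eq_bigr => k _; rewrite mxE mulrC.
have [xx'|xx'] := ltP `|x - x'| L^-1.
  rewrite (le_trans (tx x' _))//; first by rewrite -ball_normE.
  by rewrite ler_wpM2r ?exprn_ge0//; lra.
(* For distant points [1 <= L * |v|] turns constant and linear bounds into multiples of [|v| ^ 2];
   this is the origin of [2 * L ^ 3] and [d * L ^ 2] in the constant. *)
rewrite distrC in xx'; set v := x' - x in xx' *.
have Lv : 1 <= L * `|v| by rewrite -ler_pdivrMl// mulr1.
have dv : `|\sum_k v 0 k * f1 k x| <= d%:R * L * `|v|.
  have := @norm_dot_le R d (\row_k f1 k x) v L ltac:(by move=> k; rewrite mxE).
  rewrite dot_sum; congr (`|_| <= _); apply: eq_bigr => k _.
  by rewrite mxE mulrC.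
rewrite (le_trans (ler_normB _ _))// (le_trans (lerD (ler_normB _ _) dv))//.
have v0 := normr_ge0 v.
have h1 : `|v| <= L * `|v| ^+ 2 by rewrite expr2 mulrA ler_peMl.
have h2 : 1 <= L ^+ 2 * `|v| ^+ 2.
  by rewrite -exprMn; apply: exprn_ege1.
have h3 : L <= L * (L ^+ 2 * `|v| ^+ 2) by rewrite ler_peMr// ltW.
have h4 : d%:R * L * `|v| <= d%:R * L * (L * `|v| ^+ 2).
  by rewrite ler_wpM2l// mulr_ge0// ltW.
have h5 : 0 <= L * `|v| ^+ 2 by rewrite mulr_ge0 ?exprn_ge0// ltW.
rewrite (_ : (_ + _ + _) * _ = L * `|v| ^+ 2 + 2 * (L * (L ^+ 2 * `|v| ^+ 2)) +
  d%:R * L * (L * `|v| ^+ 2)); last by ring.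
by move: fx fx'; lra.
Qed.

End taylor.

Section slices.
Variables (R : realType) (d : nat) (W : normedModType R) (t0 : R).
Local Notation vec := 'rV[R]_d.
Variable l : {linear W -> R}.
Hypothesis cl : continuous l.
Implicit Types F : vec * R -> W.

Let sl (z : vec) : vec * R := (z, t0).

Let sl_differentiable x : differentiable sl x.
Proof.
apply: differentiable_pair; last exact: differentiable_cst.
exact: (@ex_diff _ _ _ _ _ _ _ (is_diff_id x)).
Qed.

Lemma slice_differentiable F x : differentiable F (sl x) ->
  differentiable (fun z => l (F (sl z))) x.
Proof.
move=> dF.
have d1 : differentiable (F \o sl) x by exact: differentiable_comp.
have d2 : differentiable l ((F \o sl) x) by exact: linear_differentiable.
exact: (differentiable_comp d1 d2).
Qed.

Lemma slice_derive F x v : differentiable F (sl x) ->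
  'D_v (fun z => l (F (sl z))) x = l ('D_((v, 0) : vec * R) F (sl x)).
Proof.
move=> dF; have D := diff_derivable (v := ((v, 0) : vec * R)) dF.
have C : h^-1 *: ((F \o shift (sl x)) (h *: ((v, 0) : vec * R)) - F (sl x))
    @[h --> 0^'] --> 'D_((v, 0) : vec * R) F (sl x) by exact: D.
have C' : l (h^-1 *: ((F \o shift (sl x)) (h *: ((v, 0) : vec * R)) - F (sl x)))
    @[h --> 0^'] --> l ('D_((v, 0) : vec * R) F (sl x)).
  by apply: continuous_cvg; [exact: cl|exact: C].
apply: cvg_lim => //; apply: cvg_trans C'; apply: near_eq_cvg.
apply: nearW => h /=; rewrite linearZ linearB /= /sl.
by rewrite -[h *: (v, 0) + (x, t0)]/(h *: v + x, h *: (0 : R) + t0) scaler0 add0r.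
Qed.

(** Smoothness is given in space-time. The slice on one side and the continuous linear component [l]
    on the other reduce it to scalar functions of space, whose derivatives are those of [F] in the
    directions [(v, 0)]. *)
Lemma smooth_slice_expands (E : set vec) (T : set R) F : compact E -> T t0 ->
  smooth_on (E `*` T) F ->
  expands E (fun x => l (F (sl x)))
    (fun x => \row_k l ('D_((delta_mx 0 k, 0) : vec * R) F (sl x))).
Proof.
move=> cE Tt0 [Q [oQ EQ CQ]].
have [dF CF] := CQ 2%N.
have dF1 v p : Q p -> differentiable (fun q => 'D_v F q) p.
  by have [H _] := CF v; exact: H.
have csl : continuous sl.
  by move=> x; apply: differentiable_continuous; exact: sl_differentiable.
have oQ' : open (sl @^-1` Q) by apply: open_comp => // x _; exact: csl.
apply: (@smooth_expands _ _ E (sl @^-1` Q) _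
  (fun k x => l ('D_((delta_mx 0 k, 0) : vec * R) F (sl x)))
  (fun k m x => l ('D_((delta_mx 0 m, 0) : vec * R)
     (fun q => 'D_((delta_mx 0 k, 0) : vec * R) F q) (sl x)))) => //.
- by move=> x Ex; apply: EQ.
- by move=> z Qz; apply: slice_differentiable; exact: dF.
- by move=> z k Qz; apply: slice_derive; exact: dF.
- by move=> z k Qz; apply: (slice_differentiable (dF1 _ _ Qz)).
- by move=> z k m Qz; apply: (slice_derive _ (dF1 _ _ Qz)).
move=> z k m Qz; have [_ H] := CF ((delta_mx 0 k, 0) : vec * R).
have cc := H ((delta_mx 0 m, 0) : vec * R) _ Qz.
apply: (@continuous_comp _ _ _ (fun x => 'D_((delta_mx 0 m, 0) : vec * R)
     (fun q => 'D_((delta_mx 0 k, 0) : vec * R) F q) (sl x)) l).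
  exact: (@continuous_comp _ _ _ sl _ z (csl z) cc).
exact: cl.
Qed.

End slices.

Lemma polygonal_domain_compact (R : realType) (d : nat) (D : set 'rV[R]_d) :
  polygonal_domain D -> compact (closure D).
Proof.
move=> [_ _ _ _ [N [m [p E]]]].
apply: bounded_closed_compact; last exact: closed_closure.
exists (\sum_s \sum_a `|p s a|); split; first exact: num_real.
move=> B /ltW HB x; rewrite E => -[s _ [w [w0 w1 ->]]] /=.
rewrite (le_trans _ HB)// (le_trans (ler_norm_sum _ _ _))//.
rewrite (bigD1 s)//= ler_wpDr ?sumr_ge0//; first by move=> s' _; rewrite sumr_ge0.
apply: ler_sum => a _; rewrite mx_normZ ger0_norm// ler_piMl//.
by rewrite -w1 (bigD1 a)//= lerDl sumr_ge0.
Qed.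

Section state_components.
Variables (R : realType) (n : nat) (D : set 'rV[R]_n.+1) (T tn : R).
Variable U : 'rV[R]_n.+1 -> R -> state R n.
Hypotheses (cD : compact (closure D)) (tnT : 0 <= tn <= T).
Hypothesis sU : smooth_on (closure D `*` [set t | 0 <= t <= T]) (fun p => U p.1 p.2).
Local Notation expandable f := (exists F, expands (closure D) f F).

Let component (l : state R n -> R) : linear l -> continuous l ->
  expandable (fun x => l (U x tn)).
Proof.
move=> ll cl.
pose lM := GRing.isLinear.Build _ _ _ _ _ ll.
pose L : {linear _ -> _} := HB.pack l lM.
have := @smooth_slice_expands R n.+1 _ tn L cl (closure D) [set t | 0 <= t <= T]
  (fun p => U p.1 p.2) cD tnT sU.
by move=> H; eexists; exact: H.
Qed.

Lemma rho_expandable : expandable (fun x => rho (U x tn)).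
Proof.
apply: component => // u; apply: (@continuous_comp _ _ _ fst fst); exact: cvg_fst.
Qed.

Lemma mom_expandable k : expandable (fun x => mom (U x tn) 0 k).
Proof.
apply: (@component (fun u => mom u 0 k)).
  by move=> c u v; rewrite /mom !mxE.
move=> u; apply: (@continuous_comp _ _ _ (fun u : state R n => u.1.2) (fun m => m 0 k)).
  by apply: (@continuous_comp _ _ _ fst snd); [exact: cvg_fst|exact: cvg_snd].
exact: coord_continuous.
Qed.

Lemma rhotheta_expandable : expandable (fun x => rhotheta (U x tn)).
Proof. by apply: component => // u; exact: cvg_snd. Qed.

End state_components.

(** * Gradients of the nodal basis and consistency of the coefficients [cvec] *)

Section finite_elements.
Variables (R : realType) (n : nat).
Local Notation d := n.+1.
Local Notation vec := 'rV[R]_d.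
Local Notation vtx := {ffun 'I_d -> bool}.
Local Notation preim := (preimage (@rV_of_tuple R d)).
Local Notation toV := (@rV_of_tuple R d).
Variables (D : set vec) (M : mesh R d) (phi : node M -> vec -> R) (kappa : R).
Hypotheses (oD : open D) (cD : compact (closure D)) (hM : mesh_of M D).
Hypotheses (kappa_gt0 : 0 < kappa) (reg : regular_mesh M kappa).
Hypothesis nb : nodal_basis D phi.

Let S := cell_skeleton M.
Let A := D `\` S.
Let E := preim A.
Let mu := lebesgue_tuple R d.

(** The bound of [basis_gradient_le], which depends on the dimension and on [kappa] but not on the
    mesh. *)
Definition gradient_const : R := d%:R * ((n`!)%:R * #|{: vtx}|%:R ^+ n) / kappa.
Local Notation C0 := gradient_const.

Lemma gradient_const_ge0 : 0 <= C0.
Proof. by rewrite divr_ge0 ?(ltW kappa_gt0)// !mulr_ge0// exprn_ge0. Qed.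

Let mE : measurable E.
Proof.
rewrite (_ : E = preim D `\` preim S)//; apply: measurableD.
  exact: open_preimage_measurable.
exact: cell_skeleton_measurable.
Qed.

Lemma finite_measure_of_bounded : (mu (preim D) < +oo)%E.
Proof.
have [B [_ HB]] := compact_bounded cD.
pose r := `|B| + 1 + 1.
have r0 : 0 <= r by rewrite !addr_ge0.
have sub : preim D `<=` [set t | forall k, ball (0 : R) r (tnth t k : R)].
  move=> t Dt k; rewrite -ball_normE /= sub0r normrN.
  have : `|toV t| <= `|B| + 1.
    apply: (HB (`|B| + 1)); last exact: subset_closure.
    by rewrite (le_lt_trans (ler_norm _))// ltrDl.
  move/(le_trans (coord_le_norm _ k)); rewrite mxE => /le_lt_trans; apply.
  by rewrite ltrDl.
apply: (@le_lt_trans _ _ (mu [set t | forall k, ball (0 : R) r (tnth t k : R)])).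
  apply: le_measure; rewrite ?inE//; first exact: open_preimage_measurable.
  exact: (measurable_tuple_ball (fun=> 0)).
by rewrite (lebesgue_tuple_ball (fun=> 0))// ltry.
Qed.

Let finE : (mu E < +oo)%E.
Proof.
apply: le_lt_trans finite_measure_of_bounded; apply: le_measure; rewrite ?inE//.
  exact: open_preimage_measurable.
by move=> t [].
Qed.

Lemma domain_integral_off_skeleton (f : vec -> R) :
  domain_integral D f = \int[mu]_(t in E) f (toV t).
Proof.
rewrite /domain_integral /Rintegral (@integral_setD_null _ _ _ _ _ (preim S))//.
  exact: cell_skeleton_measurable.
exact: cell_skeleton_null.
Qed.

Lemma shape_on_cell j (K : cell M) z : refcube z ->
  phi j (cellmap K z) = \sum_a (vertex K a == j)%:R * refshape a z.
Proof.
move=> Hz; have [_ /(_ K)[c Hc]] := nb.1 j; rewrite -[LHS]/((phi j \o cellmap K) z).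
rewrite Hc//; apply: eq_bigr => a _; congr (_ * _).
have := Hc _ (refcube_vertex R a); rewrite /= cellmap_vertex nb.2 eq_sym => ->.
rewrite (bigD1 a)//= refshape_vertex eqxx mulr1 big1 ?addr0// => b ba.
by rewrite refshape_vertex (negbTE ba) mulr0.
Qed.

(** The interface to the cell geometry: after it, the reference cube no longer appears. The vertex
    weights [w] are strictly positive because off the skeleton the reference point is interior to
    the cube. *)
Lemma cell_gradient x : A x -> exists (K : cell M) (B : vtx -> vec) (w : vtx -> R),
  [/\ cellset K x, (forall a, 0 < w a) /\ \sum_a w a = 1,
      forall j, phi j x = \sum_a (vertex K a == j)%:R * w a,
      forall j k, is_derive x (delta_mx 0 k) (phi j)
        (\sum_a (vertex K a == j)%:R * B a 0 k) &
      [/\ forall k, \sum_a B a 0 k = 0,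
          forall k m, \sum_a B a 0 k * pos (vertex K a) 0 m = (k == m)%:R &
          forall a k, `|B a 0 k| * cell_diam K <= C0]].
Proof.
move=> [Dx Sx]; have [K [y [Hy yx nK]]] := cell_nbhs_off_skeleton hM oD Dx Sx.
have inj : set_inj (@refcube R d) (cellmap K) by case: hM.
have rK : kappa * cell_diam K ^+ d <= `|\det ('J (cellmap K) y)| by exact: reg.
have nK' : nbhs (cellmap K y) (cellset K) by rewrite yx.
exists K, (basis_gradient K y), (fun a => refshape a y); split.
- by rewrite -yx; exists y.
- split; last exact: sum_refshape.
  have oy : refcube_open y by apply: (@refcube_open_off_skeleton _ _ M K); rewrite ?yx.
  move=> a; rewrite /refshape prodr_gt0// => k _; have := oy k.
  by case: (a k); lra.
- by move=> j; rewrite -yx shape_on_cell.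
- move=> j k; rewrite -yx.
  apply: (@pderiv_on_cell _ _ _ _ inj kappa y kappa_gt0 rK Hy nK') => z Hz.
  exact: shape_on_cell.
- split.
  + by move=> k; exact: sum_basis_gradient.
  + by move=> k m; exact: (@sum_basis_gradient_pos _ _ _ _ inj kappa y kappa_gt0 rK).
  + by move=> a k; exact: (@basis_gradient_le _ _ _ _ inj kappa y kappa_gt0 rK Hy).
Qed.

Lemma shape_itv j x : A x -> 0 <= phi j x <= 1.
Proof.
move=> Ax; have [K [B [w [_ [w0 w1] -> _ _]]]] := cell_gradient Ax.
rewrite sumr_ge0 => [|a _]; last by rewrite mulr_ge0 ?ler0n// ltW.
rewrite /= -[leRHS]w1 ler_sum// => a _; rewrite ler_piMl ?(ltW (w0 a))//.
by case: (_ == _); rewrite ?lexx ?ler01.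
Qed.

Lemma shape_continuous j x : D x -> {for x, continuous (phi j)}.
Proof.
move=> Dx; have [c _] := nb.1 j.
have : {within D, continuous (phi j)}.
  by apply: continuous_subspaceW c; exact: subset_closure.
by rewrite continuous_open_subspace// => /(_ x (mem_set Dx)).
Qed.

Let bm : (d.-tuple (measurableTypeR R) -> R) -> Prop := bounded_mfun E.

Let bm_shape j : bm (phi j \o toV).
Proof.
split.
  apply: (@measurable_funS _ _ _ _ (preim D)) => //; first exact: open_preimage_measurable.
    by move=> t [].
  by apply: continuous_on_open_measurable => // x; exact: shape_continuous.
exists 1 => t Et; have /andP[p0 p1] := shape_itv j Et.
by rewrite /= ger0_norm.
Qed.

Let bm_pderiv j k : bm (pderiv k (phi j) \o toV).
Proof.
split.
  apply: (@pderiv_measurable _ _ D) => //; first by move=> x [].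
    by move=> x; exact: shape_continuous.
  by move=> x /cell_gradient[K [B [w [_ _ _ /(_ j k)[]]]]].
(* This bound depends on the mesh; it serves integrability and enters no error estimate. *)
exists (\sum_(K : cell M) #|{: vtx}|%:R * (C0 / cell_diam K)) => t Et.
have [K [B [w [_ _ _ /(_ j k) Dj [_ _ HB]]]]] := cell_gradient Et.
have dK (L : cell M) : 0 < cell_diam L by apply: cell_diam_gt0; case: hM.
rewrite /= /pderiv (@derive_val _ _ _ _ _ _ _ Dj).
rewrite (le_trans (ler_norm_sum _ _ _))// (bigD1 K)//= ler_wpDr ?sumr_ge0//.
  by move=> L _; rewrite mulr_ge0 ?divr_ge0 ?gradient_const_ge0// ltW.
rewrite mulr_natl -sumr_const ler_sum// => a _.
rewrite normrM (@le_trans _ _ `|B a 0 k|)//.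
  by rewrite ler_piMl//; case: (_ == _); rewrite ?normr1 ?normr0 ?lexx ?ler01.
by rewrite ler_pdivlMr.
Qed.

Lemma cvec_coord i j k :
  cvec D phi i j 0 k = \int[mu]_(t in E) (phi i (toV t) * pderiv k (phi j) (toV t)).
Proof.
rewrite /cvec mxE domain_integral_off_skeleton.
by apply: eq_Rintegral => t _; rewrite !mxE.
Qed.

(** A vanishing integral of the nonnegative [phi i * phi j] makes the product zero almost
    everywhere. Where [phi j] is zero, positivity of the weights shows that [j] is no vertex of the
    cell, so its gradient vanishes too. Sums over the stencil may thus be extended to all nodes. *)
Lemma cvec_off_stencil i j : j \notin stencil D phi i -> cvec D phi i j = 0.
Proof.
rewrite inE negbK /mass domain_integral_off_skeleton => /eqP m0.
apply/matrixP => l k; rewrite (ord1 l) [RHS]mxE cvec_coord.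
have ae := @ae_eq0_Rintegral _ _ _ mu E mE finE (fun t => phi i (toV t) * phi j (toV t))
  (bounded_mfunM (bm_shape i) (bm_shape j)) _ m0.
apply: Rintegral_ae_eq0 => //.
  by have [] := bounded_mfunM (bm_shape i) (bm_pderiv j k).
have {}ae := ae _; apply: filterS (ae _) => [t H Et|t Et]; last first.
  have /andP[i0 _] := shape_itv i Et; have /andP[j0 _] := shape_itv j Et.
  exact: mulr_ge0.
have /eqP := H Et; rewrite mulf_eq0 => /orP[/eqP->|]; first by rewrite mul0r.
have [K [B [w [_ [w0 _] -> Dj _]]]] := cell_gradient Et => /eqP s0.
have nj a : (vertex K a == j)%:R = 0 :> R.
  have := psumr_eq0P _ s0; move=> /(_ _ a isT) /eqP.
  rewrite mulf_eq0 (gt_eqF (w0 a)) orbF => /(_ _)/eqP; apply => b _.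
  by rewrite mulr_ge0 ?ler0n// ltW.
rewrite /pderiv (@derive_val _ _ _ _ _ _ _ (Dj j k)) big1 ?mulr0// => a _.
by rewrite nj mul0r.
Qed.

(* The nodal gradients reproduce affine functions, so only the deviation of [W]
   from an affine function on each cell contributes. *)
Lemma affine_consistency i k (W : node M -> R) (beta : vec -> R) (eps : R) :
  bounded_mfun E (beta \o toV) -> 0 <= eps ->
  (forall (K : cell M) a0 x, vertex K a0 = i -> cellset K x -> D x ->
     exists (al : R) (b : vec), b 0 k = beta x /\
       forall a, `|W (vertex K a) - (al + dot b (pos (vertex K a) - x))| <=
         eps * cell_diam K) ->
  `|domain_integral D (fun x => phi i x * beta x) -
    \sum_(j in stencil D phi i) W j * cvec D phi i j 0 k| <=
  #|{: vtx}|%:R * C0 * eps * lumped_mass D phi i.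
Proof.
move=> bb eps0 HW.
rewrite (_ : \sum_(j in _) _ = \sum_j W j * cvec D phi i j 0 k); last first.
  rewrite big_mkcond; apply: eq_bigr => j _; case: ifPn => // /cvec_off_stencil->.
  by rewrite mxE mulr0.
pose G j x := phi i x * pderiv k (phi j) x.
have bG j : bm (fun t => G j (toV t)) := bounded_mfunM (bm_shape i) (bm_pderiv j k).
have bWG j : bm (fun t => W j * G j (toV t)) := bounded_mfunZ (W j) (bG j).
have bF : bm (fun t => phi i (toV t) * beta (toV t)) := bounded_mfunM (bm_shape i) bb.
rewrite (_ : \sum_j _ = \int[mu]_(t in E) (\sum_j W j * G j (toV t))); last first.
  rewrite Rintegral_sum//; apply: eq_bigr => j _.
  by rewrite cvec_coord RintegralZl//; exact: (bounded_mfun_integrable mE finE (bG j)).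
rewrite domain_integral_off_skeleton -RintegralB//; last 2 first.
- exact: (bounded_mfun_integrable mE finE bF).
- exact: (bounded_mfun_integrable mE finE (bounded_mfun_sum (index_enum _) bWG)).
rewrite /lumped_mass domain_integral_off_skeleton -RintegralZl//; last first.
  exact: (bounded_mfun_integrable mE finE (bm_shape i)).
apply: norm_Rintegral_le => //.
- exact: (bounded_mfunB bF (bounded_mfun_sum (index_enum _) bWG)).
- exact: (bounded_mfunZ _ (bm_shape i)).
move=> t Et; set x := toV t.
have /andP[i0 i1] := shape_itv i Et.
rewrite (_ : _ - _ = phi i x * (beta x - \sum_j W j * pderiv k (phi j) x)); last first.
  by rewrite mulrBr mulr_sumr; congr (_ - _); apply: eq_bigr => j _; rewrite mulrCA.
rewrite normrM ger0_norm// mulrC.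
(* Where [phi i] is nonzero, [i] is a vertex of the cell, as [HW] requires. *)
have [->|pi0] := eqVneq (phi i x) 0; first by rewrite !mulr0.
rewrite ler_wpM2r//.
have [K [B [w [Kx [w0 _] shK Dj [B0 B1 B2]]]]] := cell_gradient Et.
have [a0 va0] : exists a0, vertex K a0 = i.
  move: pi0; rewrite shK; apply: contraNP => /forallNP H.
  by rewrite big1// => a _; case: eqP => [/H//|_]; rewrite mul0r.
have [al [b [bk Wb]]] := HW K a0 x va0 Kx Et.1.
have EW : \sum_j W j * pderiv k (phi j) x = \sum_a W (vertex K a) * B a 0 k.
  under eq_bigr do rewrite /pderiv (@derive_val _ _ _ _ _ _ _ (Dj _ k)) mulr_sumr.
  rewrite exchange_big; apply: eq_bigr => a _.
  rewrite (bigD1 (vertex K a))//= eqxx mul1r big1 ?addr0// => j ja.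
  by rewrite eq_sym (negbTE ja) mul0r mulr0.
have Em m : \sum_a b 0 m * (pos (vertex K a) - x) 0 m * B a 0 k = b 0 m * (k == m)%:R.
  transitivity (b 0 m * (\sum_a B a 0 k * pos (vertex K a) 0 m - x 0 m * \sum_a B a 0 k)).
    by rewrite mulrBr !mulr_sumr -sumrB; apply: eq_bigr => a _; rewrite !mxE; ring.
  by rewrite B1 B0 mulr0 subr0.
have Eaff : \sum_a (al + dot b (pos (vertex K a) - x)) * B a 0 k = beta x.
  rewrite -bk.
  under eq_bigr do rewrite mulrDl dot_sum mulr_suml.
  rewrite big_split/= -mulr_sumr B0 mulr0 add0r exchange_big/=.
  rewrite (eq_bigr _ (fun m _ => Em m)) (bigD1 k)//= eqxx mulr1 big1 ?addr0// => m mk.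
  by rewrite eq_sym (negbTE mk) mulr0.
rewrite EW -Eaff -sumrB (le_trans (ler_norm_sum _ _ _))//.
rewrite -mulrA mulr_natl -sumr_const ler_sum// => a _.
rewrite -mulrBl normrM distrC (@le_trans _ _ (eps * cell_diam K * `|B a 0 k|))//.
  by rewrite ler_wpM2r.
by rewrite -mulrA [leRHS]mulrC ler_wpM2l// mulrC.
Qed.

(** The gradient in [cvec] costs an inverse diameter, which the weights [c] pay back cell by cell,
    even if neighbouring cells differ in size. It is meant for [c] a height difference. *)
Lemma sum_norm_cvec_le i k (c : node M -> R) : (forall j, 0 <= c j) ->
  (forall (K : cell M) a0 a, vertex K a0 = i -> c (vertex K a) <= cell_diam K) ->
  \sum_j c j * `|cvec D phi i j 0 k| <= #|{: vtx}|%:R * C0 * lumped_mass D phi i.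
Proof.
move=> c0 cK.
pose G j x := phi i x * `|pderiv k (phi j) x|.
have bG j : bm (fun t => G j (toV t)).
  exact: (bounded_mfunM (bm_shape i) (bounded_mfun_norm (bm_pderiv j k))).
have bcG j : bm (fun t => c j * G j (toV t)) := bounded_mfunZ (c j) (bG j).
rewrite /lumped_mass domain_integral_off_skeleton -RintegralZl//; last first.
  exact: (bounded_mfun_integrable mE finE (bm_shape i)).
apply: (@le_trans _ _ (\int[mu]_(t in E) (\sum_j c j * G j (toV t)))).
  rewrite Rintegral_sum//; apply: ler_sum => j _.
  rewrite RintegralZl//; last exact: (bounded_mfun_integrable mE finE (bG j)).
  rewrite ler_wpM2l// cvec_coord; apply: norm_Rintegral_le => //.
  - exact: (bounded_mfunM (bm_shape i) (bm_pderiv j k)).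
  - exact: bG.
  move=> t Et; have /andP[i0 _] := shape_itv i Et.
  by rewrite normrM /G (ger0_norm i0).
apply: le_Rintegral => //.
- exact: (bounded_mfun_integrable mE finE (bounded_mfun_sum (index_enum _) bcG)).
- exact: (bounded_mfun_integrable mE finE (bounded_mfunZ _ (bm_shape i))).
move=> t Et; set x := toV t; have /andP[i0 _] := shape_itv i Et.
rewrite (_ : \sum_j _ = (\sum_j c j * `|pderiv k (phi j) x|) * phi i x); last first.
  by rewrite mulr_suml; apply: eq_bigr => j _; rewrite /G mulrCA mulrC.
have [->|pi0] := eqVneq (phi i x) 0; first by rewrite !mulr0.
rewrite ler_wpM2r//.
have [K [B [w [Kx [w0 _] shK Dj [B0 B1 B2]]]]] := cell_gradient Et.
have [a0 va0] : exists a0, vertex K a0 = i.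
  move: pi0; rewrite shK; apply: contraNP => /forallNP H.
  by rewrite big1// => a _; case: eqP => [/H//|_]; rewrite mul0r.
apply: (@le_trans _ _ (\sum_j \sum_a c j * ((vertex K a == j)%:R * `|B a 0 k|))).
  apply: ler_sum => j _; rewrite -mulr_sumr ler_wpM2l//.
  rewrite /pderiv (@derive_val _ _ _ _ _ _ _ (Dj j k)).
  rewrite (le_trans (ler_norm_sum _ _ _))// ler_sum// => a _.
  by rewrite normrM ger0_norm ?ler0n.
rewrite exchange_big/= mulr_natl -sumr_const ler_sum// => a _.
rewrite (bigD1 (vertex K a))//= eqxx mul1r big1 ?addr0 => [|j ja].
  by rewrite mulrC (le_trans _ (B2 a k))// ler_wpM2l// (cK K a0).
by rewrite eq_sym (negbTE ja) mul0r mulr0.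
Qed.

Lemma lumped_mass_le i :
  0 <= lumped_mass D phi i <= fine (mu (preim D)).
Proof.
rewrite /lumped_mass domain_integral_off_skeleton; apply/andP; split.
  by apply: Rintegral_ge0 => t Et; have /andP[] := shape_itv i Et.
apply: (@le_trans _ _ (\int[mu]_(t in E) 1)).
  apply: le_Rintegral => //.
  - exact: (bounded_mfun_integrable mE finE (bm_shape i)).
  - exact: (bounded_mfun_integrable mE finE (bounded_mfun_cst E 1)).
  - by move=> t Et; have /andP[] := shape_itv i Et.
rewrite Rintegral_cst// mul1r fine_le ?ge0_fin_numE//.
  exact: finite_measure_of_bounded.
apply: le_measure; rewrite ?inE//; first exact: open_preimage_measurable.
by move=> t [].
Qed.

Lemma expands_bounded_mfun (f : vec -> R) (F : vec -> vec) :
  expands (closure D) f F -> bounded_mfun E (f \o toV).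
Proof.
move=> ef; have nE x : D x -> nbhs x (closure D).
  move=> Dx; apply: filterS (open_nbhs_nbhs (conj oD Dx)); exact: subset_closure.
split.
  apply: (@measurable_funS _ _ _ _ (preim D)) => //; first exact: open_preimage_measurable.
    by move=> t [].
  apply: continuous_on_open_measurable => // x Dx.
  by apply: expands_continuous ef _; exact: nE.
case: ef => L L0 H; exists L => t [Dt _].
by have [] := H _ (subset_closure Dt).
Qed.

(** Nothing in [expands] makes [F] measurable by itself; inside [D] it coincides with the partial
    derivatives of [f], which are. *)
Lemma expands_gradient_bounded_mfun (f : vec -> R) (F : vec -> vec) k :
  expands (closure D) f F -> bounded_mfun E ((fun x => F x 0 k) \o toV).
Proof.
move=> ef; have nE x : D x -> nbhs x (closure D).
  move=> Dx; apply: filterS (open_nbhs_nbhs (conj oD Dx)); exact: subset_closure.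
split; last first.
  case: ef => L L0 H; exists L => t [Dt _].
  by have [_ HF _] := H _ (subset_closure Dt); exact: HF.
have : measurable_fun E (pderiv k f \o toV).
  apply: (@pderiv_measurable _ _ D) => //; first by move=> x [].
    by move=> x Dx; apply: expands_continuous ef _; exact: nE.
  by move=> x [Dx _]; have [] := expands_pderiv k ef (nE _ Dx).
apply: eq_measurable_fun => t /set_mem[Dt _]; rewrite /= /pderiv.
exact: (@derive_val _ _ _ _ _ _ _ (expands_pderiv k ef (nE _ Dt))).
Qed.

Lemma domain_integral_shape_sum i (I : finType) (g : I -> vec -> R) :
  (forall l, bounded_mfun E (g l \o toV)) ->
  domain_integral D (fun x => phi i x * \sum_l g l x) =
  \sum_l domain_integral D (fun x => phi i x * g l x).
Proof.
move=> bg; rewrite domain_integral_off_skeleton.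
transitivity (\int[mu]_(t in E) (\sum_l phi i (toV t) * g l (toV t))).
  by apply: eq_Rintegral => t _; rewrite mulr_sumr.
rewrite (Rintegral_sum mE finE (index_enum _) (fun l => bounded_mfunM (bm_shape i) (bg l))).
by apply: eq_bigr => l _; rewrite domain_integral_off_skeleton.
Qed.

Lemma mesh_size_ge0 : 0 <= mesh_size M.
Proof. by rewrite /mesh_size bigmax_ge_id. Qed.

Lemma drop_height_ge0 (i j : node M) : 0 <= drop_height i j.
Proof. by rewrite /drop_height le_max lexx. Qed.

(* In each matched pair the two contributions cancel up to [eps]. *)
Lemma matched_sum_le (cM : R) i k : vertically_matched D phi cM i ->
  `|\sum_(j in stencil D phi i)
      (drop_height i j + drop_height j i) * cvec D phi i j 0 k| <=
  `|cM| * mesh_size M * (#|{: vtx}|%:R * C0 * lumped_mass D phi i).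
Proof.
rewrite /vertically_matched; set up := [set j in _ | _]%SET; set dn := [set k in _ | _]%SET.
move=> [cardE [s [sinj Hs]]].
have only (b : node M -> R) (P : node M -> R) : (forall j, 0 <= b j) ->
    \sum_(j in stencil D phi i) b j * P j =
    \sum_(j in [set j in stencil D phi i | 0 < b j]%SET) b j * P j.
  move=> b0; rewrite big_mkcond [RHS]big_mkcond; apply: eq_bigr => j _.
  rewrite !inE; case: (_ != 0) => //=; case: ifPn => // nb0.
  suff -> : b j = 0 by rewrite mul0r.
  by apply/eqP; rewrite eq_le b0 andbT leNgt.
under eq_bigr do rewrite mulrDl.
rewrite big_split/= (only (drop_height i))//; last by move=> j; exact: drop_height_ge0.
rewrite (only (fun j => drop_height j i))//; last by move=> j; exact: drop_height_ge0.
rewrite -/up -/dn.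
(* An injection between finite sets of equal cardinality is onto, so the lower neighbours can be
   indexed by the upper ones. *)
have -> : dn = [set s j | j in up]%SET.
  apply/esym/eqP; rewrite eqEcard card_in_imset// cardE leqnn andbT.
  by apply/fintype.subsetP => _ /imsetP[j /Hs[sB _] ->].
rewrite big_imset//= -big_split/=.
rewrite (le_trans (ler_norm_sum _ _ _))//.
rewrite (@le_trans _ _ (\sum_(j in up) `|cM| * mesh_size M *
    (drop_height j i * `|cvec D phi i j 0 k|)))//.
  apply: ler_sum => j /Hs[_ [eps epsM]].
  move: (cvec D phi i j) (cvec D phi i (s j)) => v w /matrixP/(_ 0 k).
  rewrite !mxE => E1.
  rewrite (_ : _ + _ = - (eps * (drop_height j i * v 0 k))); last first.
    by move: E1; rewrite -mulrA mulrDl mul1r => E1; rewrite -[_ * w _ _]opprK -E1; ring.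
  rewrite normrN !normrM (ger0_norm (drop_height_ge0 _ _)).
  rewrite ler_wpM2r ?mulr_ge0 ?drop_height_ge0// (le_trans epsM)//.
  by rewrite ler_wpM2r ?mesh_size_ge0// ler_norm.
rewrite -mulr_sumr ler_wpM2l ?mulr_ge0 ?mesh_size_ge0//.
have := @sum_norm_cvec_le i k (fun j => drop_height j i) (fun j => drop_height_ge0 j i).
move=> H; apply: (le_trans _ (H _)).
  rewrite big_mkcond; apply: ler_sum => j _; case: ifPn => // _.
  by rewrite mulr_ge0 ?drop_height_ge0.
move=> K a0 a va0; rewrite /drop_height ge_max cell_diam_ge0/= -va0.
have := cell_diam_ge (cellset_vertex K a) (cellset_vertex K a0).
apply: le_trans; have := coord_le_norm (pos (vertex K a) - pos (vertex K a0)) ord_max.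
by apply: le_trans; rewrite !mxE ler_norm.
Qed.

End finite_elements.

(** * Closure properties of expandable functions, and a mesh-free calculus of orders *)

Section expandable_functions.
Variables (R : realType) (d : nat) (E : set 'rV[R]_d).
Local Notation vec := 'rV[R]_d.
Implicit Types f g : vec -> R.

Definition expandable f := exists F, expands E f F.

Lemma expands_eq f g F : {in E, f =1 g} -> expands E f F -> expands E g F.
Proof.
move=> fg [L L0 H]; exists L => // x Ex; have [fx Fx ex] := H x Ex.
by split => // [|x' Ex']; rewrite -!fg ?inE//; exact: ex.
Qed.

Lemma expands_powR f F (a r : R) : 0 < a -> (forall x, E x -> a <= f x) ->
  expands E f F ->
  expands E (fun x => f x `^ r) (fun x => (r * f x `^ (r - 1)) *: F x).
Proof.
move=> a0 af ef; have [L L0 HL] := ef; have [C HC] := powR_expansion r L a0.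
apply: (@expands_comp _ _ E f F (fun s => s `^ r) (fun s => r * s `^ (r - 1))
  [set s | a <= s <= L] C ef) => // x Ex /=.
by rewrite af//=; have [fL _ _] := HL x Ex; rewrite (le_trans (ler_norm _)).
Qed.

Lemma expandable_powR f (a r : R) : 0 < a -> (forall x, E x -> a <= f x) ->
  expandable f -> expandable (fun x => f x `^ r).
Proof. by move=> a0 af [F ef]; eexists; exact: expands_powR a0 af ef. Qed.

Lemma expandable_mul f g : expandable f -> expandable g ->
  expandable (fun x => f x * g x).
Proof. by move=> [F ef] [G eg]; eexists; exact: expands_mul ef eg. Qed.

Lemma expands_cst (c : R) : expands E (fun=> c) (fun=> 0).
Proof.
exists (`|c| + 1) => [|x Ex]; first by rewrite ltr_wpDl.
split; first by rewrite lerDl.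
  by move=> k; rewrite mxE normr0 addr_ge0.
by move=> x' _; rewrite /dot mul0mx mxE !subrr normr0 mulr_ge0 ?exprn_ge0.
Qed.

Lemma expandable_cst (c : R) : expandable (fun=> c).
Proof. by eexists; exact: expands_cst. Qed.

(** The Lipschitz bound on [E] keeps [f] above [f x0 / 2] on a ball about [x0]; the covering
    argument yields [L^-1] as a common lower bound. *)
Lemma expandable_lower_bound f : compact E -> expandable f ->
  (forall x, E x -> 0 < f x) ->
  exists2 a : R, 0 < a & forall x, E x -> a <= f x.
Proof.
move=> cE [F ef] f0; have [K K0 HK] := expands_lipschitz ef.
have : \forall L \near +oo, E `<=` (fun x => E x -> L^-1 <= f x).
  apply: ((compact_near_coveringP E).1 cE _ _ (fun L x => E x -> L^-1 <= f x)) => x0 Ex0.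
  have fx0 := f0 _ Ex0.
  have f2 : 0 < f x0 / 2 by rewrite divr_gt0.
  exists (ball x0 (f x0 / 2 / K), [set L | (f x0 / 2)^-1 <= L]).
    split => /=; first by apply: nbhsx_ballx; rewrite divr_gt0.
    by apply: nbhs_pinfty_ge; exact: num_real.
  move=> [x L] /= [xx0 HL] Ex.
  have fx : f x0 / 2 <= f x.
    have := HK _ _ Ex0 Ex; move: xx0; rewrite -ball_normE /= distrC ltr_pdivlMr// mulrC.
    by rewrite ler_distl => h1 /andP[h2 _]; lra.
  apply: le_trans fx; rewrite -[leRHS]invrK lef_pV2// posrE ?invr_gt0//.
  by rewrite (lt_le_trans _ HL)// invr_gt0.
move=> [L0 [_ HL]]; exists (`|L0| + 1)^-1.
  by rewrite invr_gt0 ltr_wpDl.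
move=> x Ex; apply: (HL (`|L0| + 1)) => //.
by rewrite (le_lt_trans (ler_norm _))// ltrDl.
Qed.

End expandable_functions.

Section asymptotic_calculus.
Variables (R : realType) (d : nat) (E : set 'rV[R]_d) (delta : R).
Local Notation vec := 'rV[R]_d.

(* Two nodes and a point at mutual distance at most [radius]. *)
Record configuration := Configuration {
  ptI : vec; ptJ : vec; ptX : vec; radius : R }.

Definition close_points c := [/\ [/\ E (ptI c), E (ptJ c) & E (ptX c)],
  0 <= radius c <= delta &
  [/\ `|ptI c - ptX c| <= radius c, `|ptJ c - ptX c| <= radius c &
      `|ptJ c - ptI c| <= radius c]].

(** The radius is the small parameter and the constant is common to all configurations, hence to all
    meshes. *)
Definition bigO (p : nat) (f : configuration -> R) :=
  exists C : R, forall c, close_points c -> `|f c| <= C * radius c ^+ p.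

Lemma bigO_ge0 p f : bigO p f -> exists2 C : R, 0 <= C &
  forall c, close_points c -> `|f c| <= C * radius c ^+ p.
Proof.
move=> [C H]; exists `|C| => // c Hc; rewrite (le_trans (H c Hc))//.
have [_ /andP[r0 _] _] := Hc.
by rewrite ler_wpM2r ?ler_norm// exprn_ge0.
Qed.

Lemma bigO_eq p f g : (forall c, close_points c -> f c = g c) ->
  bigO p f -> bigO p g.
Proof. by move=> fg [C H]; exists C => c Hc; rewrite -fg// H. Qed.

Lemma bigOD p f g : bigO p f -> bigO p g -> bigO p (fun c => f c + g c).
Proof.
move=> [C H] [C' H']; exists (C + C') => c Hc.
by rewrite (le_trans (ler_normD _ _))// mulrDl lerD// ?H// H'.
Qed.

Lemma bigOM p q f g : bigO p f -> bigO q g -> bigO (p + q) (fun c => f c * g c).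
Proof.
move=> /bigO_ge0[C C0 H] /bigO_ge0[C' C0' H']; exists (C * C') => c Hc.
by rewrite normrM exprD mulrACA ler_pM// ?H// H'.
Qed.

Lemma bigON p f : bigO p f -> bigO p (fun c => - f c).
Proof. by move=> [C H]; exists C => c Hc; rewrite normrN H. Qed.

Lemma bigOB p f g : bigO p f -> bigO p g -> bigO p (fun c => f c - g c).
Proof. by move=> bf bg; apply: bigOD => //; exact: bigON. Qed.

Lemma bigO_cst (a : R) : bigO 0 (fun=> a).
Proof. by exists `|a| => c _; rewrite expr0 mulr1. Qed.

Lemma bigO_bounded (f : vec -> R) (pt : configuration -> vec) :
  (forall c, close_points c -> E (pt c)) -> expandable E f -> bigO 0 (f \o pt).
Proof.
move=> Ept [F [L L0 H]]; exists L => c Hc; rewrite expr0 mulr1.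
by have [] := H _ (Ept c Hc).
Qed.

Lemma bigO_diff (f : vec -> R) (pt qt : configuration -> vec) :
  (forall c, close_points c ->
     [/\ E (pt c), E (qt c) & `|pt c - qt c| <= radius c]) ->
  expandable E f -> bigO 1 (fun c => f (pt c) - f (qt c)).
Proof.
move=> Hp [F /expands_lipschitz[L L0 H]]; exists L => c Hc.
have [Ep Eq pq] := Hp c Hc; rewrite expr1 (le_trans (H _ _ Eq Ep))//.
by rewrite ler_pM2l.
Qed.

Lemma bigO_taylor (f : vec -> R) F (pt qt : configuration -> vec) :
  (forall c, close_points c ->
     [/\ E (pt c), E (qt c) & `|pt c - qt c| <= radius c]) ->
  expands E f F ->
  bigO 2 (fun c => f (pt c) - f (qt c) - dot (F (qt c)) (pt c - qt c)).
Proof.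
move=> Hp [L L0 H]; exists L => c Hc.
have [Ep Eq pq] := Hp c Hc; have [_ _ H2] := H _ Eq.
rewrite (le_trans (H2 _ Ep))// ler_pM2l// lerXn2r ?nnegrE//.
exact: le_trans pq.
Qed.

Lemma bigO_inv (f : configuration -> R) (a : R) : 0 < a ->
  (forall c, close_points c -> a <= f c) -> bigO 0 (fun c => (f c)^-1).
Proof.
move=> a0 af; exists a^-1 => c Hc; rewrite expr0 mulr1.
have f0 : 0 < f c := lt_le_trans a0 (af c Hc).
rewrite ger0_norm; last by rewrite invr_ge0 ltW.
by rewrite lef_pV2 ?posrE// af.
Qed.

Lemma bigO_max_coord k (pt qt : configuration -> vec) :
  (forall c, close_points c -> `|pt c - qt c| <= radius c) ->
  bigO 1 (fun c => Num.max 0 (pt c 0 k - qt c 0 k)).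
Proof.
move=> Hp; exists 1 => c Hc; rewrite mul1r expr1 (le_trans _ (Hp c Hc))//.
have := coord_le_norm (pt c - qt c) k; rewrite !mxE; apply: le_trans.
by rewrite maxEle; case: ifPn => // _; rewrite normr0.
Qed.

End asymptotic_calculus.

Lemma mulr_powR_pred (R : realType) (x r : R) : 0 < x -> x * x `^ (r - 1) = x `^ r.
Proof.
move=> x0; rewrite -[X in X * _](powRr1 (ltW x0)) -powRD ?(gt_eqF x0) ?implybT//.
by rewrite addrC subrK.
Qed.

(** * Expansions of the star pressures and star densities *)

Section hydrostatic_expansions.
Variables (R : realType) (n : nat) (E : set 'rV[R]_n.+1).
Variables (gam Ceos grav : R) (u : 'rV[R]_n.+1 -> state R n).
Local Notation vec := 'rV[R]_n.+1.
Hypotheses (cE : compact E) (gam_gt0 : 0 < gam) (gam_neq1 : gam != 1).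
Hypotheses (Ceos_gt0 : 0 < Ceos).
Hypotheses (adm : forall x, E x -> admissible (u x)).
Hypotheses (erho : expandable E (fun x => rho (u x)))
  (erth : expandable E (fun x => rhotheta (u x))).

Local Notation ro x := (rho (u x)).
Local Notation th x := (theta (u x)).
Local Notation Th x := (rhotheta (u x)).
Local Notation ct := (ctilde gam Ceos).
Local Notation z x := (x 0 ord_max : R).
Local Notation up x y := (Num.max 0 (z x - z y)).
Local Notation conf := (configuration R n.+1).
Implicit Types (x y : vec) (c : conf).

Let ro_gt0 x : E x -> 0 < ro x. Proof. by case/adm. Qed.
Let th_gt0 x : E x -> 0 < th x. Proof. by case/adm. Qed.

Let gam1 : gam - 1 != 0. Proof. by rewrite subr_eq0. Qed.

Let ct_neq0 : ct != 0.
Proof. by rewrite /ctilde !mulf_neq0 ?invr_eq0// gt_eqF. Qed.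

Let ThE x : E x -> Th x = ro x * th x.
Proof. by move=> Ex; rewrite /theta mulrCA mulfV ?mulr1// gt_eqF// ro_gt0. Qed.

Let Th_gt0 x : E x -> 0 < Th x.
Proof. by move=> Ex; rewrite ThE// mulr_gt0 ?ro_gt0 ?th_gt0. Qed.

Let positive_expandable_powR (f : vec -> R) (r : R) : (forall x, E x -> 0 < f x) ->
  expandable E f -> expandable E (fun x => f x `^ r).
Proof.
move=> f0 ef; have [a a0 af] := expandable_lower_bound cE ef f0.
exact: expandable_powR a0 af ef.
Qed.

Let eth : expandable E (fun x => th x).
Proof.
have := expandable_mul erth (positive_expandable_powR (-1) ro_gt0 erho).
move=> [F eF]; exists F; apply: expands_eq eF => x /set_mem Ex.
by rewrite powR_inv1// ltW// ro_gt0.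
Qed.

(** The base of the power in [star_rho], isolated because it can be negative when [gam < 1]. *)
Definition star_argument x y : R :=
  ro x `^ (gam - 1) +
  grav / (ct * ((th x + th y) / 2) * th x `^ (gam - 1)) * up x y.

Lemma star_rhoE x y : star_rho gam Ceos grav (u x) (u y) (z x) (z y) =
  star_argument x y `^ (gam - 1)^-1.
Proof. by []. Qed.

(** The factor [theta ^ (gam - 1)] in the denominator of the star density is made to cancel here,
    leaving an additive correction that depends on the two temperatures only through their mean. The
    sign condition is what makes the two powers inverse to each other. *)
Lemma star_pressure x y : E x -> E y -> 0 <= star_argument x y ->
  (star_rho gam Ceos grav (u x) (u y) (z x) (z y) * th x) `^ (gam - 1) =
  Th x `^ (gam - 1) + grav / (ct * ((th x + th y) / 2)) * up x y.
Proof.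
move=> Ex Ey X0; have tx := th_gt0 Ex; have ty := th_gt0 Ey.
rewrite powRM ?powR_ge0 ?(ltW tx)// star_rhoE -powRrM mulVf// powRr1//.
rewrite ThE// powRM ?(ltW (ro_gt0 Ex)) ?(ltW tx)// /star_argument.
have tr : th x `^ (gam - 1) != 0 by rewrite gt_eqF// powR_gt0.
have txy : th x + th y != 0 by rewrite gt_eqF// addr_gt0.
by field; rewrite tr txy ct_neq0.
Qed.

Section near_equilibrium.
Variable delta : R.
Hypothesis delta_le1 : delta <= 1.
Local Notation close := (close_points E delta).
Local Notation bO := (bigO E delta).

Let II c : close c -> E (ptI c). Proof. by case=> -[]. Qed.
Let JJ c : close c -> E (ptJ c). Proof. by case=> -[]. Qed.
Let XX c : close c -> E (ptX c). Proof. by case=> -[]. Qed.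

Let IX c : close c -> [/\ E (ptI c), E (ptX c) & `|ptI c - ptX c| <= radius c].
Proof. by case=> -[? ? ?] ? []. Qed.
Let JX c : close c -> [/\ E (ptJ c), E (ptX c) & `|ptJ c - ptX c| <= radius c].
Proof. by case=> -[? ? ?] ? []. Qed.
Let JI c : close c -> [/\ E (ptJ c), E (ptI c) & `|ptJ c - ptI c| <= radius c].
Proof. by case=> -[? ? ?] ? []. Qed.
Let IJ c : close c -> [/\ E (ptI c), E (ptJ c) & `|ptI c - ptJ c| <= radius c].
Proof. by move=> /JI[? ?]; rewrite distrC. Qed.

(** Exchanging the nodes transfers each estimate on the star state of [ptI] to that of [ptJ]. *)
Definition swap c : conf := Configuration (ptJ c) (ptI c) (ptX c) (radius c).

Let close_swap c : close c -> close (swap c).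
Proof. by case=> -[? ? ?] ? [? ?]; rewrite distrC; split. Qed.

Let bigO_swap p f : bO p f -> bO p (f \o swap).
Proof. by move=> [C H]; exists C => c /close_swap/H. Qed.

Let bO_inv_mean : bO 0 (fun c => ((th (ptI c) + th (ptJ c)) / 2)^-1).
Proof.
have [a a0 ath] := expandable_lower_bound cE eth th_gt0.
apply: (bigO_inv a0) => c Hc.
by have := ath _ (II Hc); have := ath _ (JJ Hc); lra.
Qed.

Let bO_up : bO 1 (fun c => up (ptI c) (ptJ c)).
Proof. by apply: (@bigO_max_coord _ _ _ _ ord_max (@ptI R _) (@ptJ R _)) => c /IJ[]. Qed.

(** The hydrostatic increment of [star_argument], of first order because of the height
    difference. *)
Let w c := grav / (ct * ((th (ptI c) + th (ptJ c)) / 2) * th (ptI c) `^ (gam - 1)) *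
  up (ptI c) (ptJ c).

Let bO_w : bO 1 w.
Proof.
have b1 := bigO_cst E delta (grav / ct).
have b2 := bigO_bounded II (positive_expandable_powR (- (gam - 1)) th_gt0 eth).
have := bigOM (bigOM (bigOM b1 bO_inv_mean) b2) bO_up.
apply: bigO_eq => c Hc; rewrite /w /= powRN.
by rewrite !invfM !mulrA.
Qed.

(** The power of the density has a positive lower bound on the compact set, and the increment [w] is
    [O(radius)]; for small radius half of that bound survives, whatever the sign of [ctilde]. *)
Lemma star_argument_lower_bound : exists2 a : R, 0 < a & exists2 r : R, 0 < r &
  forall c, close c -> radius c <= r -> a <= star_argument (ptI c) (ptJ c).
Proof.
have e1 := positive_expandable_powR (gam - 1) ro_gt0 erho.
have [a a0 ab] := expandable_lower_bound cE e1
  (fun x Ex => powR_gt0 (gam - 1) (ro_gt0 Ex)).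
have [C C0 HC] := bigO_ge0 bO_w.
exists (a / 2); first by rewrite divr_gt0.
exists (a / 2 / (C + 1)); first by rewrite !divr_gt0// ltr_wpDl.
move=> c Hc rc; rewrite /star_argument -/(w c).
have : `|w c| <= a / 2.
  rewrite (le_trans (HC c Hc))// expr1.
  move: rc; rewrite ler_pdivlMr ?ltr_wpDl// mulrC; apply: le_trans.
  by have [_ /andP[r0 _] _] := Hc; rewrite ler_wpM2r// lerDl.
by rewrite ler_norml => /andP[w1 _]; have := ab _ (II Hc); lra.
Qed.

Hypothesis star_pos : exists2 a : R, 0 < a &
  forall c, close c -> a <= star_argument (ptI c) (ptJ c).

Lemma pressure_weight_expansion : exists2 G : vec -> vec,
  expands E (fun x => pres gam Ceos (u x)) G &
  bO 2 (fun c => ct * ro (ptI c) * th (ptI c) *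
    ((star_rho gam Ceos grav (u (ptJ c)) (u (ptI c)) (z (ptJ c)) (z (ptI c)) *
        th (ptJ c)) `^ (gam - 1) -
     (star_rho gam Ceos grav (u (ptI c)) (u (ptJ c)) (z (ptI c)) (z (ptJ c)) *
        th (ptI c)) `^ (gam - 1)) -
    dot (G (ptX c) + (ro (ptX c) * grav) *: e_vert R n) (ptJ c - ptI c)).
Proof.
have [a Th0 aTh] := expandable_lower_bound cE erth Th_gt0.
have [F eF] := erth.
have eP := expands_powR (gam - 1) Th0 aTh eF.
have eg := expands_powR gam Th0 aTh eF.
eexists; first exact: expands_mul (expands_cst E Ceos) eg.
have e1 : expandable E (fun x => Th x `^ (gam - 1)) by eexists; exact: eP.
have q1 : bO 1 (fun c => ct * (Th (ptI c) - Th (ptX c))).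
  exact: bigOM (bigO_cst E delta ct) (bigO_diff IX erth).
have q0 : bO 0 (fun c => ct * Th (ptX c)).
  exact: bigOM (bigO_cst E delta ct) (bigO_bounded XX erth).
have T2 := bigOB (bigO_taylor JX eP) (bigO_taylor IX eP).
have z1 : bO 1 (fun c => z (ptJ c) - z (ptI c)).
  exists 1 => c /JI[_ _ h]; rewrite mul1r expr1 (le_trans _ h)//.
  by have := coord_le_norm (ptJ c - ptI c) ord_max; rewrite !mxE.
(* Based on [theta_I / mean - 1 = (theta_I - theta_J) / 2 / mean]: the factor of gravity is the
   density at [ptI] up to first order. *)
have th1 := bigOM (bigOM (bigOM (bigO_bounded II erho) (bigO_diff IJ eth))
  (bigO_cst E delta 2^-1)) bO_inv_mean.
have m1 := bigOM (bigO_cst E delta grav)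
  (bigOM (bigOD th1 (bigO_diff IX erho)) z1).
(* Three second-order errors: freezing [ct * Theta] at [ptX], the Taylor remainders of
   [Theta ^ (gam - 1)], and replacing the factor of gravity by the density at [ptX]. *)
have := bigOD (bigOD (bigOM q1 (bigO_diff JI e1)) (bigOM q0 T2)) m1.
apply: bigO_eq => c Hc /=.
have [a' a'0 star0] := star_pos.
have EI := II Hc; have EJ := JJ Hc; have EX := XX Hc.
rewrite !star_pressure//; last 2 first.
- exact: le_trans (ltW a'0) (star0 _ Hc).
- exact: le_trans (ltW a'0) (star0 _ (close_swap Hc)).
rewrite scaler0 addr0 dotDl !dotZl.
have -> : dot (e_vert R n) (ptJ c - ptI c) = z (ptJ c) - z (ptI c).
  rewrite dot_sum (bigD1 ord_max)//= big1 ?addr0 => [|k km].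
    by rewrite !mxE !eqxx mul1r.
  by rewrite !mxE eqxx (negbTE km) mul0r.
have dotB (b v v' : vec) : dot b (v - v') = dot b v - dot b v'.
  by rewrite !dot_sum -sumrB; apply: eq_bigr => k _; rewrite !mxE mulrBr.
rewrite !dotB.
(* The two one-sided height differences combine into the signed one, so the kinks of the maxima
   disappear from the pressure weight. *)
have hup : up (ptJ c) (ptI c) - up (ptI c) (ptJ c) = z (ptJ c) - z (ptI c).
  rewrite !maxEle; case: ifPn; case: ifPn; rewrite ?subr_ge0 -?ltNge; lra.
have ThX := Th_gt0 EX.
have pX : Th (ptX c) * Th (ptX c) `^ (gam - 1 - 1) = Th (ptX c) `^ (gam - 1).
  exact: mulr_powR_pred.
have tI := th_gt0 EI; have tJ := th_gt0 EJ.
have tIJ : th (ptI c) + th (ptJ c) != 0 by rewrite gt_eqF// addr_gt0.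
rewrite [th (ptJ c) + th (ptI c)]addrC.
move: hup; set hJI := up _ _; set hIJ := up _ _ => hup.
have -> : hJI = hIJ + (z (ptJ c) - z (ptI c)) by rewrite -hup addrC subrK.
(* This is [grad p = ctilde * Theta * grad (Theta ^ (gam - 1))], which explains the constant
   [ctilde]. *)
have key v : Ceos * (gam * Th (ptX c) `^ (gam - 1) * v) =
    ct * Th (ptX c) * ((gam - 1) * Th (ptX c) `^ (gam - 1 - 1) * v).
  by rewrite -pX /ctilde; field; exact: gam1.
rewrite !key (ThE EI); field.
by rewrite tIJ ct_neq0.
Qed.

(** The one-sided derivative of the star density in the height difference, at zero difference and
    with the mean temperature replaced by that of the node. *)
Definition star_slope x : R :=
  (gam - 1)^-1 * ro x `^ (2 - gam) * (grav / ct) * th x `^ (- gam).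

Lemma star_slope_expandable : expandable E star_slope.
Proof.
have e1 := positive_expandable_powR (2 - gam) ro_gt0 erho.
have e2 := positive_expandable_powR (- gam) th_gt0 eth.
exact: expandable_mul (expandable_mul (expandable_mul (expandable_cst E (gam - 1)^-1) e1)
  (expandable_cst E (grav / ct))) e2.
Qed.

Lemma star_density_expansion :
  bO 2 (fun c => star_rho gam Ceos grav (u (ptI c)) (u (ptJ c)) (z (ptI c)) (z (ptJ c)) -
    ro (ptI c) - star_slope (ptI c) * up (ptI c) (ptJ c)).
Proof.
have [a a0 star0] := star_pos.
have e1 := positive_expandable_powR (gam - 1) ro_gt0 erho.
have [a1 a10 aro] := expandable_lower_bound cE e1
  (fun x Ex => powR_gt0 (gam - 1) (ro_gt0 Ex)).
have [B B0 HB] := bigO_ge0 (bigO_bounded II e1).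
have [W W0 HW] := bigO_ge0 bO_w.
have [am am0 [am1 am2]] : exists2 am : R, 0 < am & am <= a /\ am <= a1.
  exists (Num.min a a1); first by rewrite lt_min a0.
  by split; rewrite ge_min lexx ?orbT.
(* The interval from [am] to [B + W] contains both [rho ^ (gam - 1)] and [star_argument], since
   [|w| <= W] for radius at most 1. *)
have [C HC] := powR_expansion (gam - 1)^-1 (B + W) am0.
have powE x : E x -> (ro x `^ (gam - 1)) `^ (gam - 1)^-1 = ro x.
  by move=> Ex; rewrite -powRrM mulfV// powRr1// ltW// ro_gt0.
have first : bO 2 (fun c => star_argument (ptI c) (ptJ c) `^ (gam - 1)^-1 -
    (ro (ptI c) `^ (gam - 1)) `^ (gam - 1)^-1 -
    (gam - 1)^-1 * (ro (ptI c) `^ (gam - 1)) `^ ((gam - 1)^-1 - 1) * w c).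
  exists (`|C| * W ^+ 2) => c Hc.
  have r01 : 0 <= radius c <= 1.
    by have [_ /andP[r0 r1] _] := Hc; rewrite r0 (le_trans r1).
  have rB : ro (ptI c) `^ (gam - 1) <= B.
    by have := HB c Hc; rewrite expr0 mulr1; apply: le_trans; exact: ler_norm.
  have wW : `|w c| <= W * radius c by have := HW c Hc; rewrite expr1.
  have wW1 : W * radius c <= W by case/andP: r01 => ? ?; rewrite ler_piMr.
  have sE : star_argument (ptI c) (ptJ c) = ro (ptI c) `^ (gam - 1) + w c by [].
  have h1 : am <= ro (ptI c) `^ (gam - 1) <= B + W.
    by rewrite (le_trans am2 (aro _ (II Hc)))/=; move: rB; lra.
  have h2 : am <= star_argument (ptI c) (ptJ c) <= B + W.
    rewrite (le_trans am1 (star0 _ Hc))/= sE.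
    by move: (ler_norm (w c)); lra.
  have [_ _ /(_ _ h2)] := HC _ h1.
  have -> : star_argument (ptI c) (ptJ c) - ro (ptI c) `^ (gam - 1) = w c.
    by rewrite sE addrAC subrr add0r.
  move=> H; rewrite (le_trans H)//.
  rewrite (@le_trans _ _ (`|C| * (w c) ^+ 2))//.
    by rewrite ler_wpM2r ?sqr_ge0// ler_norm.
  rewrite -mulrA ler_wpM2l// -exprMn -real_normK ?num_real// lerXn2r ?nnegrE//.
  by apply: le_trans wW.
have c1 := bigO_bounded II (positive_expandable_powR (2 - gam) ro_gt0 erho).
have c2 := bigO_bounded II (positive_expandable_powR (- gam) th_gt0 eth).
(* The added term is the cost of replacing the mean temperature by that of [ptI]: the temperature
   difference contributes a second factor of first order. *)
have := bigOD first (bigOM (bigOM (bigOM (bigOM (bigOM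
  (bigO_cst E delta ((gam - 1)^-1 * (grav / ct) / 2)) c1) c2)
  bO_inv_mean) (bigO_diff IJ eth)) bO_up).
apply: bigO_eq => c Hc; have EI := II Hc; have EJ := JJ Hc.
have tI := th_gt0 EI; have tJ := th_gt0 EJ.
rewrite star_rhoE powE// -powRrM /star_slope /w /=.
have -> : (gam - 1) * ((gam - 1)^-1 - 1) = 2 - gam.
  by rewrite mulrBr mulfV//; ring.
rewrite [_ `^ (- gam)]powRN -(mulr_powR_pred gam tI).
have tr : th (ptI c) `^ (gam - 1) != 0 by rewrite gt_eqF// powR_gt0.
have tI0 : th (ptI c) != 0 by rewrite gt_eqF.
have tIJ : th (ptI c) + th (ptJ c) != 0 by rewrite gt_eqF// addr_gt0.
by field; rewrite tr tI0 tIJ ct_neq0 gam1.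
Qed.

(** Unlike in the pressure weight, the one-sided height differences add up and do not form an affine
    function. Moving the slope from [ptJ] to [ptI] costs second order and leaves a multiple of their
    sum, subtracted here and left to the vertical matching. *)
Lemma flux_weight_expansion (s : vec -> R) (G : vec -> vec) :
  expandable E s -> expands E (fun x => ro x * s x) G ->
  bO 2 (fun c =>
    star_rho gam Ceos grav (u (ptI c)) (u (ptJ c)) (z (ptI c)) (z (ptJ c)) * s (ptI c) +
    star_rho gam Ceos grav (u (ptJ c)) (u (ptI c)) (z (ptJ c)) (z (ptI c)) * s (ptJ c) -
    star_slope (ptI c) * s (ptI c) * (up (ptI c) (ptJ c) + up (ptJ c) (ptI c)) -
    (ro (ptI c) * s (ptI c) + ro (ptX c) * s (ptX c) +
     dot (G (ptX c)) (ptJ c - ptX c))).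
Proof.
move=> es eG; have S := star_density_expansion.
have eb := expandable_mul star_slope_expandable es.
have up' : bO 1 (fun c => up (ptJ c) (ptI c)) := bigO_swap bO_up.
have := bigOD (bigOD (bigOD (bigOM S (bigO_bounded II es))
  (bigOM (bigO_swap S) (bigO_bounded JJ es)))
  (bigOM (bigO_diff JI eb) up')) (bigO_taylor JX eG).
by apply: bigO_eq => c Hc /=; ring.
Qed.

End near_equilibrium.
End hydrostatic_expansions.

(** * From expansions of the weights to consistency errors of the integrals *)

Section interpolation_error.
Variables (R : realType) (n : nat) (D : set 'rV[R]_n.+1) (kappa delta : R).
Local Notation vec := 'rV[R]_n.+1.
Local Notation vtx := {ffun 'I_n.+1 -> bool}.
Local Notation preim := (preimage (@rV_of_tuple R n.+1)).
Hypotheses (oD : open D) (cD : compact (closure D)) (kappa_gt0 : 0 < kappa).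

Let C0 : R := #|{: vtx}|%:R * gradient_const n kappa.

Let C0_ge0 : 0 <= C0.
Proof. by rewrite mulr_ge0// gradient_const_ge0. Qed.

(** Of the remainder [cell_diam K ^ 2] one factor is bounded by the mesh size, the other is what
    [affine_consistency] needs against the gradients. The term [al] may depend on the node and the
    point, since it is constant in the second vertex. *)
Lemma bigO_consistency (k : 'I_n.+1) (W al : vec -> vec -> R) (b : vec -> vec) :
  (forall M : mesh R n.+1,
     bounded_mfun (preim (D `\` cell_skeleton M)) ((fun x => b x 0 k) \o @rV_of_tuple R n.+1)) ->
  bigO (closure D) delta 2 (fun c => W (ptI c) (ptJ c) -
    (al (ptI c) (ptX c) + dot (b (ptX c)) (ptJ c - ptX c))) ->
  exists2 C : R, 0 <= C &
  forall (M : mesh R n.+1) (phi : node M -> vec -> R) (i : node M),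
    mesh_of M D -> regular_mesh M kappa -> mesh_size M <= delta ->
    nodal_basis D phi ->
    `|domain_integral D (fun x => phi i x * b x 0 k) -
      \sum_(j in stencil D phi i) W (pos i) (pos j) * cvec D phi i j 0 k| <=
    C * mesh_size M * lumped_mass D phi i.
Proof.
move=> bb /bigO_ge0[C C_ge0 HC]; exists (C0 * C) => [|M phi i hM reg hsz nb].
  exact: mulr_ge0.
have m0 := mesh_size_ge0 M.
rewrite -(mulrA C0); apply: (@affine_consistency _ _ D M phi kappa oD cD hM kappa_gt0 reg nb
  i k (fun j => W (pos i) (pos j)) (fun x => b x 0 k) (C * mesh_size M)).
- exact: bb.
- exact: mulr_ge0.
move=> K a0 x va0 Kx Dx; exists (al (pos i) x), (b x); split => // a.
have clK y : cellset K y -> closure D y.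
  by move=> Ky; have [_ _ _ -> _] := hM; exists K.
pose c := Configuration (pos i) (pos (vertex K a)) x (cell_diam K).
have Ki : cellset K (pos i) by rewrite -va0; exact: cellset_vertex.
have Ka := cellset_vertex K a.
have Hc : close_points (closure D) delta c.
  split; first by split; apply: clK.
    by rewrite cell_diam_ge0/= (le_trans (cell_diam_le_mesh_size K)).
  by split; exact: cell_diam_ge.
apply: le_trans (HC c Hc) _; rewrite /= expr2 mulrA.
by rewrite ler_wpM2r ?cell_diam_ge0// ler_wpM2l// cell_diam_le_mesh_size.
Qed.

End interpolation_error.

(** The bound with the lumped mass [m] is the stronger one; as [m] is at most the volume [V] of the
    domain, one constant serves both bounds of the theorem. *)
Lemma error_bound_pair (R : realType) (A V h m e : R) : 0 <= A -> 0 <= h ->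
  0 <= m <= V -> e <= A * h * m ->
  e <= A * (1 + V) * h /\ e <= A * (1 + V) * h * m.
Proof.
move=> A0 h0 /andP[m0 mV] eA; have V0 : 0 <= V := le_trans m0 mV.
have Ah : 0 <= A * h by rewrite mulr_ge0.
have -> : A * (1 + V) * h = A * h * (1 + V) by ring.
split; rewrite (le_trans eA)//.
  by rewrite ler_wpM2l//; lra.
by rewrite ler_wpM2r// ler_peMr//; lra.
Qed.

Lemma state_norm_le (R : realType) (n : nat) (e : state R n) (B : R) : 0 <= B ->
  `|e.1.1| <= B -> (forall a, `|e.1.2 0 a| <= B) -> `|e.2| <= B -> `|e| <= B.
Proof.
move=> B0 h1 h2 h3; rewrite prod_normE ge_max h3 andbT prod_normE ge_max h1/=.
exact: norm_le_coord.
Qed.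

Lemma eq_domain_integral (R : realType) (d : nat) (D : set 'rV[R]_d)
    (f g : 'rV[R]_d -> R) : (forall x, D x -> f x = g x) ->
  domain_integral D f = domain_integral D g.
Proof. by move=> fg; apply: eq_Rintegral => t /set_mem Dt; rewrite fg. Qed.

Section star_fluxes.
Variables (R : realType) (n : nat).
Local Notation vec := 'rV[R]_n.+1.
Implicit Types (s t : R) (v c : vec).

(** A star state keeps velocity and potential temperature, so its flux is linear in the star
    density. *)
Lemma pressureless_flux_star s v t : s != 0 ->
  pressureless_flux (s, s *: v, t * s) =
  (s *: v, s *: (v^T *m v), (s * t) *: v) :> flux R n.
Proof.
move=> s0; rewrite /pressureless_flux /vel /mom /rho /rhotheta /=; congr (_, _, _).
  by apply/matrixP => a l; rewrite !mxE !big_ord1 !mxE; field.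
by apply/matrixP => i l; rewrite !mxE; field.
Qed.

(** All components have the shape [s * (q * v_l)] with [q] equal to 1, to a velocity component or to
    [t]; the factors 1 are kept so that [flux_consistency] applies to each. *)
Lemma fluxdot_star s v t s' v' t' c :
  let e := fluxdot ((s *: v, s *: (v^T *m v), (s * t) *: v) +
                    (s' *: v', s' *: (v'^T *m v'), (s' * t') *: v') : flux R n) c in
  [/\ e.1.1 = \sum_l (s * (1 * v 0 l) + s' * (1 * v' 0 l)) * c 0 l,
      forall a, e.1.2 0 a =
        \sum_l (s * (v 0 a * v 0 l) + s' * (v' 0 a * v' 0 l)) * c 0 l &
      e.2 = \sum_l (s * (t * v 0 l) + s' * (t' * v' 0 l)) * c 0 l].
Proof.
split => [|a|] /=.
- by rewrite dot_sum; apply: eq_bigr => l _; rewrite !mxE !mul1r.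
- by rewrite mxE; apply: eq_bigr => l _; rewrite !mxE !big_ord1 !mxE mulrC.
- by rewrite dot_sum; apply: eq_bigr => l _; rewrite !mxE !mulrA.
Qed.

End star_fluxes.

Section consistency.
Variables (R : realType) (n : nat) (D : set 'rV[R]_n.+1) (gam Ceos grav T tn kappa : R).
Variable U : 'rV[R]_n.+1 -> R -> state R n.
Local Notation vec := 'rV[R]_n.+1.
Local Notation vtx := {ffun 'I_n.+1 -> bool}.
Local Notation toV := (@rV_of_tuple R n.+1).
Local Notation preim := (preimage toV).
Hypotheses (oD : open D) (cD : compact (closure D)).
Hypotheses (gam_gt0 : 0 < gam) (gam_neq1 : gam != 1) (Ceos_gt0 : 0 < Ceos).
Hypotheses (tn_T : 0 <= tn <= T) (kappa_gt0 : 0 < kappa).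
Hypothesis sU : smooth_on (closure D `*` [set t | 0 <= t <= T]) (fun p => U p.1 p.2).
Hypothesis aU : forall x t, closure D x -> 0 <= t <= T -> admissible (U x t).

Let u x := U x tn.
Local Notation ro x := (rho (u x)).
Local Notation th x := (theta (u x)).
Local Notation v x l := (vel (u x) 0 l).
Local Notation ct := (ctilde gam Ceos).
Local Notation z x := (x 0 ord_max : R).
Local Notation up x y := (Num.max 0 (z x - z y)).
Local Notation star x y := (star_rho gam Ceos grav (u x) (u y) (z x) (z y)).

Let au x : closure D x -> admissible (u x).
Proof. by move=> Dx; exact: aU. Qed.

Let erho : expandable (closure D) (fun x => ro x) := rho_expandable cD tn_T sU.
Let erth : expandable (closure D) (fun x => rhotheta (u x)) :=
  rhotheta_expandable cD tn_T sU.

Let ro_gt0 x : closure D x -> 0 < ro x. Proof. by case/au. Qed.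

Let einv : expandable (closure D) (fun x => (ro x)^-1).
Proof.
have [a a0 aro] := expandable_lower_bound cD erho ro_gt0.
have [F eF] := expandable_powR (-1) a0 aro erho.
exists F; apply: expands_eq eF => x /set_mem Dx.
by rewrite powR_inv1// ltW// ro_gt0.
Qed.

Lemma velocity_expandable l : expandable (closure D) (fun x => v x l).
Proof.
have [F eF] := expandable_mul einv (mom_expandable cD tn_T sU l).
by exists F; apply: expands_eq eF => x _; rewrite /vel mxE.
Qed.

Lemma theta_expandable : expandable (closure D) (fun x => th x).
Proof.
have [F eF] := expandable_mul erth einv.
by exists F; apply: expands_eq eF.
Qed.

Let star_radius : exists2 delta : R, 0 < delta <= 1 & exists2 a : R, 0 < a &
  forall c, close_points (closure D) delta c ->
    a <= star_argument gam Ceos grav u (ptI c) (ptJ c).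
Proof.
have [a a0 [r r0 H]] := star_argument_lower_bound gam Ceos grav cD au erho erth 1.
exists (Num.min 1 r); first by rewrite lt_min ltr01 r0 ge_min lexx.
exists a => // c [cE /andP[r1 r2] cd]; move: r2; rewrite le_min => /andP[r2 r3].
by apply: H => //; split; rewrite ?r1.
Qed.

Let nbhs_closure x : D x -> nbhs x (closure D).
Proof.
move=> Dx; apply: filterS (open_nbhs_nbhs (conj oD Dx)); exact: subset_closure.
Qed.

Let pderiv_expands f F k x : expands (closure D) f F -> D x -> pderiv k f x = F x 0 k.
Proof.
move=> ef Dx; exact: (@derive_val _ _ _ _ _ _ _ (expands_pderiv k ef (nbhs_closure Dx))).
Qed.

(** For [gam > 1] the constant [ctilde] is positive, so the hydrostatic increment is nonnegative at
    any distance. *)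
Lemma star_rho_gt0 x y : 1 < gam -> 0 < grav -> closure D x -> closure D y ->
  0 < star x y.
Proof.
move=> g1 grav0 /au[rx tx] /au[_ ty]; apply: powR_gt0; rewrite ltr_pwDl ?powR_gt0//.
have ct0 : 0 < ct by rewrite /ctilde divr_gt0 ?mulr_gt0 ?subr_gt0.
rewrite mulr_ge0 ?le_max ?lexx// divr_ge0 ?(ltW grav0)//.
apply: mulr_ge0 (powR_ge0 _ _); apply: (mulr_ge0 (ltW ct0)).
by apply: divr_ge0 => //; exact: ltW (addr_gt0 tx ty).
Qed.

Lemma pressure_consistency : exists C h0 : R, [/\ 0 <= C, 0 < h0 &
  forall (M : mesh R n.+1) (phi : node M -> vec -> R) (i : node M) k,
    mesh_of M D -> regular_mesh M kappa -> mesh_size M <= h0 -> nodal_basis D phi ->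
    `|domain_integral D (fun x => phi i x *
        (pderiv k (fun y => pres gam Ceos (u y)) x + ro x * grav * e_vert R n 0 k)) -
      \sum_(j in stencil D phi i)
        ct * ro (pos i) * th (pos i) *
        ((star (pos j) (pos i) * th (pos j)) `^ (gam - 1) -
         (star (pos i) (pos j) * th (pos i)) `^ (gam - 1)) * cvec D phi i j 0 k| <=
    C * mesh_size M * lumped_mass D phi i].
Proof.
have [delta /andP[d0 d1] spos] := star_radius.
have [G eG bG] := pressure_weight_expansion cD gam_gt0 gam_neq1 Ceos_gt0 au erho erth spos.
pose W x y := ct * ro x * th x * ((star y x * th y) `^ (gam - 1) -
  (star x y * th x) `^ (gam - 1)).
pose b x := G x + (ro x * grav) *: e_vert R n.
have [F eF] := erho.
have bb k (M : mesh R n.+1) :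
    bounded_mfun (preim (D `\` cell_skeleton M)) ((fun x => b x 0 k) \o toV).
  rewrite (_ : _ \o _ = fun t => G (toV t) 0 k + ro (toV t) * (grav * e_vert R n 0 k)).
    apply: bounded_mfunD; first exact: (expands_gradient_bounded_mfun M oD k eG).
    apply: bounded_mfunM; first exact: (expands_bounded_mfun M oD eF).
    exact: bounded_mfun_cst.
  by apply/funext => t; rewrite /= /b !mxE mulrA.
(* The weight expansion is centred at [ptI], the consistency lemma at [ptX]; the discrepancy does
   not involve [ptJ] and goes into the constant term. *)
have bO : bigO (closure D) delta 2 (fun c => W (ptI c) (ptJ c) -
    (- dot (b (ptX c)) (ptI c - ptX c) + dot (b (ptX c)) (ptJ c - ptX c))).
  apply: bigO_eq bG => c _; congr (_ - _); rewrite !dot_sum -sumrN -big_split/=.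
  by apply: eq_bigr => k _; rewrite /b !mxE; ring.
have H k := @bigO_consistency R n D kappa delta oD cD kappa_gt0 k W
  (fun x y => - dot (b y) (x - y)) b (bb k) bO.
have [C HC] :=
  choice (fun k => let: ex_intro2 C p q := H k in ex_intro _ C (conj p q)).
exists (\sum_k C k), delta; split => //; first by apply: sumr_ge0 => k _; case: (HC k).
move=> M phi i k hM reg hsz nb; have [Ck0 /(_ M phi i hM reg hsz nb) HCk] := HC k.
have /andP[m0 _] := lumped_mass_le oD cD hM kappa_gt0 reg nb i.
have E : domain_integral D (fun x => phi i x *
    (pderiv k (fun y => pres gam Ceos (u y)) x + ro x * grav * e_vert R n 0 k)) =
    domain_integral D (fun x => phi i x * b x 0 k).
  by apply: eq_domain_integral => x Dx; rewrite (pderiv_expands k eG Dx) /b !mxE.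
rewrite E (le_trans HCk)// ler_wpM2r// ler_wpM2r ?mesh_size_ge0//.
by rewrite (bigD1 k)//= lerDl sumr_ge0// => k' _; case: (HC k').
Qed.

(** Consistency for the transport of one scalar density [rho * q]. The threshold is chosen before
    [q], so all components of the flux share it. *)
Lemma flux_consistency : exists2 h0 : R, 0 < h0 &
  forall (q : vec -> R) (f : 'I_n.+1 -> vec -> R) (cM : R),
  expandable (closure D) q ->
  (forall l x, closure D x -> f l x = ro x * (q x * v x l)) ->
  exists2 C : R, 0 <= C &
  forall (M : mesh R n.+1) (phi : node M -> vec -> R) (i : node M),
    mesh_of M D -> regular_mesh M kappa -> mesh_size M <= h0 -> nodal_basis D phi ->
    vertically_matched D phi cM i ->
    `|domain_integral D (fun x => phi i x * \sum_l pderiv l (f l) x) -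
      \sum_(j in stencil D phi i) \sum_l
        (star (pos i) (pos j) * (q (pos i) * v (pos i) l) +
         star (pos j) (pos i) * (q (pos j) * v (pos j) l)) * cvec D phi i j 0 l| <=
    C * mesh_size M * lumped_mass D phi i.
Proof.
have [delta /andP[d0 d1] spos] := star_radius.
exists delta => // q f cM eq fE.
pose s l x := q x * v x l.
have es l : expandable (closure D) (s l) by exact: expandable_mul eq (velocity_expandable l).
have [G eG] := choice (fun l => expandable_mul erho (es l)).
pose sl := star_slope gam Ceos grav u.
have esl : expandable (closure D) sl := star_slope_expandable gam Ceos grav cD au erho erth.
pose W l x y := star x y * s l x + star y x * s l y -
  sl x * s l x * (up x y + up y x).
have bb l (M : mesh R n.+1) :
    bounded_mfun (preim (D `\` cell_skeleton M)) ((fun x => G l x 0 l) \o toV).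
  exact: (expands_gradient_bounded_mfun M oD l (eG l)).
have bO l : bigO (closure D) delta 2 (fun c => W l (ptI c) (ptJ c) -
    (ro (ptI c) * s l (ptI c) + ro (ptX c) * s l (ptX c) +
     dot (G l (ptX c)) (ptJ c - ptX c))).
  exact: (flux_weight_expansion cD gam_gt0 gam_neq1 Ceos_gt0 au erho erth d1 spos (es l) (eG l)).
have H l := @bigO_consistency R n D kappa delta oD cD kappa_gt0 l (W l)
  (fun x y => ro x * s l x + ro y * s l y) (G l) (bb l) (bO l).
have [C HC] :=
  choice (fun k => let: ex_intro2 C p q := H k in ex_intro _ C (conj p q)).
have bs l : exists B : R, forall x, closure D x -> `|sl x * s l x| <= B.
  have [F [L _ HL]] := expandable_mul esl (es l).
  by exists L => x Dx; have [] := HL x Dx.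
have [B HB] := choice bs.
pose K : R := #|{: vtx}|%:R * gradient_const n kappa.
have K0 : 0 <= K by rewrite mulr_ge0// gradient_const_ge0.
exists (\sum_l (C l + `|B l| * `|cM| * K)).
  apply: sumr_ge0 => l _; apply: addr_ge0; first by case: (HC l).
  by apply: mulr_ge0 K0; exact: mulr_ge0.
move=> M phi i hM reg hsz nb vm.
have Di : closure D (pos i).
  have [_ [_ /(_ i)[L [a La]]] _ -> _] := hM; exists L => //.
  by rewrite -La; exact: cellset_vertex.
rewrite (@eq_domain_integral R n.+1 D _ (fun x => phi i x * \sum_l G l x 0 l)); last first.
  move=> x Dx; congr (_ * _); apply: eq_bigr => l _.
  apply: (pderiv_expands (f := f l) (F := G l) l _ Dx).
  by apply: expands_eq (eG l) => y /set_mem Dy; rewrite fE.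
rewrite (@domain_integral_shape_sum R n D M phi kappa oD cD hM kappa_gt0 reg nb i _
  (fun l x => G l x 0 l) (fun l => bb l M)).
rewrite exchange_big/= -sumrB (le_trans (ler_norm_sum _ _ _))// !mulr_suml ler_sum// => l _.
pose mid := \sum_(j in stencil D phi i)
  (drop_height i j + drop_height j i) * cvec D phi i j 0 l.
(* [W] was formed by subtracting the non-affine part; adding it back produces [mid], which the
   vertical matching bounds. *)
have -> : \sum_(j in stencil D phi i) (star (pos i) (pos j) * (q (pos i) * v (pos i) l) +
    star (pos j) (pos i) * (q (pos j) * v (pos j) l)) * cvec D phi i j 0 l =
    \sum_(j in stencil D phi i) W l (pos i) (pos j) * cvec D phi i j 0 l +
    sl (pos i) * s l (pos i) * mid.
  rewrite mulr_sumr -big_split/=; apply: eq_bigr => j _.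
  rewrite [X in _ = _ + X]mulrA -[RHS]mulrDl; congr (_ * _); rewrite /W /drop_height /height /s.
  by rewrite subrK.
rewrite opprD addrA (le_trans (ler_normB _ _))// !mulrDl lerD//.
  by have [_ /(_ M phi i hM reg hsz nb)] := HC l.
have hmid := matched_sum_le oD cD hM kappa_gt0 reg nb l vm.
rewrite normrM (@le_trans _ _ (`|B l| * (`|cM| * mesh_size M * (K * lumped_mass D phi i))))//.
  by rewrite ler_pM// (le_trans (HB l _ Di))// ler_norm.
by rewrite le_eqVlt; apply/orP; left; apply/eqP; ring.
Qed.

End consistency.

Theorem proposition3p4 (R : realType) (n : nat) (D : set 'rV[R]_n.+1)
    (gam Ceos grav T tn kappa : R) (U : 'rV[R]_n.+1 -> R -> state R n)
    (dim23 : n.+1 = 2%N \/ n.+1 = 3%N) (hD : polygonal_domain D)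
    (gam_gt0 : 0 < gam) (gam_neq1 : gam != 1) (Ceos_gt0 : 0 < Ceos)
    (grav_gt0 : 0 < grav) (T_gt0 : 0 < T) (tn_T : 0 <= tn <= T)
    (kappa_gt0 : 0 < kappa)
    (hU : smooth_admissible_solution gam Ceos grav D T U) :
  (exists C h0 : R, 0 < h0 /\
    forall (M : mesh R n.+1) (phi : node M -> 'rV[R]_n.+1 -> R) (i : node M),
      mesh_of M D -> regular_mesh M kappa -> mesh_size M <= h0 ->
      nodal_basis D phi -> interior_node D i ->
      let u j := U (pos j) tn in
      let z := @height R n M in
      let err :=
        vec_integral D (fun x => phi i x *:
          (grad (fun y => pres gam Ceos (U y tn)) x +
           (rho (U x tn) * grav) *: e_vert R n))
        - (ctilde gam Ceos * rho (u i) * theta (u i)) *: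
          (\sum_(j in stencil D phi i)
            ((star_rho gam Ceos grav (u j) (u i) (z j) (z i) * theta (u j))
               `^ (gam - 1) -
             (star_rho gam Ceos grav (u i) (u j) (z i) (z j) * theta (u i))
               `^ (gam - 1)) *: cvec D phi i j) in
      `|err| <= C * mesh_size M /\
      `|err| <= C * mesh_size M * lumped_mass D phi i)
  /\
  (1 < gam -> forall cM : R, exists C h0 : R, 0 < h0 /\
    forall (M : mesh R n.+1) (phi : node M -> 'rV[R]_n.+1 -> R) (i : node M),
      mesh_of M D -> regular_mesh M kappa -> mesh_size M <= h0 ->
      nodal_basis D phi -> interior_node D i ->
      vertically_matched D phi cM i ->
      let u j := U (pos j) tn in
      let z := @height R n M in
      let err :=
        state_integral D (fun x => phi i x *:
          divflux (fun y => pressureless_flux (U y tn)) x)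
        - \sum_(j in stencil D phi i)
            fluxdot (pressureless_flux
                       (star_state gam Ceos grav (u i) (u j) (z i) (z j)) +
                     pressureless_flux
                       (star_state gam Ceos grav (u j) (u i) (z j) (z i)))
              (cvec D phi i j) in
      `|err| <= C * mesh_size M /\
      `|err| <= C * mesh_size M * lumped_mass D phi i).
Proof.
have [_ oD _ _ _] := hD; have cD := polygonal_domain_compact hD.
have [sU aU _] := hU.
split.
  have [C [h0 [C0 h0_gt0 HC]]] := pressure_consistency grav oD cD gam_gt0 gam_neq1
    Ceos_gt0 tn_T kappa_gt0 sU aU.
  exists (C * (1 + fine (lebesgue_tuple R n.+1 (@rV_of_tuple R n.+1 @^-1` D)))), h0.
  split => // M phi i hM reg hsz nb _ u z err.
  have mm := lumped_mass_le oD cD hM kappa_gt0 reg nb i.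
  apply: (error_bound_pair C0 (mesh_size_ge0 M) mm).
  apply: norm_le_coord => [|k].
    by case/andP: mm => m0 _; rewrite !mulr_ge0 ?mesh_size_ge0.
  apply: le_trans (HC M phi i k hM reg hsz nb).
  rewrite le_eqVlt; apply/orP; left; apply/eqP; congr `|_|.
  rewrite /err [LHS]mxE [X in X + _]mxE [X in _ + X]mxE [X in - X]mxE summxE.
  congr (_ - _).
    apply: eq_domain_integral => x _; rewrite [LHS]mxE; congr (_ * _).
    by rewrite [LHS]mxE [X in X + _]mxE [X in _ + X]mxE.
  rewrite mulr_sumr; apply: eq_bigr => j _; rewrite [X in _ * X]mxE.
  by rewrite [LHS]mulrA.
move=> gam_gt1 cM.
have [h0 h0_gt0 HF] := flux_consistency grav oD cD gam_gt0 gam_neq1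
  Ceos_gt0 tn_T kappa_gt0 sU aU.
have ev := velocity_expandable cD tn_T sU aU.
have ro0 x : closure D x -> rho (U x tn) != 0.
  by move=> Dx; have [r0 _] := aU x tn Dx tn_T; rewrite gt_eqF.
(* The transported scalars are [q = 1] for mass, [theta] for the last component and [vel] in
   direction [a] for momentum. *)
have [C1 C1_ge0 H1] := HF (fun=> 1) (fun l x => mom (U x tn) 0 l) cM
  (expandable_cst _ 1) ltac:(by move=> l x /ro0 r0; rewrite /vel mxE mul1r mulrA mulfV// mul1r).
have [C3 C3_ge0 H3] := HF (fun x => theta (U x tn))
  (fun l x => (rhotheta (U x tn) *: vel (U x tn)) 0 l) cM
  (theta_expandable cD tn_T sU aU)
  ltac:(by move=> l x /ro0 r0; rewrite mxE /theta mulrA [rho _ * _]mulrC mulfVK).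
have H2' a := HF (fun x => vel (U x tn) 0 a)
  (fun l x => row a ((rho (U x tn))^-1 *: ((mom (U x tn))^T *m mom (U x tn))) 0 l) cM
  (ev a)
  ltac:(by move=> l x /ro0 r0; rewrite /vel !mxE big_ord1 !mxE; field).
have [C2 H2] := choice (fun a => let: ex_intro2 C p q := H2' a in ex_intro _ C (conj p q)).
have S2 : 0 <= \sum_a C2 a by apply: sumr_ge0 => a _; case: (H2 a).
pose C := C1 + \sum_a C2 a + C3.
have C0 : 0 <= C by rewrite !addr_ge0.
exists (C * (1 + fine (lebesgue_tuple R n.+1 (@rV_of_tuple R n.+1 @^-1` D)))), h0.
split => // M phi i hM reg hsz nb _ vm u z err.
have mm := lumped_mass_le oD cD hM kappa_gt0 reg nb i.
apply: (error_bound_pair C0 (mesh_size_ge0 M) mm).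
have clp (j : node M) : closure D (pos j).
  have [_ [_ /(_ j)[L [a La]]] _ -> _] := hM; exists L => //.
  by rewrite -La; exact: cellset_vertex.
have hm : 0 <= mesh_size M * lumped_mass D phi i.
  by case/andP: mm => m0 _; rewrite mulr_ge0 ?mesh_size_ge0.
have star0 (j k : node M) : star_rho gam Ceos grav (u j) (u k) (z j) (z k) != 0.
  by rewrite gt_eqF// (star_rho_gt0 gam_gt0 Ceos_gt0 tn_T aU gam_gt1 grav_gt0 (clp j) (clp k)).
pose st j k := star_rho gam Ceos grav (u j) (u k) (z j) (z k).
pose X j := fluxdot (pressureless_flux
      (star_state gam Ceos grav (u i) (u j) (z i) (z j)) +
    pressureless_flux (star_state gam Ceos grav (u j) (u i) (z j) (z i)))
  (cvec D phi i j).
have FS j := fluxdot_star (st i j) (vel (u i)) (theta (u i)) (st j i) (vel (u j))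
  (theta (u j)) (cvec D phi i j).
have XE j : X j = fluxdot ((st i j *: vel (u i), st i j *: ((vel (u i))^T *m vel (u i)),
      (st i j * theta (u i)) *: vel (u i)) +
    (st j i *: vel (u j), st j i *: ((vel (u j))^T *m vel (u j)),
      (st j i * theta (u j)) *: vel (u j)) : flux R n) (cvec D phi i j).
  by rewrite /X /star_state (pressureless_flux_star _ _ (star0 i j))
    (pressureless_flux_star _ _ (star0 j i)).
have mono c : c <= C -> c * mesh_size M * lumped_mass D phi i <=
    C * mesh_size M * lumped_mass D phi i.
  by move=> cC; rewrite -!mulrA ler_wpM2r.
have S2a a : C2 a <= \sum_a C2 a.
  by rewrite (bigD1 a)//= lerDl sumr_ge0// => b _; case: (H2 b).
apply: state_norm_le.
- by rewrite -mulrA mulr_ge0.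
- apply: le_trans (mono C1 _); last by rewrite /C -addrA lerDl addr_ge0.
  apply: le_trans (H1 M phi i hM reg hsz nb vm).
  rewrite le_eqVlt; apply/orP; left; apply/eqP; congr `|_|.
  have sum1 : (\sum_(j in stencil D phi i) X j).1.1 =
      \sum_(j in stencil D phi i) (X j).1.1.
    by apply: (big_morph (fun e : state R n => e.1.1)).
  rewrite -[LHS]/(domain_integral D (fun x => (phi i x *:
    divflux (fun y => pressureless_flux (U y tn)) x).1.1) -
    (\sum_(j in stencil D phi i) X j).1.1) sum1; congr (_ - _).
  by apply: eq_bigr => j _; rewrite XE; have [E _ _] := FS j; exact: E.
- move=> a; apply: le_trans (mono (C2 a) _); last first.
    by rewrite /C (le_trans (S2a a))// addrAC lerDr addr_ge0.
  have [_ H2a] := H2 a; apply: le_trans (H2a M phi i hM reg hsz nb vm).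
  rewrite le_eqVlt; apply/orP; left; apply/eqP; congr `|_|.
  have sum2 : (\sum_(j in stencil D phi i) X j).1.2 0 a =
      \sum_(j in stencil D phi i) (X j).1.2 0 a.
    by apply: (big_morph (fun e : state R n => e.1.2 0 a)) => [x y|]; rewrite mxE.
  rewrite -[LHS]/((vec_integral D (fun x => (phi i x *:
    divflux (fun y => pressureless_flux (U y tn)) x).1.2) -
    (\sum_(j in stencil D phi i) X j).1.2) 0 a).
  rewrite [LHS]mxE [X in _ + X]mxE sum2 [X in X - _]mxE; congr (_ - _).
    apply: eq_domain_integral => x _.
    rewrite -[LHS]/((phi i x *: divmx (fun y => (pressureless_flux (U y tn)).1.2) x) 0 a).
    by rewrite [LHS]mxE; congr (_ * _); rewrite [LHS]mxE.
  by apply: eq_bigr => j _; rewrite XE; have [_ E _] := FS j; exact: E.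
- apply: le_trans (mono C3 _); last by rewrite /C lerDr addr_ge0.
  apply: le_trans (H3 M phi i hM reg hsz nb vm).
  rewrite le_eqVlt; apply/orP; left; apply/eqP; congr `|_|.
  have sum3 : (\sum_(j in stencil D phi i) X j).2 =
      \sum_(j in stencil D phi i) (X j).2.
    by apply: (big_morph (fun e : state R n => e.2)).
  rewrite -[LHS]/(domain_integral D (fun x => (phi i x *:
    divflux (fun y => pressureless_flux (U y tn)) x).2) -
    (\sum_(j in stencil D phi i) X j).2) sum3; congr (_ - _).
  by apply: eq_bigr => j _; rewrite XE; have [_ _ E] := FS j; exact: E.
Qed.
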